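(* Let $\hat\theta_n$ be a supervised estimator of $\theta^*=\theta(\mathbb P^* )\in\mathbb R^p$ with influence function $\varphi_{\eta^*}$ and let $\tilde\eta_n$ be an estimator of $\eta^*$ such that: (a) $\hat\theta_n=\hat\theta(\mathcal L_n)$ is a regular and asymptotically linear estimator of $\theta^*$ with influence function $\varphi_{\eta^*}(z)$; (b) there is a set $\mathcal O\subset\Omega$ with $\eta^*\in\mathcal O$ such that $\{\varphi_\eta(z):\eta\in\mathcal O\}$ is $\mathbb P^*$-Donsker and $\|\varphi_{\eta_1}(z)-\varphi_{\eta_2}(z)\|\le L(z)\rho(\eta_1,\eta_2)$ for all $\eta_1,\eta_2\in\mathcal O$, with $L:\mathcal Z\to\mathbb R^+$ square integrable; (c) $\mathbb P^*\{\tilde\eta_n\in\mathcal O\}\to1$ and $\rho(\tilde\eta_n,\eta^* )=o_p(1)$. Let $g:\mathcal X\to\mathbb R^d$ satisfy $\mathbb E\|g(X)\|^2<\infty$ with $\mathrm{Var}[g(X)]$ non-singular, and let $g^0(x)=g(x)-\mathbb E[g(X)]$. Define $$\hat{\mathbf B}^g_n=\Big[\tfrac1n\sum_{i=1}^n\varphi_{\tilde\eta_n}(Z_i)g^0(X_i)^\top\Big]\mathbb E[g^0(X)g^0(X)^\top]^{-1},\qquad \hat\theta^{\mathrm{safe}}_{n,\mathbb P_X^*}=\hat\theta_n-\tfrac1n\sum_{i=1}^n\hat{\mathbf B}_n^g g^0(X_i),$$ $$\mathbf B^g=\mathbb E[\varphi_{\eta^*}(Z)g^0(X)^\top]\,\mathbb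 E[g^0(X)g^0(X)^\top]^{-1}.$$ Then $\hat\theta^{\mathrm{safe}}_{n,\mathbb P_X^*}$ is a regular and asymptotically linear estimator of $\theta^*$ with influence function $\varphi_{\eta^*}(z)-\mathbf B^gg^0(x)$ and asymptotic variance $\mathrm{Var}[\varphi_{\eta^*}(Z)-\mathbf B^gg^0(X)]$. Moreover, with $\phi_{\eta^*}(x)=\mathbb E[\varphi_{\eta^*}(Z)\mid X=x]$, $$\mathrm{Var}[\varphi_{\eta^*}(Z)-\mathbf B^gg^0(X)]=\mathrm{Var}[\varphi_{\eta^*}(Z)-\phi_{\eta^*}(X)]+\mathrm{Var}[\phi_{\eta^*}(X)-\mathbf B^gg^0(X)]\preceq\mathrm{Var}[\varphi_{\eta^*}(Z)].$$
   Context: $Z=(X,Y)\in\mathcal Z=\mathcal X\times\mathcal Y$, $Z\sim\mathbb P^*=\mathbb P_X^*\mathbb P_{Y\mid X}^*$ in the model $\mathcal P=\{\mathbb P_X\mathbb P_{Y\mid X}:\mathbb P_X\in\mathcal P_X,\mathbb P_{Y\mid X}\in\mathcal P_{Y\mid X}\}$ (dominated by a common measure); $\theta:\mathcal P\to\Theta\subseteq\mathbb R^p$. Labeled data $\mathcal L_n=\{Z_i\}_{i=1}^n$ are i.i.d. from $\mathbb P^*$. Ideal semi-supervised (ISS) setting: in addition the marginal $\mathbb P_X^*$ is known, so the model is $\{\mathbb P_X^*\}\otimes\mathcal P_{Y\mid X}=\{\mathbb P_X^*\mathbb P_{Y\mid X}:\mathbb P_{Y\mid X}\in\mathcal P_{Y\mid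 X}\}$ and estimators may depend on $\mathbb P_X^*$. $\eta:\mathcal P\to\Omega$ is a (possibly infinite-dimensional) functional into a metric space $(\Omega,\rho)$, $\eta^*=\eta(\mathbb P^* )$, and $\{\varphi_\eta:\eta\in\Omega\}$ are $\mathbb R^p$-valued functions on $\mathcal Z$. Vector-valued Donsker classes are understood coordinatewise. An estimator is asymptotically linear with influence function $\varphi$ (square integrable, mean zero under $\mathbb P^*$) if $\sqrt n(\hat\theta_n-\theta^* )=n^{-1/2}\sum_{i=1}^n\varphi(Z_i)+o_p(1)$. It is regular relative to a model $\mathcal M\ni\mathbb P^*$ if for every one-dimensional sub-model $\{\mathbb P_t:t\in T\subset\mathbb R\}\subset\mathcal M$ with $\mathbb P_{t^*}=\mathbb P^*$ that is differentiable in quadratic mean at $t^*$, and every $h\in\mathbb R$, $\sqrt n[\hat\theta_n-\theta(\mathbb P_{t^*+h/\sqrt n})]$ converges in distribution under $\mathbb P_{t^*+h/\sqrt n}$ to a law not depending on $h$. The initial $\hat\theta_n$ is regular relative to $\mathcal P$; regularity of the ISS estimator is relative to the ISS model $\{\mathbb P_X^*\}\otimes\mathcal P_{Y\mid X}$. $A\preceq B$ means $B-A$ is positive semidefinite. *)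

(* Defs.v *)
From HB Require Import structures.
From mathcomp Require Import all_boot all_order all_algebra.
From mathcomp Require Import all_classical all_reals all_analysis.

Set Implicit Arguments.
Unset Strict Implicit.
Unset Printing Implicit Defensive.

Import Order.TTheory GRing.Theory Num.Theory.
Import numFieldNormedType.Exports.

Local Open Scope classical_set_scope.
Local Open Scope ring_scope.

Section linear_algebra.
Context {R : realType}.

(* The Euclidean norm; the library norm of matrices is the sup norm. *)
Definition enorm m (v : 'cV[R]_m) : R := Num.sqrt (\sum_i v i ord0 ^+ 2).

Definition psdmx m (A : 'M[R]_m) : Prop :=
  A^T = A /\ forall v : 'cV[R]_m, 0 <= (v^T *m A *m v) ord0 ord0.

Definition loewner_le m (A B : 'M[R]_m) : Prop := psdmx (B - A).

End linear_algebra.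

Section moments.
Context {d : measure_display} {T : measurableType d} {R : realType}.

Definition Emx (P : probability T R) m n (f : T -> 'M[R]_(m, n)) : 'M[R]_(m, n) :=
  \matrix_(i, j) fine ('E_P[fun z => f z i j])%E.

Definition Varmx (P : probability T R) m (f : T -> 'cV[R]_m) : 'M[R]_m :=
  \matrix_(i, j)
    fine (covariance P (fun z => f z i ord0) (fun z => f z j ord0)).

Definition square_integrable (P : probability T R) m (f : T -> 'cV[R]_m) :
    Prop :=
  forall i, (fun z => f z i ord0) \in Lfun P 2%:E.

End moments.

Section iid_sample.
Context {d : measure_display} {Z : measurableType d} {R : realType}.

Definition cons_sample n (u : Z * n.-tuple Z) : n.+1.-tuple Z :=
  [tuple of u.1 :: u.2].

Lemma measurable_cons_sample n : measurable_fun [set: _] (@cons_sample n).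
Proof. by apply: measurable_cons. Qed.

HB.instance Definition _ n :=
  isMeasurableFun.Build _ _ _ _ (@cons_sample n) (@measurable_cons_sample n).

(* The law P^n of a sample (Z_1, ..., Z_n) of i.i.d. draws from P. *)
Fixpoint iid (P : probability Z R) n : probability (n.-tuple Z) R :=
  match n with
  | 0%N => \d_([tuple] : 0.-tuple Z)
  | m.+1 => distribution (P \x iid P m)%E (@cons_sample m)
  end.

End iid_sample.

Section stochastic_convergence.
Context {R : realType}.

(* Outer expectation of van der Vaart and Wellner; statistics are arbitrary
   maps on the sample space, and all the modes of convergence below are
   understood with outer probabilities and expectations, which are the ordinary
   ones for measurable statistics. *)
Definition outer_expectation {d} {T : measurableType d} (P : probability T R)
    (f : T -> R) : \bar R :=
  ereal_inf [set (\int[P]_z (g z)%:E)%E | g in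
    [set g : T -> R | P.-integrable [set: T] (EFin \o g) /\
                      forall z, f z <= g z]].

Definition outer_probability {d} {T : measurableType d} (P : probability T R)
    (A : set T) : \bar R := mu_ext P A.

Definition inner_probability {d} {T : measurableType d} (P : probability T R)
    (A : set T) : \bar R := (1 - outer_probability P (~` A))%E.

Context {d : measure_display} {Z : measurableType d}.

Definition o_p1 (P : probability Z R) (W : forall n, n.-tuple Z -> R) : Prop :=
  forall e : R, 0 < e ->
    outer_probability (iid P n) [set z | e < `|W n z|] @[n --> \oo] --> 0%E.

Definition borel (S : ptopologicalType) := g_sigma_algebraType (@open S).

(* Convergence in distribution (in the sense of Hoffmann-Jorgensen) of X_n to
   the Borel law L, the n-th sample being drawn from Q n. *)
Definition cvg_in_distribution {S : ptopologicalType}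
    (Q : forall n, probability (n.-tuple Z) R) (X : forall n, n.-tuple Z -> S)
    (L : probability (borel S) R) : Prop :=
  forall f : S -> R, continuous f -> bounded_fun f ->
    outer_expectation (Q n) (f \o X n) @[n --> \oo] --> (\int[L]_x (f x)%:E)%E.

End stochastic_convergence.

Section donsker.
Context {d : measure_display} {Z : measurableType d} {R : realType}.

Definition bounded_on (F : set (Z -> R)) : set (arrow_uniform_type F R) :=
  [set h | bounded_fun (h : F -> R)].

(* l^oo(F): bounded real functions on the class F, with the uniform topology. *)
Definition linfty (F : set (Z -> R)) : Type := set_type (@bounded_on F).

Section linfty_structure.
Variable F : set (Z -> R).

HB.instance Definition _ := Uniform.on (linfty F).

Let linfty0_subproof :
  ((fun _ => 0) : arrow_uniform_type F R) \in @bounded_on F.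
Proof.
apply/mem_set; exists 0; split; first exact: real0.
by move=> x x0 f _; rewrite normr0 ltW.
Qed.

Definition linfty0 : linfty F :=
  exist _ (_ : arrow_uniform_type F R) linfty0_subproof.

HB.instance Definition _ := isPointed.Build (linfty F) linfty0.

End linfty_structure.

Definition linfty_tight F (L : probability (borel (linfty F)) R) : Prop :=
  forall e : R, 0 < e ->
    exists2 K : set (linfty F), compact K & ((1 - e)%:E <= L K)%E.

Definition empirical_process (P : probability Z R) n (z : n.-tuple Z)
    (f : Z -> R) : R :=
  Num.sqrt n%:R * (n%:R^-1 * \sum_(i < n) f (tnth z i) - fine ('E_P[f])%E).

(* The existence of G says that all sample paths are bounded on F.  The limit L
   need not be assumed Gaussian: its finite-dimensional laws are determined by
   the central limit theorem. *)
Definition donsker (P : probability Z R) (F : set (Z -> R)) : Prop :=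
  (forall f, F f -> f \in Lfun P 2%:E) /\
  exists2 G : forall n, n.-tuple Z -> linfty F,
    forall n (z : n.-tuple Z) (f : F),
      (sval (G n z) : F -> R) f = empirical_process P z (sval f) &
    exists2 L : probability (borel (linfty F)) R,
      linfty_tight L & cvg_in_distribution (iid P) G L.

Definition vector_donsker (P : probability Z R) m
    (F : set (Z -> 'cV[R]_m)) : Prop :=
  forall i : 'I_m, donsker P [set (fun z => f z i ord0) | f in F].

End donsker.

Section models.
Context {dx dy : measure_display} {X : measurableType dx}
  {Y : measurableType dy} {R : realType}.

Definition is_joint (PX : probability X R) (K : R.-pker X ~> Y)
    (P : probability (X * Y)%type R) : Prop :=
  forall A, measurable A -> P A = (\int[PX]_x K x (xsection A x))%E.

Definition model (PXs : set (probability X R)) (PYXs : set (R.-pker X ~> Y)) :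
    set (probability (X * Y)%type R) :=
  [set P | exists PX K, [/\ PXs PX, PYXs K & is_joint PX K P]].

(* phi0 is a version of x |-> E[phi(Z) | X = x]. *)
Definition is_cond_exp (P : probability (X * Y)%type R) m
    (phi : X * Y -> 'cV[R]_m) (phi0 : X -> 'cV[R]_m) : Prop :=
  forall i : 'I_m,
    [/\ measurable_fun [set: X] (fun x => phi0 x i ord0),
        P.-integrable [set: X * Y] (fun z => (phi0 z.1 i ord0)%:E) &
        forall A : set X, measurable A ->
          (\int[P]_(z in A `*` [set: Y]) (phi0 z.1 i ord0)%:E =
           \int[P]_(z in A `*` [set: Y]) (phi z i ord0)%:E)%E].

End models.

Section estimators.
Context {d : measure_display} {Z : measurableType d} {R : realType}.

Definition is_density (mu : {measure set Z -> \bar R}) (P : probability Z R)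
    (f : Z -> R) : Prop :=
  [/\ measurable_fun [set: Z] f, forall z, 0 <= f z &
      forall A, measurable A -> P A = (\int[mu]_(z in A) (f z)%:E)%E].

(* Square integrability of the score s is automatic from the limit. *)
Definition dqm (mu : {measure set Z -> \bar R}) (T : set R) (t0 : R)
    (P : R -> probability Z R) : Prop :=
  exists (f : R -> Z -> R) (s : Z -> R),
    [/\ forall t, T t -> is_density mu (P t) (f t),
        s \in Lfun (P t0) 2%:E &
        ((((t - t0) ^+ 2)^-1)%:E *
          \int[mu]_z ((Num.sqrt (f t z) - Num.sqrt (f t0 z)
             - (t - t0) / 2 * s z * Num.sqrt (f t0 z)) ^+ 2)%:E)%E
          @[t --> t0^'] --> 0%E].

Definition asymptotically_linear (P : probability Z R) m
    (est : forall n, n.-tuple Z -> 'cV[R]_m) (theta0 : 'cV[R]_m)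
    (phi : Z -> 'cV[R]_m) : Prop :=
  [/\ square_integrable P phi,
      Emx P phi = 0 &
      o_p1 P (fun n z => enorm (Num.sqrt n%:R *: (est n z - theta0)
        - (Num.sqrt n%:R)^-1 *: \sum_(i < n) phi (tnth z i)))].

(* t0 is interior to T, so that P (t0 + h / sqrt n) belongs to the submodel for
   all large n; the earlier terms do not matter. *)
Definition regular (mu : {measure set Z -> \bar R})
    (M : set (probability Z R)) (Pstar : probability Z R) m
    (theta : probability Z R -> 'cV[R]_m)
    (est : forall n, n.-tuple Z -> 'cV[R]_m) : Prop :=
  forall (T : set R) (t0 : R) (P : R -> probability Z R),
    nbhs t0 T -> (forall t, T t -> M (P t)) -> P t0 = Pstar -> dqm mu T t0 P ->
    exists L : probability (borel 'cV[R]_m) R, forall h : R,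
      let Pn n := P (t0 + h / Num.sqrt n%:R) in
      cvg_in_distribution (fun n => iid (Pn n) n)
        (fun n z => Num.sqrt n%:R *: (est n z - theta (Pn n))) L.

(* normal_prob is not the Dirac mass when its standard deviation is 0. *)
Definition normal_law (v : R) (A : set R) : \bar R :=
  if v == 0 then \d_(0 : R) A else normal_prob 0 (Num.sqrt v) A.

Definition centered_gaussian m (V : 'M[R]_m)
    (L : probability (borel 'cV[R]_m) R) : Prop :=
  forall (a : 'cV[R]_m) (A : set R), measurable A ->
    L [set x : 'cV[R]_m | A ((a^T *m x) ord0 ord0)] =
    normal_law ((a^T *m V *m a) ord0 ord0) A.

Definition asymptotic_variance (P : probability Z R) m
    (est : forall n, n.-tuple Z -> 'cV[R]_m) (theta0 : 'cV[R]_m)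
    (V : 'M[R]_m) : Prop :=
  exists2 L : probability (borel 'cV[R]_m) R, centered_gaussian V L &
    cvg_in_distribution (iid P)
      (fun n z => Num.sqrt n%:R *: (est n z - theta0)) L.

End estimators.

Section safe_estimator.
Context {dx dy : measure_display} {X : measurableType dx}
  {Y : measurableType dy} {R : realType} {p d : nat}.
Variables (PX : probability X R) (g : X -> 'cV[R]_d).

Definition centered (x : X) : 'cV[R]_d := g x - Emx PX g.

Definition gram : 'M[R]_d := Emx PX (fun x => centered x *m (centered x)^T).

Definition Bg (P : probability (X * Y)%type R) (phi : X * Y -> 'cV[R]_p) :
    'M[R]_(p, d) :=
  Emx P (fun z => phi z *m (centered z.1)^T) *m invmx gram.

Definition Bhat n (phi : X * Y -> 'cV[R]_p) (z : n.-tuple (X * Y)%type) :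
    'M[R]_(p, d) :=
  (n%:R^-1 *: \sum_(i < n) phi (tnth z i) *m (centered (tnth z i).1)^T)
    *m invmx gram.

Definition theta_safe {Omega : Type} (phi : Omega -> X * Y -> 'cV[R]_p)
    (thetahat : forall n, n.-tuple (X * Y)%type -> 'cV[R]_p)
    (etatilde : forall n, n.-tuple (X * Y)%type -> Omega)
    n (z : n.-tuple (X * Y)%type) : 'cV[R]_p :=
  thetahat n z -
    n%:R^-1 *: \sum_(i < n)
      Bhat (phi (etatilde n z)) z *m centered (tnth z i).1.

End safe_estimator.

(* Main.v *)
Require Import Defs.
From HB Require Import structures.
From mathcomp Require Import all_boot all_order all_algebra.
From mathcomp Require Import all_classical all_reals all_analysis.
From mathcomp Require Import measurable_realfun ring lra.

Set Implicit Arguments.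
Unset Strict Implicit.
Unset Printing Implicit Defensive.

Import Order.TTheory GRing.Theory Num.Theory.
Import numFieldNormedType.Exports.

Local Open Scope classical_set_scope.
Local Open Scope ring_scope.

(* The correction subtracted from thetahat is, up to o_p(n^(-1/2)), the empirical
   mean of B g0(X): the Lipschitz bound and the law of large numbers give
   Bhat -> B, while n^(-1/2) sum_i g0(X_i) is tight.  Since B g0 is the
   L^2-projection of phi on the span of g0, and phi - E[phi | X] is orthogonal to
   every square integrable function of X, the variance statements follow.

   For regularity, write s for the score of a submodel and P_n for its law at
   t0 + h / sqrt n.  The laws P_n^n are contiguous to Pstar^n, by comparing P_n
   with an intermediate law of bounded likelihood ratio (close to P_n for the
   Hellinger distance and to Pstar for the chi-square distance), so the linear
   expansions persist under P_n^n, where n^(-1/2) sum_i psi(Z_i) tends to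
   N(h E[psi s], Var psi).  For psi = phi, the regularity of thetahat then forces
   sqrt n (theta(P_n) - theta(Pstar)) -> h E[phi s].  When the law of X is known,
   s is orthogonal to every function of X, so that phi and phi - B g0 have the
   same drift and the limit law of the new estimator does not depend on h.

   Statistics need not be measurable, so limits in distribution are obtained
   from trigonometric moments: on boxes, a bounded continuous function is
   uniformly approximated by its Bernstein polynomials in the sin(x_j / K). *)

(** * Integration *)

(** The intermediate law is forced: n times the squared Hellinger distance from P_n to Pstar stays
    bounded but in general does not tend to 0, while the likelihood ratio of P_n to Pstar may have
    no second moment, so that neither distance suffices alone. Truncating the score at a level M
    gives a law whose Hellinger error is small once M is large and whose chi-square factor stays
    bounded in n for fixed M.

    No smoothness of [theta] is assumed. Its local drift is read off by comparing two limits of one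
    and the same statistic under two centrings.

    Outer expectations are monotone but not additive. Each estimator is therefore compared with a
    measurable normalized sum, and its test functions are squeezed between integrable ones. Cosines
    with an arbitrary phase play the part of complex characteristic functions, so that all integrals
    stay real. *)

Section real_integrals.
Context {d : measure_display} {T : measurableType d} {R : realType}.
Implicit Types (m : {measure set T -> \bar R}) (f g k : T -> R).

Definition L1 m f : Prop := m.-integrable [set: T] (EFin \o f).

(** Measurability is a separate clause, since integrability of the square gives it for [f ^+ 2]
    only. *)
Definition L2 m f : Prop :=
  measurable_fun [set: T] f /\ L1 m (fun x => f x ^+ 2).

Lemma L1_measurable m f : L1 m f -> measurable_fun [set: T] f.
Proof. by move=> /integrableP[/measurable_EFinP]. Qed.

Lemma L1D m f g : L1 m f -> L1 m g -> L1 m (fun x => f x + g x).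
Proof. by move=> mf mg; exact: (integrableD measurableT mf mg). Qed.

Lemma L1B m f g : L1 m f -> L1 m g -> L1 m (fun x => f x - g x).
Proof. by move=> mf mg; exact: (integrableB measurableT mf mg). Qed.

Lemma L1Z m (c : R) f : L1 m f -> L1 m (fun x => c * f x).
Proof. by move=> mf; exact: (integrableZl measurableT c mf). Qed.

Lemma L1_norm m f : L1 m f -> L1 m (fun x => `|f x|).
Proof. by move=> mf; exact: (integrable_norm mf). Qed.

Lemma L1_le m f g : measurable_fun [set: T] f ->
  (forall x, `|f x| <= g x) -> L1 m g -> L1 m f.
Proof.
move=> mf fg; apply: le_integrable => //; first exact/measurable_EFinP.
by move=> x _ /=; rewrite lee_fin (le_trans (fg x))// ler_norm.
Qed.

Lemma L1_sum m (I : Type) (r : seq I) (f : I -> T -> R) :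
  (forall i, L1 m (f i)) -> L1 m (fun x => \sum_(i <- r) f i x).
Proof.
move=> mf; elim: r => [|i r IH].
  rewrite (_ : (fun _ => _) = cst 0); first exact: integrable0.
  by apply/funext => x; rewrite big_nil.
rewrite (_ : (fun _ => _) = (fun x => f i x + \sum_(j <- r) f j x)).
  exact: L1D.
by apply/funext => x; rewrite big_cons.
Qed.

Lemma RintD m f g : L1 m f -> L1 m g ->
  \int[m]_x (f x + g x) = \int[m]_x f x + \int[m]_x g x.
Proof. by move=> mf mg; rewrite RintegralD. Qed.

Lemma RintB m f g : L1 m f -> L1 m g ->
  \int[m]_x (f x - g x) = \int[m]_x f x - \int[m]_x g x.
Proof. by move=> mf mg; rewrite RintegralB. Qed.

Lemma RintZ m (c : R) f : L1 m f ->
  \int[m]_x (c * f x) = c * \int[m]_x f x.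
Proof. by move=> mf; rewrite RintegralZl. Qed.

Lemma Rint_sum m (I : Type) (r : seq I) (f : I -> T -> R) :
  (forall i, L1 m (f i)) ->
  \int[m]_x (\sum_(i <- r) f i x) = \sum_(i <- r) \int[m]_x f i x.
Proof.
move=> mf; elim: r => [|i r IH].
  under eq_Rintegral do rewrite big_nil.
  by rewrite big_nil /Rintegral integral0.
under eq_Rintegral do rewrite big_cons.
by rewrite big_cons RintD ?IH//; exact: L1_sum.
Qed.

Lemma Rint_le m f g : L1 m f -> L1 m g -> (forall x, f x <= g x) ->
  \int[m]_x f x <= \int[m]_x g x.
Proof. by move=> mf mg fg; apply: le_Rintegral. Qed.

Lemma Rint_ge0 m f : (forall x, 0 <= f x) -> 0 <= \int[m]_x f x.
Proof. by move=> f0; apply: Rintegral_ge0. Qed.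

Lemma Rint_norm m f : L1 m f -> `|\int[m]_x f x| <= \int[m]_x `|f x|.
Proof. by move=> mf; apply: le_normr_Rintegral. Qed.

Lemma Rint_norm_le m f g : measurable_fun [set: T] f -> L1 m g ->
  (forall x, `|f x| <= g x) -> `|\int[m]_x f x| <= \int[m]_x g x.
Proof.
move=> mf mg fg; have lf := L1_le mf fg mg.
by apply: (le_trans (Rint_norm lf)); apply: Rint_le => //; exact: L1_norm.
Qed.

Lemma EFin_Rint m f : L1 m f ->
  (\int[m]_x (f x)%:E)%E = (\int[m]_x f x)%:E.
Proof. by move=> mf; rewrite /Rintegral fineK// integrable_fin_num. Qed.

Lemma dominated_cvgR m (f_ : nat -> T -> R) f g :
  (forall n, measurable_fun [set: T] (f_ n)) ->
  (forall x, f_ n x @[n --> \oo] --> f x) ->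
  L1 m g -> (forall n x, `|f_ n x| <= g x) ->
  \int[m]_x f_ n x @[n --> \oo] --> \int[m]_x f x.
Proof.
move=> mf cf mg fg.
have mlim : measurable_fun [set: T] f.
  by apply: (measurable_fun_cvg mf) => x _; exact: cf.
have fgx x : `|f x| <= g x.
  have cn : `|f_ n x| @[n --> \oo] --> `|f x| by apply: cvg_norm; exact: cf.
  rewrite -(cvg_lim _ cn)//; apply: limr_le; last by apply: nearW => n; exact: fg.
  by apply/cvg_ex; eexists; exact: cn.
apply: fine_cvg; rewrite /Rintegral fineK; last first.
  by apply: integrable_fin_num => //; exact: L1_le mg.
apply: (@dominated_cvg _ _ _ m _ measurableT
   (fun n x => (f_ n x)%:E) (fun x => (f x)%:E) (fun x => (g x)%:E)) => //.
- by move=> n; exact/measurable_EFinP.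
- by move=> x _; apply: cvg_EFin; [exact: nearW|exact: cf].
- by move=> n x _; rewrite lee_fin.
Qed.

Lemma L1M_L2 m f g : L2 m f -> L2 m g -> L1 m (fun x => f x * g x).
Proof.
move=> [mf f2] [mg g2].
apply: (@L1_le _ _ (fun x => f x ^+ 2 + g x ^+ 2)).
- exact: measurable_funM.
- move=> x; rewrite normrM -(real_normK (num_real (f x))).
  rewrite -(real_normK (num_real (g x))).
  by have := sqr_ge0 (`|f x| - `|g x|); have := sqr_ge0 (`|f x| + `|g x|); nra.
- exact: L1D.
Qed.

Lemma L2_dom m f g : measurable_fun [set: T] f ->
  (forall x, `|f x| <= `|g x|) -> L2 m g -> L2 m f.
Proof.
move=> mf fg [mg g2]; split => //; apply: L1_le g2.
  exact: measurable_funX.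
move=> x; rewrite normrX -[leRHS]real_normK ?num_real//.
by apply: lerXn2r; rewrite ?nnegrE.
Qed.

Lemma L2Z m (c : R) f : L2 m f -> L2 m (fun x => c * f x).
Proof.
move=> [mf f2]; split; first exact: measurable_funM.
rewrite (_ : (fun _ => _) = (fun x => c ^+ 2 * f x ^+ 2)); first exact: L1Z.
by apply/funext => x; rewrite exprMn.
Qed.

Lemma L2D m f g : L2 m f -> L2 m g -> L2 m (fun x => f x + g x).
Proof.
move=> mf mg; have fg := L1M_L2 mf mg.
case: mf mg => mf f2 [mg g2]; split; first exact: measurable_funD.
rewrite (_ : (fun _ => _) =
  (fun x => f x ^+ 2 + (2 * (f x * g x) + g x ^+ 2))).
  by apply: L1D => //; apply: L1D => //; exact: L1Z.
by apply/funext => x; ring.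
Qed.

Lemma L2B m f g : L2 m f -> L2 m g -> L2 m (fun x => f x - g x).
Proof.
move=> mf mg; rewrite (_ : (fun _ => _) = (fun x => f x + (-1) * g x)).
  by apply: L2D => //; exact: L2Z.
by apply/funext => x; rewrite mulN1r.
Qed.

Lemma L2_norm m f : L2 m f -> L2 m (fun x => `|f x|).
Proof.
move=> mf; apply: L2_dom (mf).
  by apply: measurableT_comp => //; case: mf.
by move=> x; rewrite normr_id.
Qed.

Lemma L2_sum m (I : Type) (r : seq I) (f : I -> T -> R) :
  (forall i, L2 m (f i)) -> L2 m (fun x => \sum_(i <- r) f i x).
Proof.
move=> mf; elim: r => [|i r IH].
  rewrite (_ : (fun _ => _) = cst 0); last first.
    by apply/funext => x; rewrite big_nil.
  split=> //; rewrite (_ : (fun _ => _) = cst 0); first exact: integrable0.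
  by apply/funext => x; rewrite expr0n.
rewrite (_ : (fun _ => _) = (fun x => f i x + \sum_(j <- r) f j x)).
  exact: L2D.
by apply/funext => x; rewrite big_cons.
Qed.

(** The integral of [(t * f x + g x) ^+ 2] is a nonnegative quadratic polynomial in [t], evaluated
    at its minimizer [- c / a]. *)
Lemma Rint_cauchy_schwarz m f g : L2 m f -> L2 m g ->
  (\int[m]_x (f x * g x)) ^+ 2 <= \int[m]_x (f x ^+ 2) * \int[m]_x (g x ^+ 2).
Proof.
move=> mf mg; have fg := L1M_L2 mf mg.
case: mf mg => mf f2 [mg g2].
set a := \int[m]_x (f x ^+ 2); set b := \int[m]_x (g x ^+ 2).
set c := \int[m]_x (f x * g x).
have q t : 0 <= t ^+ 2 * a + 2 * t * c + b.
  have -> : t ^+ 2 * a + 2 * t * c + b = \int[m]_x ((t * f x + g x) ^+ 2).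
    transitivity (\int[m]_x (t ^+ 2 * f x ^+ 2 + 2 * t * (f x * g x) + g x ^+ 2)).
      rewrite RintD// ?RintD ?RintZ//; try exact: L1Z.
      by apply: L1D; exact: L1Z.
    by apply: eq_Rintegral => x _; ring.
  by apply: Rint_ge0 => x; exact: sqr_ge0.
have a0 : 0 <= a by apply: Rint_ge0 => x; exact: sqr_ge0.
have [a00|an0] := eqVneq a 0.
  have [->|c0] := eqVneq c 0; first by rewrite a00 mul0r expr0n.
  (* With leading coefficient 0 the polynomial is affine, and this [t] gives it the value -1. *)
  have := q (- (b + 1) / (2 * c)); rewrite a00 mulr0 add0r.
  have -> : 2 * (- (b + 1) / (2 * c)) * c = - (b + 1) by field.
  by lra.
have ap : 0 < a by rewrite lt_neqAle eq_sym an0.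
have := q (- c / a).
have -> : (- c / a) ^+ 2 * a + 2 * (- c / a) * c + b = (a * b - c ^+ 2) / a.
  by field.
by rewrite pmulr_lge0 ?invr_gt0// subr_ge0.
Qed.

Lemma L2_cst m (c : R) : (m [set: T] < +oo)%E -> L2 m (cst c).
Proof.
move=> mT; split=> //.
exact: (@measurable_bounded_integrable _ _ _ m (fun=> c ^+ 2) _ measurableT
  mT (measurable_cst _) (bounded_cst _ _)).
Qed.

Lemma L1_bounded m f (C : R) : (m [set: T] < +oo)%E ->
  measurable_fun [set: T] f -> (forall x, `|f x| <= C) -> L1 m f.
Proof.
move=> mT mf fC; apply: (L1_le mf (g := fun=> C)) => //.
exact: (@measurable_bounded_integrable _ _ _ m (fun=> C) _ measurableT
  mT (measurable_cst _) (bounded_cst _ _)).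
Qed.

Lemma L2_L1 m f : (m [set: T] < +oo)%E -> L2 m f -> L1 m f.
Proof.
move=> mT mf; rewrite (_ : f = (fun x => f x * 1)).
  exact: (L1M_L2 mf (L2_cst 1 mT)).
by apply/funext => x; rewrite mulr1.
Qed.

Lemma Lfun2P m f : f \in Lfun m 2%:E <-> L2 m f.
Proof.
split=> [mf|[mf f2]].
  split; last exact: Lfun2_integrable_sqr.
  by have := sub_Lfun_mfun mf; rewrite inE.
apply/andP; split; rewrite inE//=.
rewrite /finite_norm Lnorm.unlock /=.
have -> : (\int[m]_x (`|(f x)%:E| `^ 2))%E = (\int[m]_x ((f x) ^+ 2)%:E)%E.
  apply: eq_integral => x _ /=; rewrite powR_mulrn// real_normK//.
  exact: num_real.
by rewrite (EFin_Rint f2) poweR_EFin ltry.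
Qed.

End real_integrals.

Section probability_integrals.
Context {d : measure_display} {T : measurableType d} {R : realType}.
Context {P : probability T R}.

Lemma probability_fin : (P [set: T] < +oo)%E.
Proof. by rewrite probability_setT ltry. Qed.

Lemma L2_L1_prob f : L2 P f -> L1 P f.
Proof. exact: L2_L1 probability_fin. Qed.

Lemma L1_bounded_prob (f : T -> R) (C : R) : measurable_fun [set: T] f ->
  (forall x, `|f x| <= C) -> L1 P f.
Proof. exact: L1_bounded probability_fin. Qed.

Lemma L1_cst (c : R) : L1 P (fun=> c).
Proof. exact: (L1_bounded_prob (C := `|c|)). Qed.

Lemma Rint_cst (c : R) : \int[P]_x c = c.
Proof.
by rewrite Rintegral_cst// /= probability_setT mulr1.
Qed.

Lemma Rint_bounded (f : T -> R) (C : R) : measurable_fun [set: T] f ->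
  (forall x, `|f x| <= C) -> `|\int[P]_x f x| <= C.
Proof.
move=> mf fC; rewrite -[leRHS]Rint_cst.
by apply: Rint_norm_le => //; exact: L1_cst.
Qed.

Lemma expectation_Rint (f : T -> R) : fine ('E_P[f])%E = \int[P]_x f x.
Proof. by rewrite unlock. Qed.

Lemma Rint_indic (A : set T) : measurable A -> \int[P]_x \1_A x = fine (P A).
Proof. by move=> mA; rewrite /Rintegral integral_indic// setIT. Qed.

Lemma markovR (f : T -> R) (a : R) : 0 < a -> L1 P f -> (forall x, 0 <= f x) ->
  fine (P [set x | a <= f x]) <= (\int[P]_x f x) / a.
Proof.
move=> a0 f1 f0; have mf := L1_measurable f1.
have mA : measurable [set x | a <= f x].
  by rewrite -[X in measurable X]setTI; exact: measurable_fun_le.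
rewrite -Rint_indic// ler_pdivlMr// mulrC -RintZ; last first.
  apply: (L1_bounded_prob (C := 1)); first exact: measurable_indic.
  by move=> x; rewrite indicE; case: (_ \in _); rewrite ?normr1 ?normr0.
apply: Rint_le => //.
  apply: L1Z; apply: (L1_bounded_prob (C := 1)); first exact: measurable_indic.
  by move=> x; rewrite indicE; case: (_ \in _); rewrite ?normr1 ?normr0.
move=> x; rewrite indicE; case: (boolP (x \in _)) => [/set_mem /=|_].
  by rewrite mulr1.
by rewrite mulr0.
Qed.

End probability_integrals.

(** * Change of variables between weighted measures *)

Section transfer.
Context {d1 d2 d3 : measure_display} {T1 : measurableType d1}
  {T2 : measurableType d2} {T : measurableType d3} {R : realType}.
Import HBNNSimple.

Let integral_nnsfun_weighted d' (T' : measurableType d')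
    (m : {measure set T' -> \bar R}) (h : T' -> T) (D : T' -> R)
    (s : {nnsfun T >-> R}) :
  measurable_fun [set: T'] h -> measurable_fun [set: T'] D ->
  (forall x, 0 <= D x) ->
  (\int[m]_x (s (h x) * D x)%:E =
   \sum_(r \in range s)
      (r%:E * \int[m]_(x in h @^-1` (s @^-1` [set r])) (D x)%:E))%E.
Proof.
move=> mh mD D0.
have mpre r : measurable (h @^-1` (s @^-1` [set r])).
  by rewrite -[X in measurable X]setTI; exact: mh.
transitivity (\int[m]_x \sum_(r \in range s)
    (r * (\1_(h @^-1` (s @^-1` [set r])) x * D x))%:E)%E.
  apply: eq_integral => x _; rewrite fsumEFin// fimfunE; congr EFin.
  rewrite !fsbig_finite//= mulr_suml; apply: eq_bigr => r _.
  by rewrite mulrA.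
rewrite ge0_integral_fsum//; last 2 first.
- move=> r; apply/measurable_EFinP; apply: measurable_funM => //.
  exact: measurable_funM.
- move=> r x _; rewrite lee_fin indicE.
  have [/set_mem /= <-|_] := boolP (x \in _); last by rewrite mul0r mulr0.
  by rewrite mul1r mulr_ge0.
apply: eq_fsbigr => r /set_mem [y _ <-].
under eq_integral do rewrite EFinM.
rewrite ge0_integralZl//; last 3 first.
- by apply/measurable_EFinP; apply: measurable_funM.
- by move=> x _; rewrite lee_fin mulr_ge0.
- by rewrite lee_fin.
congr (_ * _)%E; rewrite [RHS]integral_mkcond; apply: eq_integral => x _.
rewrite patchE indicE; case: ifP => _; first by rewrite mul1r.
by rewrite mul0r.
Qed.

Let integral_weighted_lim d' (T' : measurableType d')
    (m : {measure set T' -> \bar R}) (h : T' -> T) (D : T' -> R)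
    (k : T -> \bar R) (mk : measurable_fun [set: T] k) :
  measurable_fun [set: T'] h -> measurable_fun [set: T'] D ->
  (forall x, 0 <= D x) -> (forall x, (0 <= k x)%E) ->
  (\int[m]_x (k (h x) * (D x)%:E) =
   limn (fun n => \int[m]_x (nnsfun_approx measurableT mk n (h x) * D x)%:E))%E.
Proof.
move=> mh mD D0 k0; rewrite -monotone_convergence//.
- apply: eq_integral => x _; apply/esym/cvg_lim => //.
  under eq_cvg do rewrite EFinM.
  by apply: cvgeZr => //; apply: cvg_nnsfun_approx.
- move=> n; apply/measurable_EFinP; apply: measurable_funM => //.
  exact: measurableT_comp.
- by move=> n x _; rewrite lee_fin mulr_ge0.
- move=> x _ n p np; rewrite lee_fin ler_wpM2r//.
  exact/lefP/nd_nnsfun_approx.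
Qed.

Variables (m1 : {measure set T1 -> \bar R}) (m2 : {measure set T2 -> \bar R})
  (h1 : T1 -> T) (h2 : T2 -> T) (D1 : T1 -> R) (D2 : T2 -> R).
Hypotheses (mh1 : measurable_fun [set: T1] h1)
  (mh2 : measurable_fun [set: T2] h2)
  (mD1 : measurable_fun [set: T1] D1) (mD2 : measurable_fun [set: T2] D2)
  (D10 : forall x, 0 <= D1 x) (D20 : forall x, 0 <= D2 x).
Hypothesis transfer_sets : forall A, measurable A ->
  (\int[m1]_(x in h1 @^-1` A) (D1 x)%:E =
   \int[m2]_(x in h2 @^-1` A) (D2 x)%:E)%E.

(** Agreement on preimages of measurable sets passes to simple functions and, by monotone
    convergence, to [k]. Weights 1 give the formula for image measures, identity maps the one for
    densities; equal measures and maps with different weights will serve conditional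
    expectations. *)
Lemma ge0_integral_transfer (k : T -> \bar R) :
  measurable_fun [set: T] k -> (forall x, (0 <= k x)%E) ->
  (\int[m1]_x (k (h1 x) * (D1 x)%:E) = \int[m2]_x (k (h2 x) * (D2 x)%:E))%E.
Proof.
move=> mk k0; rewrite !(integral_weighted_lim _ mk)//.
congr (limn _); apply/funext => n; rewrite !integral_nnsfun_weighted//.
by apply: eq_fsbigr => r _; rewrite transfer_sets.
Qed.

Lemma L1_transfer (k : T -> R) : measurable_fun [set: T] k ->
  L1 m2 (fun x => k (h2 x) * D2 x) -> L1 m1 (fun x => k (h1 x) * D1 x).
Proof.
move=> mk /integrableP[_ fin]; apply/integrableP; split.
  by apply/measurable_EFinP; apply: measurable_funM => //; exact: measurableT_comp.
move: fin; under eq_integral do rewrite /= normrM [X in _ * X]ger0_norm// EFinM.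
under [in X in _ -> X]eq_integral do
  rewrite /= normrM [X in _ * X]ger0_norm// EFinM.
rewrite -(ge0_integral_transfer (k := fun x => `|k x|%:E))//.
by apply/measurable_EFinP; exact: measurableT_comp.
Qed.

(** No integrability is asked: positive and negative parts transfer separately in the extended
    reals, and [fine] is applied only afterwards. *)
Lemma Rint_transfer (k : T -> R) : measurable_fun [set: T] k ->
  \int[m1]_x (k (h1 x) * D1 x) = \int[m2]_x (k (h2 x) * D2 x).
Proof.
move=> mk; rewrite /Rintegral; congr fine.
rewrite [LHS]integralE [RHS]integralE.
have mp : measurable_fun [set: T] (fun x => (Num.max (k x) 0)%:E).
  by apply/measurable_EFinP; exact: measurable_maxr.
have mn : measurable_fun [set: T] (fun x => (Num.max (- k x) 0)%:E).
  by apply/measurable_EFinP; apply: measurable_maxr => //; exact: measurableT_comp.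
have ep (a b : R) : 0 <= b -> (maxe (a * b)%:E 0 = (Num.max a 0)%:E * b%:E)%E.
  by move=> b0; rewrite -EFinM maxr_pMl// mul0r EFin_max.
congr (_ - _)%E.
- under eq_integral do rewrite funeposE ep//.
  under [RHS]eq_integral do rewrite funeposE ep//.
  apply: (ge0_integral_transfer (k := fun x => (Num.max (k x) 0)%:E)) => // x.
  by rewrite lee_fin le_max lexx orbT.
- under eq_integral do rewrite funenegE -EFinN -mulNr ep//.
  under [RHS]eq_integral do rewrite funenegE -EFinN -mulNr ep//.
  apply: (ge0_integral_transfer (k := fun x => (Num.max (- k x) 0)%:E)) => // x.
  by rewrite lee_fin le_max lexx orbT.
Qed.

End transfer.

Section image_measure.
Context {d1 d2 : measure_display} {T1 : measurableType d1}
  {T : measurableType d2} {R : realType}.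
Variables (m1 : {measure set T1 -> \bar R}) (m2 : {measure set T -> \bar R})
  (h : T1 -> T).
Hypotheses (mh : measurable_fun [set: T1] h)
  (image_sets : forall A, measurable A -> m1 (h @^-1` A) = m2 A).

Let image_int A : measurable A ->
  (\int[m1]_(x in h @^-1` A) (1 : R)%:E =
   \int[m2]_(x in id @^-1` A) (1 : R)%:E)%E.
Proof.
move=> mA; rewrite !integral_cst//=; first by rewrite image_sets.
by rewrite -[X in measurable X]setTI; exact: mh.
Qed.

Lemma L1_image (k : T -> R) : L1 m2 k -> L1 m1 (fun x => k (h x)).
Proof.
move=> kL; rewrite (_ : (fun _ => _) = (fun x => k (h x) * 1)); last first.
  by apply/funext => x; rewrite mulr1.
apply: (@L1_transfer _ _ _ _ _ _ _ m1 m2 h id (fun=> 1) (fun=> 1)) => //.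
  exact: L1_measurable kL.
by rewrite (_ : (fun _ => _) = k)//; apply/funext => x; rewrite mulr1.
Qed.

Lemma L2_image (k : T -> R) : L2 m2 k -> L2 m1 (fun x => k (h x)).
Proof.
by move=> [mk k2]; split; [exact: measurableT_comp|exact: (L1_image k2)].
Qed.

Lemma Rint_image (k : T -> R) : measurable_fun [set: T] k ->
  \int[m1]_x k (h x) = \int[m2]_x k x.
Proof.
move=> mk.
transitivity (\int[m1]_x (k (h x) * 1)).
  by apply: eq_Rintegral => x _; rewrite mulr1.
rewrite (@Rint_transfer _ _ _ _ _ _ _ m1 m2 h id (fun=> 1) (fun=> 1))//.
by apply: eq_Rintegral => x _; rewrite mulr1.
Qed.

End image_measure.

Section density.
Context {d : measure_display} {Z : measurableType d} {R : realType}.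
Variables (mu : {measure set Z -> \bar R}) (P : probability Z R) (f : Z -> R).
Hypothesis Pf : is_density mu P f.

Let density_int A : measurable A ->
  (\int[P]_(x in id @^-1` A) (1 : R)%:E =
   \int[mu]_(x in id @^-1` A) (f x)%:E)%E.
Proof.
by case: Pf => mf f0 PE mA; rewrite integral_cst// mul1e; exact: PE.
Qed.

Lemma L1_density (k : Z -> R) : measurable_fun [set: Z] k ->
  L1 P k <-> L1 mu (fun x => k x * f x).
Proof.
case: Pf => mf f0 _ mk; split=> kL.
  apply: (@L1_transfer _ _ _ _ _ _ _ mu P id id f (fun=> 1)) => //.
    by move=> A mA; rewrite density_int.
  by rewrite (_ : (fun _ => _) = k)//; apply/funext => x; rewrite mulr1.
rewrite (_ : k = (fun x => k x * 1)); last first.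
  by apply/funext => x; rewrite mulr1.
exact: (@L1_transfer _ _ _ _ _ _ _ P mu id id (fun=> 1) f).
Qed.

Lemma Rint_density (k : Z -> R) : measurable_fun [set: Z] k ->
  \int[P]_x k x = \int[mu]_x (k x * f x).
Proof.
case: Pf => mf f0 _ mk.
transitivity (\int[P]_x (k x * 1)).
  by apply: eq_Rintegral => x _; rewrite mulr1.
exact: (@Rint_transfer _ _ _ _ _ _ _ P mu id id (fun=> 1) f).
Qed.

End density.

Lemma indic_preimage (T1 T2 : Type) (R : pzRingType) (f : T1 -> T2)
  (A : set T2) x : \1_(f @^-1` A) x = \1_A (f x) :> R.
Proof.
by rewrite !indicE; congr (nat_of_bool _)%:R; apply/idP/idP => /set_mem h;
  exact/mem_set.
Qed.

Section iid_integrals.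
Context {d : measure_display} {Z : measurableType d} {R : realType}.
Context {P : probability Z R}.

Lemma measurable_cons_section n (z : Z) :
  measurable_fun [set: n.-tuple Z] (fun t => cons_sample (z, t)).
Proof.
apply: (measurableT_comp (f := @cons_sample _ Z n)).
  exact: measurable_cons_sample.
exact: measurable_fun_pair.
Qed.

Lemma ge0_integral_iidS n (F : n.+1.-tuple Z -> \bar R) :
  measurable_fun [set: _] F -> (forall t, (0 <= F t)%E) ->
  (\int[iid P n.+1]_t F t =
   \int[P]_z \int[iid P n]_t F (cons_sample (z, t)))%E.
Proof.
move=> mF F0 /=; rewrite ge0_integral_distribution//.
rewrite fubini_tonelli1//; last by move=> u; exact: F0.
by apply: measurableT_comp => //; exact: measurable_cons_sample.
Qed.

Lemma measurable_iid_section n (F : n.+1.-tuple Z -> R) :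
  measurable_fun [set: _] F -> (forall t, 0 <= F t) ->
  measurable_fun [set: Z] (fun z => \int[iid P n]_t F (cons_sample (z, t))).
Proof.
move=> mF F0; apply: measurableT_comp => //.
apply: (@measurable_fun_fubini_tonelli_F _ _ _ _ _ (iid P n)
   (fun u : Z * n.-tuple Z => (F (cons_sample u))%:E)).
- apply/measurable_EFinP.
  exact: (measurableT_comp mF (@measurable_cons_sample _ Z n)).
- by move=> u; rewrite lee_fin.
Qed.

(** Nonnegativity is for Tonelli; the bound [C] makes every inner integral finite, so that [fine]
    may enter the outer integral. Functions of varying sign are shifted by a constant before use. *)
Lemma Rint_iidS n (F : n.+1.-tuple Z -> R) (C : R) :
  measurable_fun [set: _] F -> (forall t, 0 <= F t <= C) ->
  \int[iid P n.+1]_t F t =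
  \int[P]_z \int[iid P n]_t F (cons_sample (z, t)).
Proof.
move=> mF FC; have F0 t : 0 <= F t by case/andP: (FC t).
rewrite {1}/Rintegral ge0_integral_iidS//; last exact/measurable_EFinP.
rewrite /Rintegral; congr fine; apply: eq_integral => z _.
rewrite fineK// integrable_fin_num//.
apply: (L1_bounded_prob (C := C)).
  by apply: measurableT_comp => //; exact: measurable_cons_section.
by move=> t; rewrite ger0_norm//; case/andP: (FC (cons_sample (z, t))).
Qed.

Lemma iid_tnth n (i : 'I_n) A : measurable A ->
  iid P n ((fun t => tnth t i) @^-1` A) = P A.
Proof.
elim: n i => [[]//|n IH] i mA.
have mi (m : nat) (k : 'I_m) :
    measurable ((fun t : m.-tuple Z => tnth t k) @^-1` A).
  by rewrite -[X in measurable X]setTI; apply: measurable_tnth.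
transitivity (\int[iid P n.+1]_t
    (\1_((fun t : n.+1.-tuple Z => tnth t i) @^-1` A) t)%:E)%E.
  by rewrite integral_indic ?setIT//; exact: mi.
rewrite ge0_integral_iidS//; last first.
  by apply/measurable_EFinP; apply: measurable_indic; exact: mi.
case: (unliftP ord0 i) => [j|] ->{i}.
- transitivity (\int[P]_z P A)%E; last first.
    by rewrite integral_cst//= probability_setT mule1.
  apply: eq_integral => z _; rewrite -(IH j)//.
  transitivity (\int[iid P n]_t (\1_((fun t : n.-tuple Z => tnth t j) @^-1` A) t)%:E)%E; last first.
    by rewrite integral_indic ?setIT//; exact: mi.
  by apply: eq_integral => t _; rewrite !indic_preimage tnthS.
- transitivity (\int[P]_z (\1_A z)%:E)%E; last by rewrite integral_indic ?setIT.
  apply: eq_integral => z _.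
  transitivity (\int[iid P n]_t (\1_A z)%:E)%E.
    by apply: eq_integral => t _; rewrite indic_preimage tnth0.
  by rewrite integral_cst//= probability_setT mule1.
Qed.

Lemma measurable_iid_sum n (f : Z -> R) : measurable_fun [set: Z] f ->
  measurable_fun [set: n.-tuple Z] (fun t => \sum_(i < n) f (tnth t i)).
Proof.
move=> mf; apply: measurable_sum => i.
by apply: measurableT_comp => //; exact: measurable_tnth.
Qed.

Lemma iid_sum_cons n (f : Z -> R) z (t : n.-tuple Z) :
  \sum_(i < n.+1) f (tnth (cons_sample (z, t)) i) =
  f z + \sum_(i < n) f (tnth t i).
Proof.
rewrite big_ord_recl tnth0; congr (_ + _).
by apply: eq_bigr => i _; rewrite tnthS.
Qed.

Lemma L1_iid_sum n (f : Z -> R) : L1 P f ->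
  L1 (iid P n) (fun t => \sum_(i < n) f (tnth t i)).
Proof.
move=> mf; apply: L1_sum => i.
by apply: (L1_image _ _ mf); [exact: measurable_tnth|exact: iid_tnth].
Qed.

Lemma L2_iid_sum n (f : Z -> R) : L2 P f ->
  L2 (iid P n) (fun t => \sum_(i < n) f (tnth t i)).
Proof.
move=> mf; apply: L2_sum => i.
by apply: (L2_image _ _ mf); [exact: measurable_tnth|exact: iid_tnth].
Qed.

Lemma Rint_iid_sum n (f : Z -> R) : L1 P f ->
  \int[iid P n]_t (\sum_(i < n) f (tnth t i)) = n%:R * \int[P]_z f z.
Proof.
move=> mf; rewrite Rint_sum => [|i]; last first.
  by apply: (L1_image _ _ mf); [exact: measurable_tnth|exact: iid_tnth].
rewrite (eq_bigr (fun=> \int[P]_z f z)) => [|i _]; last first.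
  apply: (Rint_image (measurable_tnth i) (iid_tnth i)).
  exact: L1_measurable mf.
by rewrite sumr_const card_ord mulr_natl.
Qed.

(** Once the first draw is split off, the cross term vanishes because the sum of the other draws has
    mean 0. *)
Lemma Rint_iid_sum_sqr n (f : Z -> R) : L2 P f -> \int[P]_z f z = 0 ->
  \int[iid P n]_t ((\sum_(i < n) f (tnth t i)) ^+ 2) =
  n%:R * \int[P]_z (f z ^+ 2).
Proof.
move=> f2 f0; have f1 := L2_L1_prob f2; have mf := L1_measurable f1.
elim: n => [|n IH].
  under eq_Rintegral do rewrite big_ord0 expr0n /=.
  by rewrite mul0r Rint_cst.
rewrite {1}/Rintegral ge0_integral_iidS; last 2 first.
- apply/measurable_EFinP; apply: measurable_funX; exact: measurable_iid_sum.
- by move=> t; rewrite lee_fin sqr_ge0.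
have [_ S2] := L2_iid_sum n f2; have S1 := L1_iid_sum n f1.
transitivity (\int[P]_z (f z ^+ 2 + n%:R * \int[P]_z (f z ^+ 2))).
  rewrite /Rintegral; congr fine; apply: eq_integral => z _.
  rewrite -IH -[in RHS]/(\int[P]_z f z ^+ 2).
  have -> : (\int[iid P n]_t
      ((\sum_(i < n.+1) f (tnth (cons_sample (z, t)) i)) ^+ 2)%:E =
      \int[iid P n]_t (f z ^+ 2 + (2 * f z * (\sum_(i < n) f (tnth t i)) +
         (\sum_(i < n) f (tnth t i)) ^+ 2))%:E)%E.
    by apply: eq_integral => t _; rewrite iid_sum_cons; congr EFin; ring.
  rewrite EFin_Rint; last first.
    by apply: L1D; [exact: L1_cst|apply: L1D => //; exact: L1Z].
  rewrite RintD ?Rint_cst//; [|exact: L1_cst|by apply: L1D => //; exact: L1Z].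
  rewrite RintD//; last exact: L1Z.
  by rewrite RintZ// Rint_iid_sum// f0 mulr0 mulr0 add0r.
rewrite RintD ?Rint_cst; [|by case: f2|exact: L1_cst].
by rewrite -natr1 mulrDl mul1r addrC.
Qed.

End iid_integrals.

(** * Trigonometric moments of sums *)

Section trig_inequalities.
Context {R : realType}.
Implicit Types u x y : R.

(** The engine of the Taylor bounds below: starting from [cos <= 1], each inequality says that the
    derivative of the next difference is nonnegative. *)
Lemma ge0_of_derive_ge0 (f f' : R -> R) :
  (forall x, is_derive x 1 f (f' x)) -> f 0 = 0 ->
  (forall x, 0 <= x -> 0 <= f' x) -> forall x, 0 <= x -> 0 <= f x.
Proof.
move=> df f0 f'0 x; rewrite le_eqVlt => /predU1P[<-|x0]; first by rewrite f0.
have cf : {within `[0, x], continuous f}.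
  by apply: derivable_within_continuous => y _; exact: ex_derive.
have [c /[!in_itv]/= /andP[c0 _]] := MVT x0 (fun y _ => df y) cf.
by rewrite f0 !subr0 => ->; rewrite mulr_ge0 ?f'0// ltW.
Qed.

Let sin_le_id u : 0 <= u -> sin u <= u.
Proof.
move=> u0; rewrite -subr_ge0; move: u u0.
have D (x : R) : is_derive x 1 (fun u => u - sin u) (1 - cos x).
  by apply: is_derive_eq; rewrite /GRing.scale /=; field.
apply: (ge0_of_derive_ge0 D) => [|x x0].
  by rewrite sin0 subr0.
by rewrite subr_ge0 cos_le1.
Qed.

Let cos_ge_quad u : 0 <= u -> 1 - u ^+ 2 / 2 <= cos u.
Proof.
move=> u0; rewrite -subr_ge0; move: u u0.
have D (x : R) : is_derive x 1 (fun u => cos u - (1 - u ^+ 2 / 2)) (x - sin x).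
  by apply: is_derive_eq; rewrite /GRing.scale /=; field.
apply: (ge0_of_derive_ge0 D) => [|x x0].
  by rewrite cos0 expr0n/= mul0r subr0 subrr.
by rewrite subr_ge0 sin_le_id.
Qed.

Let sin_ge_cubic u : 0 <= u -> u - u ^+ 3 / 6 <= sin u.
Proof.
move=> u0; rewrite -subr_ge0; move: u u0.
have D (x : R) : is_derive x 1 (fun u => sin u - (u - u ^+ 3 / 6)) (cos x - (1 - x ^+ 2 / 2)).
  by apply: is_derive_eq; rewrite /GRing.scale /=; field.
apply: (ge0_of_derive_ge0 D) => [|x x0].
  by rewrite sin0 expr0n/= mul0r !subr0.
by rewrite subr_ge0 cos_ge_quad.
Qed.

Let cos_le_quartic u : 0 <= u -> cos u <= 1 - u ^+ 2 / 2 + u ^+ 4 / 24.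
Proof.
move=> u0; rewrite -subr_ge0; move: u u0.
have D (x : R) : is_derive x 1 (fun u => 1 - u ^+ 2 / 2 + u ^+ 4 / 24 - cos u) (sin x - (x - x ^+ 3 / 6)).
  by apply: is_derive_eq; rewrite /GRing.scale /=; field.
apply: (ge0_of_derive_ge0 D) => [|x x0].
  by rewrite cos0 !expr0n/= !mul0r subr0 addr0 subrr.
by rewrite subr_ge0 sin_ge_cubic.
Qed.

Lemma abs_sin_le u : `|sin u| <= `|u|.
Proof.
wlog u0 : u / 0 <= u.
  move=> H; have [/H//|/ltW u0] := leP 0 u.
  by rewrite -normrN -sinN -[leRHS]normrN H// oppr_ge0.
have [u1|u1] := leP 1 `|u|; first exact: le_trans (sin_max u) u1.
rewrite ger0_norm in u1 *; last by [].
rewrite ler_norml sin_le_id// andbT (le_trans _ (sin_ge_cubic u0))//.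
have : 0 <= u ^+ 2 by exact: sqr_ge0.
by nra.
Qed.

Lemma abs_cosB1_le u : `|cos u - 1| <= u ^+ 2 / 2.
Proof.
wlog u0 : u / 0 <= u.
  move=> H; have [/H//|/ltW u0] := leP 0 u.
  by rewrite -cosN -sqrrN H// oppr_ge0.
by rewrite distrC ger0_norm ?subr_ge0 ?cos_le1// lerBlDr -lerBlDl cos_ge_quad.
Qed.

Lemma abs_cosB1_le_norm u : `|cos u - 1| <= 2 * `|u|.
Proof.
have [u1|u1] := leP 1 `|u|.
  rewrite (le_trans (ler_normB _ _))// normr1.
  by have := cos_max u; lra.
apply: le_trans (abs_cosB1_le u) _.
by rewrite -(real_normK (num_real u)); have := normr_ge0 u; nra.
Qed.

Lemma abs_sinB_le u : `|sin u - u| <= `|u| ^+ 3.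
Proof.
wlog u0 : u / 0 <= u.
  move=> H; have [/H//|/ltW u0] := leP 0 u.
  have := H (- u); rewrite oppr_ge0 sinN normrN => /(_ u0).
  by rewrite (_ : - sin u - - u = - (sin u - u)) ?normrN//; ring.
rewrite (ger0_norm u0) distrC ger0_norm ?subr_ge0 ?sin_le_id//.
have : 0 <= u ^+ 3 by rewrite exprn_ge0.
by have := sin_ge_cubic u0; lra.
Qed.

Lemma abs_sinB_le_sqr u : `|sin u - u| <= 2 * u ^+ 2.
Proof.
have [u1|u1] := leP 1 `|u|.
  rewrite (le_trans (ler_normB _ _))//.
  have := abs_sin_le u; rewrite -(real_normK (num_real u)).
  by move: u1; nra.
apply: le_trans (abs_sinB_le u) _.
by rewrite -(real_normK (num_real u)); have := normr_ge0 u; nra.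
Qed.

Lemma abs_cosB_quad_le u : `|cos u - 1 + u ^+ 2 / 2| <= u ^+ 4.
Proof.
wlog u0 : u / 0 <= u.
  move=> H; have [/H//|/ltW u0] := leP 0 u.
  have := H (- u); rewrite oppr_ge0 cosN sqrrN => /(_ u0).
  by rewrite (_ : (- u) ^+ 4 = u ^+ 4); last by ring.
have : 0 <= u ^+ 4 by rewrite exprn_ge0.
have := cos_le_quartic u0; have := cos_ge_quad u0 => h1 h2 h3.
by rewrite ger0_norm; lra.
Qed.

(** From below, exp(-y) >= 1 - y; from above, exp(-y) <= 1 / (1 + y) <= 1 - y + y^2. *)
Lemma abs_expRB_le y : 0 <= y -> `|expR (- y) - 1 + y| <= y ^+ 2.
Proof.
move=> y0; have h1 := expR_ge1Dx (- y).
have h2 : expR (- y) <= (1 + y)^-1.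
  by rewrite expRN lef_pV2 ?posrE ?expR_gt0 ?expR_ge1Dx//; lra.
have h3 : (1 + y)^-1 <= 1 - y + y ^+ 2.
  rewrite -[leLHS]mul1r ler_pdivrMr; last by lra.
  have : 0 <= y ^+ 3 by rewrite exprn_ge0.
  by nra.
by rewrite ger0_norm; lra.
Qed.

End trig_inequalities.

Section iid_characteristic_function.
Context {d : measure_display} {Z : measurableType d} {R : realType}.

Lemma measurable_cosD d' (T : measurableType d') (f : T -> R) (b : R) :
  measurable_fun [set: T] f -> measurable_fun [set: T] (fun z => cos (b + f z)).
Proof.
move=> mf; apply: measurableT_comp => //; last exact: measurable_funD.
by apply: continuous_measurable_fun; exact: continuous_cos.
Qed.

Lemma L1_cos d' (T : measurableType d') (P : probability T R) (f : T -> R) b :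
  measurable_fun [set: T] f -> L1 P (fun z => cos (b + f z)).
Proof.
move=> mf; apply: (L1_bounded_prob (C := 1)); first exact: measurable_cosD.
by move=> z; exact: cos_max.
Qed.

(* Replacing one coordinate at a time by a rotation of angle [s] damped by
   [expR (- t)] costs at most [e]; this is the telescoping form of the bound
   |u^n - v^n| <= n |u - v| for complex numbers of modulus at most 1. *)
Lemma iid_cos_telescope (P : probability Z R) (x : Z -> R) (t s e : R) n :
  measurable_fun [set: Z] x -> 0 <= t ->
  (forall b, `|\int[P]_z cos (b + x z) - expR (- t) * cos (b + s)| <= e) ->
  forall b, `|\int[iid P n]_u cos (b + \sum_(i < n) x (tnth u i))
     - expR (- (n%:R * t)) * cos (b + n%:R * s)| <= n%:R * e.
Proof.
move=> mx t0 He; elim: n => [|n IH] b.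
  under eq_Rintegral do rewrite big_ord0.
  by rewrite Rint_cst !mul0r oppr0 expR0 mul1r subrr normr0.
set E := expR (- (n%:R * t)) in IH *.
have E01 : 0 <= E <= 1.
  by rewrite expR_ge0 -[leRHS]expR0 ler_expR oppr_le0 mulr_ge0.
pose S (u : n.-tuple Z) := \sum_(i < n) x (tnth u i).
have mS : measurable_fun setT S by exact: measurable_iid_sum.
(* Adding 1 makes the integrand nonnegative, as [Rint_iidS] requires. *)
pose F (u : n.+1.-tuple Z) := 1 + cos (b + \sum_(i < n.+1) x (tnth u i)).
have mc : measurable_fun setT
    (fun u : n.+1.-tuple Z => cos (b + \sum_(i < n.+1) x (tnth u i))).
  by apply: measurable_cosD; exact: measurable_iid_sum.
have mF : measurable_fun setT F by exact: measurable_funD.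
have F02 u : 0 <= F u <= 2.
  by rewrite /F; have := cos_max (b + \sum_(i < n.+1) x (tnth u i));
    rewrite ler_norml => /andP[]; lra.
pose G z := \int[iid P n]_u cos (b + x z + S u).
have FG z : \int[iid P n]_u F (cons_sample (z, u)) = 1 + G z.
  transitivity (\int[iid P n]_u (1 + cos (b + x z + S u))).
    by apply: eq_Rintegral => u _; rewrite /F iid_sum_cons addrA.
  by rewrite RintD ?Rint_cst//; [exact: L1_cst|exact: L1_cos].
have mG : measurable_fun setT G.
  have -> : G = (fun z => \int[iid P n]_u F (cons_sample (z, u)) - 1).
    by apply/funext => z; rewrite FG addrC addKr.
  apply: measurable_funB => //; apply: measurable_iid_section => // u.
  by case/andP: (F02 u).
have G1 z : `|G z| <= 1.
  by apply: Rint_bounded => [|u]; [exact: measurable_cosD|exact: cos_max].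
have LG : L1 P G by exact: L1_bounded_prob mG G1.
have -> : \int[iid P n.+1]_u cos (b + \sum_(i < n.+1) x (tnth u i)) =
    \int[P]_z G z.
  have FE : \int[iid P n.+1]_u F u =
      1 + \int[iid P n.+1]_u cos (b + \sum_(i < n.+1) x (tnth u i)).
    rewrite -[X in X + _](Rint_cst (P := iid P n.+1)) -RintD//.
      exact: L1_cst.
    by apply: L1_cos; exact: measurable_iid_sum.
  apply: (addrI 1); rewrite -FE (Rint_iidS mF F02).
  under eq_Rintegral do rewrite FG.
  by rewrite RintD ?Rint_cst//; exact: L1_cst.
(* The induction hypothesis at the phase [b + x z] replaces the last n draws; then [He] at the phase
   [b + n%:R * s] replaces the first one. *)
have step1 : `|\int[P]_z G z
    - \int[P]_z (E * cos (b + n%:R * s + x z))| <= n%:R * e.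
  have LE : L1 P (fun z => E * cos (b + n%:R * s + x z)).
    by apply: L1Z; exact: L1_cos.
  rewrite -RintB//; apply: (Rint_bounded (L1_measurable (L1B LG LE))).
  by move=> z; rewrite [b + _ + x z]addrAC; exact: IH.
have step2 : `|\int[P]_z (E * cos (b + n%:R * s + x z))
    - E * (expR (- t) * cos (b + n%:R * s + s))| <= e.
  rewrite RintZ; last exact: L1_cos.
  rewrite -mulrBr normrM ger0_norm; last by case/andP: E01.
  apply: le_trans (He (b + n%:R * s)).
  by rewrite ler_piMl//; case/andP: E01.
have -> : expR (- (n.+1%:R * t)) * cos (b + n.+1%:R * s) =
    E * (expR (- t) * cos (b + n%:R * s + s)).
  rewrite mulrA -expRD; congr (expR _ * cos _); rewrite -natr1; ring.
rewrite -natr1 mulrDl mul1r.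
rewrite -(subrKA (\int[P]_z (E * cos (b + n%:R * s + x z)))).
by rewrite (le_trans (ler_normD _ _))// lerD.
Qed.

Lemma cvg_norm_le (u v : nat -> R) l : (\forall n \near \oo, `|u n - l| <= v n) ->
  v n @[n --> \oo] --> 0 -> u n @[n --> \oo] --> l.
Proof.
move=> uv v0; apply/cvgrPdist_le => e e0.
move/cvgrPdist_le : v0 => /(_ _ e0) v0.
near=> n; rewrite distrC.
have h1 : `|u n - l| <= v n by near: n.
have h2 : `|0 - v n| <= e by near: n.
by rewrite (le_trans h1)// (le_trans _ h2)// sub0r normrN ler_norm.
Unshelve. all: by end_near. Qed.

Lemma cvg_invn : (n%:R : R)^-1 @[n --> \oo] --> 0.
Proof.
by rewrite -cvg_shiftS; exact: cvg_harmonic.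
Qed.

Lemma cvg_divn (c : R) : c / n%:R @[n --> \oo] --> 0.
Proof. by rewrite -[X in _ --> X](mulr0 c); apply: cvgM cvg_invn; exact: cvg_cst. Qed.

(** A limit theorem for triangular arrays, driven by just the two limits that determine it. Each
    draw is compared with a rotation of angle s / n damped by exp(- t / n), and the error per draw
    is o(1 / n). *)
Lemma iid_cos_cvg (P : nat -> probability Z R) (x : nat -> Z -> R) (t s : R) :
  (forall n, measurable_fun [set: Z] (x n)) -> 0 <= t ->
  n%:R * \int[P n]_z (cos (x n z) - 1) @[n --> \oo] --> - t ->
  n%:R * \int[P n]_z sin (x n z) @[n --> \oo] --> s ->
  forall b, \int[iid (P n) n]_u cos (b + \sum_(i < n) x n (tnth u i))
    @[n --> \oo] --> expR (- t) * cos (b + s).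
Proof.
move=> mx t0 Hc Hs b.
pose E n := expR (- (t / n%:R)).
pose C n := \int[P n]_z cos (x n z).
pose S n := \int[P n]_z sin (x n z).
have msin n : measurable_fun [set: Z] (fun z => sin (x n z)).
  apply: measurableT_comp => //.
  by apply: continuous_measurable_fun; exact: continuous_sin.
have mcos n : measurable_fun [set: Z] (fun z => cos (x n z)).
  apply: measurableT_comp => //.
  by apply: continuous_measurable_fun; exact: continuous_cos.
have Lc n : L1 (P n) (fun z => cos (x n z)).
  by apply: (L1_bounded_prob (C := 1)) => // z; exact: cos_max.
have Ls n : L1 (P n) (fun z => sin (x n z)).
  by apply: (L1_bounded_prob (C := 1)) => // z; exact: sin_max.
(* By the addition formula the error per draw splits into a cosine and a sine part, both free of the
   phase. *)
pose e n := `|C n - E n * cos (s / n%:R)| + `|S n - E n * sin (s / n%:R)|.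
have one n : forall b, `|\int[P n]_z cos (b + x n z)
    - E n * cos (b + s / n%:R)| <= e n.
  move=> b'.
  have -> : \int[P n]_z cos (b' + x n z) = cos b' * C n - sin b' * S n.
    by under eq_Rintegral do rewrite cosD; rewrite RintB ?RintZ//; exact: L1Z.
  rewrite cosD (_ : _ - _ = cos b' * (C n - E n * cos (s / n%:R))
    - sin b' * (S n - E n * sin (s / n%:R))); last by ring.
  rewrite (le_trans (ler_normB _ _))// !normrM lerD// ler_piMl//.
    exact: cos_max.
  exact: sin_max.
apply: (@cvg_norm_le _ (fun n => n%:R * e n)).
  near=> n.
  have n0 : (n%:R : R) != 0 by rewrite pnatr_eq0 -lt0n; near: n; exists 1%N.
  have tn : 0 <= t / n%:R by rewrite divr_ge0.
  have := iid_cos_telescope n (mx n) tn (one n) b.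
  by rewrite ![n%:R * (_ / _)]mulrC !divfK.
rewrite -[X in _ --> X](addr0 0).
have nE : n%:R * (E n - 1) @[n --> \oo] --> - t.
  apply: (@cvg_norm_le _ (fun n => t ^+ 2 / n%:R)); last exact: cvg_divn.
  near=> n.
  have n0 : (0 : R) < n%:R by rewrite ltr0n; near: n; exists 1%N.
  have -> : n%:R * (E n - 1) - - t = n%:R * (E n - 1 + t / n%:R).
    by rewrite opprK [in RHS]mulrDr [n%:R * (t / _)]mulrCA divff ?mulr1// gt_eqF.
  rewrite normrM ger0_norm ?(ltW n0)//.
  have tn : 0 <= t / n%:R by rewrite divr_ge0// ltW.
  have := abs_expRB_le tn => /(ler_wpM2l (ltW n0)) /le_trans; apply.
  rewrite le_eqVlt; apply/orP; left; apply/eqP; by field; exact: lt0r_neq0.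
have E1 : E n @[n --> \oo] --> (1 : R).
  have h : - (t / n%:R) @[n --> \oo] --> (0 : R).
    by rewrite -[0]oppr0; apply: cvgN; exact: cvg_divn.
  by rewrite -expR0; apply: (cvg_comp _ expR h); exact: continuous_expR.
have nc : n%:R * (cos (s / n%:R) - 1) @[n --> \oo] --> (0 : R).
  apply: (@cvg_norm_le _ (fun n => (s ^+ 2 / 2) / n%:R)); last exact: cvg_divn.
  near=> n.
  have n0 : (0 : R) < n%:R by rewrite ltr0n; near: n; exists 1%N.
  rewrite subr0 normrM ger0_norm ?(ltW n0)//.
  have := abs_cosB1_le (s / n%:R) => /(ler_wpM2l (ltW n0)) /le_trans; apply.
  rewrite le_eqVlt; apply/orP; left; apply/eqP; by field; exact: lt0r_neq0.
have ns : n%:R * sin (s / n%:R) @[n --> \oo] --> s.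
  apply: (@cvg_norm_le _ (fun n => (2 * s ^+ 2) / n%:R)); last exact: cvg_divn.
  near=> n.
  have n0 : (0 : R) < n%:R by rewrite ltr0n; near: n; exists 1%N.
  have -> : n%:R * sin (s / n%:R) - s = n%:R * (sin (s / n%:R) - s / n%:R).
    by rewrite mulrBr [X in _ = _ - X]mulrC divfK// gt_eqF.
  rewrite normrM ger0_norm ?(ltW n0)//.
  have := abs_sinB_le_sqr (s / n%:R) => /(ler_wpM2l (ltW n0)) /le_trans; apply.
  rewrite le_eqVlt; apply/orP; left; apply/eqP; by field; exact: lt0r_neq0.
rewrite /e; under eq_cvg do rewrite mulrDr.
have nn (n : nat) (y : R) : n%:R * `|y| = `|n%:R * y|.
  by rewrite normrM [X in _ = X * _]ger0_norm.
apply: cvgD; under eq_cvg do rewrite nn; apply/norm_cvg0P.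
- have L : n%:R * \int[P n]_z (cos (x n z) - 1)
      - (n%:R * (E n - 1) + E n * (n%:R * (cos (s / n%:R) - 1)))
      @[n --> \oo] --> - t - (- t + 1 * 0).
    by apply: cvgB Hc _; apply: cvgD nE _; exact: cvgM.
  move: L; rewrite mulr0 addr0 subrr; apply: cvg_trans; apply: near_eq_cvg.
  near=> n; rewrite RintB ?Rint_cst//; last exact: L1_cst.
  by rewrite -/(C n); ring.
- have L : n%:R * S n - E n * (n%:R * sin (s / n%:R)) @[n --> \oo] --> s - 1 * s.
    by apply: cvgB Hs _; exact: cvgM.
  move: L; rewrite mul1r subrr; apply: cvg_trans; apply: near_eq_cvg.
  by near=> n; ring.
Unshelve. all: by end_near. Qed.

End iid_characteristic_function.

(** * Contiguity and local asymptotics *)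

Section hellinger.
Context {d : measure_display} {Z : measurableType d} {R : realType}.

Let iid_section_bounds (P : probability Z R) n (F : n.+1.-tuple Z -> R) :
  measurable_fun [set: _] F -> (forall t, 0 <= F t <= 1) -> forall z,
  0 <= \int[iid P n]_t F (cons_sample (z, t)) <= 1.
Proof.
move=> mF F01 z; have F0 t : 0 <= F t by case/andP: (F01 t).
rewrite Rint_ge0//= -[leRHS](Rint_cst (P := iid P n)); apply: Rint_le => //.
- apply: (L1_bounded_prob (C := 1)).
    by apply: measurableT_comp => //; exact: measurable_cons_section.
  by move=> t; rewrite ger0_norm//; case/andP: (F01 (cons_sample (z, t))).
- exact: L1_cst.
- by move=> t; case/andP: (F01 (cons_sample (z, t))).
Qed.

Lemma density_L1 (mu : {measure set Z -> \bar R}) (P : probability Z R)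
    (p : Z -> R) :
  is_density mu P p -> L1 mu p /\ \int[mu]_z p z = 1.
Proof.
move=> dP; have mc : measurable_fun [set: Z] (fun=> 1 : R) by [].
split.
  have := (L1_density dP mc).1 (L1_cst 1).
  by rewrite (_ : (fun _ => _) = p)//; apply/funext => x; rewrite mul1r.
rewrite -(Rint_cst (P := P) 1) (Rint_density dP mc).
by apply: eq_Rintegral => x _; rewrite mul1r.
Qed.

Let L2_sqrt_density (mu : {measure set Z -> \bar R}) (P : probability Z R)
    (p a : Z -> R) :
  is_density mu P p -> measurable_fun [set: Z] a -> (forall z, 0 <= a z <= 1) ->
  L2 mu (fun z => Num.sqrt (p z * a z)) /\
  \int[mu]_z (Num.sqrt (p z * a z) ^+ 2) = \int[P]_z a z.
Proof.
move=> dP ma a01; have [mp p0 _] := dP.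
have sq z : Num.sqrt (p z * a z) ^+ 2 = a z * p z.
  by rewrite sqr_sqrtr ?mulr_ge0// 1?mulrC//; case/andP: (a01 z).
split; last by rewrite (Rint_density dP ma); apply: eq_Rintegral => z _.
split.
  apply: measurableT_comp; last exact: measurable_funM.
  by apply: continuous_measurable_fun; exact: sqrt_continuous.
rewrite (_ : (fun _ => _) = (fun z => a z * p z)); last exact/funext.
apply: (L1_density dP ma).1; apply: (L1_bounded_prob (C := 1)) => // z.
by rewrite ger0_norm; case/andP: (a01 z).
Qed.

Let CS_sqrt (mu : {measure set Z -> \bar R}) f g : L2 mu f -> L2 mu g ->
  \int[mu]_z (f z * g z) <=
  Num.sqrt (\int[mu]_z (f z ^+ 2) * \int[mu]_z (g z ^+ 2)).
Proof.
move=> f2 g2; apply: le_trans (ler_norm _) _.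
by rewrite -sqrtr_sqr ler_wsqrtr//; exact: Rint_cauchy_schwarz.
Qed.

(* Testing form of the tensorization of the Hellinger affinity; it avoids
   densities on the product space. *)
Lemma iid_affinity_le (mu : {measure set Z -> \bar R}) (P Q : probability Z R)
    (p q : Z -> R) n (F : n.-tuple Z -> R) :
  is_density mu P p -> is_density mu Q q ->
  measurable_fun [set: _] F -> (forall t, 0 <= F t <= 1) ->
  (\int[mu]_z Num.sqrt (p z * q z)) ^+ n <=
  Num.sqrt (\int[iid P n]_t F t * \int[iid Q n]_t F t) +
  Num.sqrt ((1 - \int[iid P n]_t F t) * (1 - \int[iid Q n]_t F t)).
Proof.
move=> dP dQ; have [mp p0 _] := dP; have [mq q0 _] := dQ.
elim: n F => [|n IH] F mF F01.
  rewrite expr0 -[iid Q 0]/(iid P 0) -!expr2 !sqrtr_sqr.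
  have x0 : 0 <= \int[iid P 0]_t F t.
    by apply: Rint_ge0 => t; case/andP: (F01 t).
  have x1 : \int[iid P 0]_t F t <= 1.
    rewrite -[leRHS](Rint_cst (P := iid P 0)); apply: Rint_le => //.
    - apply: (L1_bounded_prob (C := 1)) => // t.
      by rewrite ger0_norm; case/andP: (F01 t).
    - exact: L1_cst.
    - by move=> t; case/andP: (F01 t).
  by rewrite !ger0_norm ?subr_ge0//; lra.
pose a z := \int[iid P n]_t F (cons_sample (z, t)).
pose b z := \int[iid Q n]_t F (cons_sample (z, t)).
have F0 t : 0 <= F t by case/andP: (F01 t).
have ma : measurable_fun setT a by exact: measurable_iid_section.
have mb : measurable_fun setT b by exact: measurable_iid_section.
have a01 z : 0 <= a z <= 1 by exact: iid_section_bounds.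
have b01 z : 0 <= b z <= 1 by exact: iid_section_bounds.
rewrite (Rint_iidS (P := P) mF F01) (Rint_iidS (P := Q) mF F01).
rewrite -/a -/b.
have La : L1 P a.
  by apply: (L1_bounded_prob (C := 1)) => // z; rewrite ger0_norm; case/andP: (a01 z).
have Lb : L1 Q b.
  by apply: (L1_bounded_prob (C := 1)) => // z; rewrite ger0_norm; case/andP: (b01 z).
have ca01 z : 0 <= 1 - a z <= 1 by have := a01 z; lra.
have cb01 z : 0 <= 1 - b z <= 1 by have := b01 z; lra.
have mca : measurable_fun setT (fun z => 1 - a z) by exact: measurable_funB.
have mcb : measurable_fun setT (fun z => 1 - b z) by exact: measurable_funB.
have [A1 A2] := L2_sqrt_density dP ma a01.
have [B1 B2] := L2_sqrt_density dQ mb b01.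
have [A1' A2'] := L2_sqrt_density dP mca ca01.
have [B1' B2'] := L2_sqrt_density dQ mcb cb01.
have -> : 1 - \int[P]_z a z = \int[P]_z (1 - a z).
  by rewrite RintB ?Rint_cst//; exact: L1_cst.
have -> : 1 - \int[Q]_z b z = \int[Q]_z (1 - b z).
  by rewrite RintB ?Rint_cst//; exact: L1_cst.
rewrite -A2 -B2 -A2' -B2'.
apply: le_trans (lerD (CS_sqrt A1 B1) (CS_sqrt A1' B1')).
rewrite -RintD; [|exact: L1M_L2|exact: L1M_L2].
have Lpq : L1 mu (fun z => Num.sqrt (p z * q z)).
  have [lp _] := density_L1 dP; have [lq _] := density_L1 dQ.
  apply: (L1_le (g := fun z => p z + q z)); last exact: L1D.
    apply: measurableT_comp; last exact: measurable_funM.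
    by apply: continuous_measurable_fun; exact: sqrt_continuous.
  move=> z; rewrite ger0_norm ?sqrtr_ge0//.
  rewrite -[leRHS]ger0_norm ?addr_ge0// -sqrtr_sqr ler_wsqrtr//.
  rewrite -subr_ge0 (_ : _ - _ = p z ^+ 2 + p z * q z + q z ^+ 2); last by ring.
  by rewrite !addr_ge0 ?sqr_ge0 ?mulr_ge0.
rewrite exprSr -RintZ//; apply: Rint_le.
- exact: L1Z.
- by apply: L1D; exact: L1M_L2.
move=> z; have [[a0 a1] [b0 b1]] := (andP (a01 z), andP (b01 z)).
rewrite -!sqrtrM ?mulr_ge0 ?subr_ge0//.
rewrite [_ * a z * _]mulrACA [_ * (1 - a z) * _]mulrACA.
rewrite !(sqrtrM (a := p z * q z)) ?mulr_ge0// -mulrDr mulrC ler_wpM2l//.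
apply: IH; last by move=> t; exact: F01.
by apply: measurableT_comp => //; exact: measurable_cons_section.
Qed.

(** Squaring the bound on [r] leaves a cross term 2 s t, where s^2 = x (1 - x) and t^2 = y (1 - y).
    Bounding it by s^2 + t^2 makes the right-hand side exactly 1 - (x - y)^2. *)
Lemma affinity_dist_le (x y r : R) : 0 <= x <= 1 -> 0 <= y <= 1 -> 0 <= r ->
  r <= Num.sqrt (x * y) + Num.sqrt ((1 - x) * (1 - y)) ->
  (x - y) ^+ 2 <= 1 - r ^+ 2.
Proof.
move=> /andP[x0 x1] /andP[y0 y1] r0 rle.
have r2 : r ^+ 2 <= (Num.sqrt (x * y) + Num.sqrt ((1 - x) * (1 - y))) ^+ 2.
  by rewrite lerXn2r// nnegrE addr_ge0.
apply: (le_trans _ (lerB (lexx 1) r2)).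
have xy0 : 0 <= x * y by rewrite mulr_ge0.
have xy1 : 0 <= (1 - x) * (1 - y) by rewrite mulr_ge0// subr_ge0.
rewrite [(Num.sqrt _ + _) ^+ 2]sqrrD (sqr_sqrtr xy0) (sqr_sqrtr xy1) -sqrtrM//.
have -> : x * y * ((1 - x) * (1 - y)) = (x * (1 - x)) * (y * (1 - y)) by ring.
rewrite sqrtrM; last by rewrite mulr_ge0// subr_ge0.
set s := Num.sqrt (x * (1 - x)); set t := Num.sqrt (y * (1 - y)).
have s2 : s ^+ 2 = x * (1 - x) by rewrite sqr_sqrtr// mulr_ge0// subr_ge0.
have t2 : t ^+ 2 = y * (1 - y) by rewrite sqr_sqrtr// mulr_ge0// subr_ge0.
by have := sqr_ge0 (s - t); rewrite sqrrB s2 t2; nra.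
Qed.

(** Cauchy-Schwarz for [F] times the n-fold likelihood ratio, carried out one coordinate at a time
    so that no density on the product space appears. *)
Lemma iid_chi2_le (P Q : probability Z R) (w : Z -> R) n (F : n.-tuple Z -> R) :
  is_density P Q w -> L2 P w ->
  measurable_fun [set: _] F -> (forall t, 0 <= F t <= 1) ->
  (\int[iid Q n]_t F t) ^+ 2 <=
  (\int[P]_z (w z ^+ 2)) ^+ n * \int[iid P n]_t (F t ^+ 2).
Proof.
move=> dQ w2; have [mw w0 _] := dQ.
have bnd2 m (G : m.-tuple Z -> R) : (forall t, 0 <= G t <= 1) ->
    forall t, 0 <= G t ^+ 2 <= 1.
  by move=> G01 t; rewrite sqr_ge0 expr_le1//=; case/andP: (G01 t).
elim: n F => [|n IH] F mF F01.
  rewrite expr0 mul1r -[iid Q 0]/(iid P 0).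
  have L2F : L2 (iid P 0) F.
    split => //; apply: (L1_bounded_prob (C := 1)) => [|t].
      exact: measurable_funX.
    by rewrite ger0_norm; case/andP: (bnd2 _ _ F01 t).
  have -> : \int[iid P 0]_t F t = \int[iid P 0]_t (F t * 1).
    by apply: eq_Rintegral => t _; rewrite mulr1.
  apply: le_trans (Rint_cauchy_schwarz L2F (L2_cst 1 probability_fin)) _.
  by rewrite /= expr1n Rint_cst mulr1.
pose b z := \int[iid Q n]_t F (cons_sample (z, t)).
pose a z := \int[iid P n]_t (F (cons_sample (z, t)) ^+ 2).
have F0 t : 0 <= F t by case/andP: (F01 t).
have mF2 : measurable_fun setT (fun t => F t ^+ 2) by exact: measurable_funX.
have mb : measurable_fun setT b by exact: measurable_iid_section.
have ma : measurable_fun setT a.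
  by apply: (measurable_iid_section (F := fun t => F t ^+ 2)) => // t; exact: sqr_ge0.
have b01 z : 0 <= b z <= 1 by exact: iid_section_bounds.
have a01 z : 0 <= a z <= 1.
  by apply: (@iid_section_bounds P n (fun t => F t ^+ 2)) => //; exact: bnd2.
have La : L1 P a.
  by apply: (L1_bounded_prob (C := 1)) => // z; rewrite ger0_norm; case/andP: (a01 z).
have L2b : L2 P b.
  split => //; apply: (L1_bounded_prob (C := 1)); first exact: measurable_funX.
  by move=> z; rewrite ger0_norm; case/andP: (bnd2 _ (fun=> b z) (fun=> b01 z) ([tuple] : 0.-tuple Z)).
rewrite (Rint_iidS (P := Q) mF F01) -/b.
rewrite (Rint_iidS (P := P) (F := fun t => F t ^+ 2) mF2 (bnd2 _ _ F01)) -/a.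
rewrite (Rint_density dQ mb).
apply: le_trans (Rint_cauchy_schwarz L2b w2) _.
rewrite mulrC exprSr -mulrA mulrCA ler_wpM2l//.
  by apply: Rint_ge0 => z; exact: sqr_ge0.
rewrite -RintZ//; apply: Rint_le => //; first by case: L2b.
  exact: L1Z.
move=> z; apply: IH; last by move=> t; exact: F01.
by apply: measurableT_comp => //; exact: measurable_cons_section.
Qed.

Lemma density_probability (P : probability Z R) (w : Z -> R) :
  L1 P w -> (forall z, 0 <= w z) -> \int[P]_z w z = 1 ->
  exists Q : probability Z R, is_density P Q w.
Proof.
move=> Lw w0 w1; have mw := L1_measurable Lw.
pose q (A : set Z) : \bar R := (\int[P]_(z in A) (w z)%:E)%E.
have q0 : q set0 = 0%E by rewrite /q integral_set0.
have qge A : (0 <= q A)%E by apply: integral_ge0 => z _; rewrite lee_fin.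
have qadd : semi_sigma_additive q.
  move=> A mA tA mUA; rewrite /q integral_bigcup//=; last first.
    exact: (integrableS measurableT).
  apply: is_cvg_ereal_nneg_natsum_cond => n _ _.
  by apply: integral_ge0 => /= x ?; rewrite lee_fin.
have qT : q setT = 1%E by rewrite /q EFin_Rint// w1.
pose M := isMeasure.Build _ _ _ q q0 qge qadd.
pose Mq : {measure set Z -> \bar R} := HB.pack q M.
pose N := Measure_isProbability.Build _ _ _ Mq qT.
pose Q : probability Z R := HB.pack q M N.
by exists Q; split.
Qed.

(** The comparison goes through the law [Q] of density [w] with respect to [P0]: the first term is
    the Hellinger cost from [P] to [Q], the second the chi-square cost from [Q] to [P0]. *)
Lemma iid_prob_le (mu : {measure set Z -> \bar R}) (P P0 : probability Z R)
    (p p0 w : Z -> R) n (A : set (n.-tuple Z)) :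
  is_density mu P p -> is_density mu P0 p0 ->
  L2 P0 w -> (forall z, 0 <= w z) -> \int[P0]_z w z = 1 -> measurable A ->
  fine (iid P n A) <=
    Num.sqrt (n%:R *
      \int[mu]_z ((Num.sqrt (p z) - Num.sqrt (w z * p0 z)) ^+ 2)) +
    Num.sqrt ((\int[P0]_z (w z ^+ 2)) ^+ n * fine (iid P0 n A)).
Proof.
move=> dP dP0 w2 w0 w1 mA; have mw : measurable_fun setT w by case: w2.
have [mp p_ge0 _] := dP; have [mp0 p0_ge0 _] := dP0.
have [Q dQ] := density_probability (L2_L1_prob w2) w0 w1.
have dQmu : is_density mu Q (fun z => w z * p0 z).
  split=> [|z|B mB]; first exact: measurable_funM.
    exact: mulr_ge0.
  case: dQ => _ _ ->//.
  have [_ _ P0E] := dP0.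
  rewrite integral_mkcond [RHS]integral_mkcond.
  have sets C : measurable C -> (\int[P0]_(x in id @^-1` C) (1 : R)%:E =
      \int[mu]_(x in id @^-1` C) (p0 x)%:E)%E.
    by move=> mC; rewrite integral_cst// mul1e; exact: P0E.
  have := @ge0_integral_transfer _ _ _ _ _ _ _ P0 mu id id (fun=> 1) p0.
  move=> /(_ _ _ _ _ _ _ sets (fun z => (w z * \1_B z)%:E)) H.
  transitivity (\int[P0]_x ((w x * \1_B x)%:E * 1))%E.
    apply: eq_integral => z _; rewrite mule1 patchE indicE.
    by case: ifP => _; rewrite ?mulr1 ?mulr0.
  rewrite H//.
    apply: eq_integral => z _; rewrite patchE indicE.
    by case: ifP => _; rewrite ?mulr1 ?mulr0 ?mul0e.
    by apply/measurable_EFinP; apply: measurable_funM.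
  by move=> z; rewrite lee_fin mulr_ge0.
pose F : n.-tuple Z -> R := \1_A.
have mF : measurable_fun setT F by exact: measurable_indic.
have F01 t : 0 <= F t <= 1.
  by rewrite /F indicE; case: (_ \in _); rewrite ?ler01 ?lexx.
have IF (T : probability Z R) : \int[iid T n]_t F t = fine (iid T n A).
  by rewrite Rint_indic.
have Ib (T : probability Z R) : 0 <= fine (iid T n A) <= 1.
  rewrite fine_ge0//= -lee_fin fineK ?probability_le1//.
  by rewrite fin_num_measure.
set H := \int[mu]_z _.
have [Lp Ip] := density_L1 dP; have [Lq Iq] := density_L1 dQmu.
have mS (f : Z -> R) : measurable_fun setT f ->
    measurable_fun setT (fun z => Num.sqrt (f z)).
  move=> mf; apply: measurableT_comp => //.
  by apply: continuous_measurable_fun; exact: sqrt_continuous.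
have L2S (f : Z -> R) : (forall z, 0 <= f z) -> L1 mu f ->
    L2 mu (fun z => Num.sqrt (f z)).
  move=> f0 Lf; split; first exact: mS (L1_measurable Lf).
  by rewrite (_ : (fun _ => _) = f)//; apply/funext => z; rewrite sqr_sqrtr.
have q0 z : 0 <= w z * p0 z by rewrite mulr_ge0.
(* [H] is a squared Hellinger distance, so the affinity is 1 - H / 2, and Bernoulli's inequality
   will bound 1 - (1 - H / 2)^(2n) by n H. *)
have rhoE : \int[mu]_z Num.sqrt (p z * (w z * p0 z)) = 1 - H / 2.
  have LM := L1M_L2 (L2S _ p_ge0 Lp) (L2S _ q0 Lq).
  have sqE z : Num.sqrt (p z * (w z * p0 z)) =
      Num.sqrt (p z) * Num.sqrt (w z * p0 z) by rewrite sqrtrM.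
  under eq_Rintegral do rewrite sqE.
  have -> : H = \int[mu]_z p z + \int[mu]_z (w z * p0 z)
      - 2 * \int[mu]_z (Num.sqrt (p z) * Num.sqrt (w z * p0 z)).
    rewrite -RintD// -RintZ// -RintB; [|exact: L1D|exact: L1Z].
    apply: eq_Rintegral => z _; rewrite sqrrB !sqr_sqrtr//; ring.
  by rewrite Ip Iq; field.
have H0 : 0 <= H by apply: Rint_ge0 => z; exact: sqr_ge0.
have rho0 : 0 <= 1 - H / 2 by rewrite -rhoE; apply: Rint_ge0 => z.
have := iid_affinity_le dP dQmu mF F01; rewrite !IF rhoE.
move=> /(affinity_dist_le (Ib P) (Ib Q) (exprn_ge0 n rho0)).
rewrite -exprM => dist.
have bern m : 1 - m%:R * (H / 2) <= (1 - H / 2) ^+ m.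
  elim: m => [|m IHm]; first by rewrite mul0r subr0 expr0.
  rewrite exprS -natr1.
  apply: le_trans (ler_wpM2l rho0 IHm).
  have : 0 <= m%:R * (H / 2) ^+ 2 by rewrite mulr_ge0// sqr_ge0.
  by move: (m%:R : R) => k; nra.
have dist2 : (fine (iid P n A) - fine (iid Q n A)) ^+ 2 <= n%:R * H.
  apply: (le_trans dist); rewrite lerBlDr -lerBlDl.
  apply: le_trans (bern (n * 2)%N).
  by rewrite natrM le_eqVlt; apply/orP; left; apply/eqP; field.
have d1 : fine (iid P n A) - fine (iid Q n A) <= Num.sqrt (n%:R * H).
  by rewrite (le_trans (ler_norm _))// -sqrtr_sqr ler_wsqrtr.
have d2 : fine (iid Q n A) <=
    Num.sqrt ((\int[P0]_z (w z ^+ 2)) ^+ n * fine (iid P0 n A)).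
  have := iid_chi2_le dQ w2 mF F01; rewrite IF.
  have -> : \int[iid P0 n]_t (F t ^+ 2) = fine (iid P0 n A).
    rewrite -IF; apply: eq_Rintegral => t _; rewrite /F indicE.
    by case: (_ \in _); rewrite ?expr1n ?expr0n.
  move=> h; rewrite -[leLHS]ger0_norm; last by case/andP: (Ib Q).
  by rewrite -sqrtr_sqr ler_wsqrtr.
by move: d1 d2; lra.
Qed.

End hellinger.

Lemma cvg_sqrt (R : realType) (u : nat -> R) l : u n @[n --> \oo] --> l ->
  Num.sqrt (u n) @[n --> \oo] --> Num.sqrt l.
Proof. by move=> ul; apply: (cvg_comp _ Num.sqrt ul); exact: sqrt_continuous. Qed.

Lemma cvg_invsqrtn (R : realType) :
  (Num.sqrt n%:R : R)^-1 @[n --> \oo] --> (0 : R).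
Proof.
have := cvg_sqrt (@cvg_invn R); rewrite sqrtr0; apply: cvg_trans.
by apply: near_eq_cvg; apply: nearW => n; rewrite sqrtrV.
Qed.

(** * First-order expansion of integrals along a differentiable path of laws *)

Section local_expansion.
Context {d : measure_display} {Z : measurableType d} {R : realType}.
Variables (mu : {measure set Z -> \bar R}) (P0 : probability Z R)
  (P : nat -> probability Z R) (f0 : Z -> R) (f : nat -> Z -> R) (s : Z -> R).
Hypotheses (dP0 : is_density mu P0 f0) (dP : forall n, is_density mu (P n) (f n))
  (s2 : L2 P0 s).

(* The remainder of the differentiability in quadratic mean of [P], with score
   [s], rescaled by sqrt n. *)
Definition qm_remainder n z : R :=
  Num.sqrt n%:R * (Num.sqrt (f n z) - Num.sqrt (f0 z)) - s z * Num.sqrt (f0 z) / 2.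

Hypothesis qm : \int[mu]_z (qm_remainder n z ^+ 2) @[n --> \oo] --> (0 : R).

Let f0_ge0 z : 0 <= f0 z. Proof. by case: dP0. Qed.
Let f_ge0 n z : 0 <= f n z. Proof. by case: (dP n). Qed.
Let ms : measurable_fun setT s. Proof. by case: s2. Qed.

Let mS (g : Z -> R) : measurable_fun setT g ->
  measurable_fun setT (fun z => Num.sqrt (g z)).
Proof.
move=> mg; apply: measurableT_comp => //.
by apply: continuous_measurable_fun; exact: sqrt_continuous.
Qed.

Let L2f0 : L2 mu (fun z => Num.sqrt (f0 z)).
Proof.
have [L _] := density_L1 dP0; split; first exact: mS (L1_measurable L).
by rewrite (_ : (fun _ => _) = f0)//; apply/funext => z; rewrite sqr_sqrtr.
Qed.

Let L2f n : L2 mu (fun z => Num.sqrt (f n z)).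
Proof.
have [L _] := density_L1 (dP n); split; first exact: mS (L1_measurable L).
by rewrite (_ : (fun _ => _) = f n)//; apply/funext => z; rewrite sqr_sqrtr.
Qed.

Lemma L2_mul_sqrt (g : Z -> R) : L2 P0 g -> L2 mu (fun z => g z * Num.sqrt (f0 z)).
Proof.
move=> [mg g2]; have mg2 : measurable_fun setT (fun z => g z ^+ 2).
  exact: measurable_funX.
split; first by apply: measurable_funM => //; case: L2f0.
rewrite (_ : (fun _ => _) = (fun z => g z ^+ 2 * f0 z)).
  exact: (L1_density dP0 mg2).1.
by apply/funext => z; rewrite exprMn sqr_sqrtr.
Qed.

Lemma Rint_mul_sqrt (g k : Z -> R) :
  measurable_fun [set: Z] g -> measurable_fun [set: Z] k ->
  \int[mu]_z (g z * Num.sqrt (f0 z) * (k z * Num.sqrt (f0 z))) =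
  \int[P0]_z (g z * k z).
Proof.
move=> mg mk; rewrite (Rint_density dP0); last exact: measurable_funM.
apply: eq_Rintegral => z _; rewrite mulrACA -expr2 sqr_sqrtr//.
Qed.

Let L2rem n : L2 mu (qm_remainder n).
Proof.
apply: L2B; first by apply: L2Z; apply: L2B.
rewrite (_ : (fun _ => _) = (fun z => 2^-1 * (s z * Num.sqrt (f0 z)))).
  by apply: L2Z; exact: L2_mul_sqrt.
by apply/funext => z; rewrite mulrC.
Qed.

Let qm_ge0 n : 0 <= \int[mu]_z (qm_remainder n z ^+ 2).
Proof. by apply: Rint_ge0 => z; exact: sqr_ge0. Qed.

Section expansion.
Variables (k : nat -> Z -> R) (C : R) (kappa D : Z -> R).
Hypotheses (mk : forall n, measurable_fun [set: Z] (k n))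
  (kC : forall n z, `|k n z| <= C)
  (D2 : L2 P0 D) (kD : forall n z, `|Num.sqrt n%:R * k n z| <= D z)
  (kkappa : forall z, Num.sqrt n%:R * k n z @[n --> \oo] --> kappa z).

Let mD : measurable_fun setT D. Proof. by case: D2. Qed.

Let C0 : 0 <= C \/ forall z : Z, False.
Proof.
have [[z _]|/set0P/negP] := pselect ([set: Z] !=set0); first by left; exact: le_trans (kC 0 z).
by rewrite negbK => /eqP E; right => z; have : [set: Z] z by []; rewrite E.
Qed.

Let rk n z := Num.sqrt n%:R * k n z.

Let L2rk n : L2 P0 (rk n).
Proof.
apply: L2_dom D2; first exact: measurable_funM.
by move=> z; rewrite (le_trans (kD n z))// ler_norm.
Qed.

(** With [v] the difference of the root densities times sqrt n, one has n (f_n - f_0) = 2 sqrt n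
    sqrt f_0 v + v^2. Writing v as s sqrt f_0 / 2 plus the remainder isolates the term in [s];
    Cauchy-Schwarz bounds the mixed term, and v^2 is at most twice the sum of the two squares. *)
Let expansion_bound n :
  `|n%:R * (\int[P n]_z k n z - \int[P0]_z k n z) - \int[P0]_z (rk n z * s z)|
  <= 2 * Num.sqrt (\int[P0]_z (D z ^+ 2) *
                   \int[mu]_z (qm_remainder n z ^+ 2))
     + \int[P0]_z (`|k n z| * s z ^+ 2) / 2
     + 2 * C * \int[mu]_z (qm_remainder n z ^+ 2).
Proof.
have Lk : L1 P0 (k n) by exact: L1_bounded_prob (mk n) (kC n).
have Lkn : L1 (P n) (k n) by exact: L1_bounded_prob (mk n) (kC n).
pose e := qm_remainder n; pose a z := Num.sqrt (f0 z).
pose v z := s z * a z / 2 + e z.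
have L2e : L2 mu e by exact: L2rem.
have L2sa : L2 mu (fun z => s z * a z / 2).
  rewrite (_ : (fun _ => _) = (fun z => 2^-1 * (s z * a z))).
    by apply: L2Z; exact: L2_mul_sqrt.
  by apply/funext => z; rewrite mulrC.
have L2v : L2 mu v by exact: L2D.
have L2rka : L2 mu (fun z => rk n z * a z) by exact: L2_mul_sqrt.
have mkv : measurable_fun setT (fun z => k n z * v z ^+ 2).
  by apply: measurable_funM => //; apply: measurable_funX; case: L2v.
have L1kv : L1 mu (fun z => k n z * v z ^+ 2).
  apply: (L1_le (g := fun z => C * v z ^+ 2)) => //.
    by move=> z; rewrite normrM [X in _ * X]ger0_norm ?sqr_ge0// ler_wpM2r ?sqr_ge0.
  by apply: L1Z; case: L2v.
have E : n%:R * (\int[P n]_z k n z - \int[P0]_z k n z) =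
    \int[P0]_z (rk n z * s z) + 2 * \int[mu]_z (rk n z * a z * e z)
    + \int[mu]_z (k n z * v z ^+ 2).
  have -> : \int[P0]_z (rk n z * s z) =
      \int[mu]_z (rk n z * a z * (s z * a z)).
    by rewrite Rint_mul_sqrt//; case: (L2rk n).
  rewrite (Rint_density dP0 (mk n)) (Rint_density (dP n) (mk n)).
  have L1f0 := (L1_density dP0 (mk n)).1 Lk.
  have L1f := (L1_density (dP n) (mk n)).1 Lkn.
  have L1re := L1M_L2 L2rka L2e.
  have L1rs := L1M_L2 L2rka (L2_mul_sqrt s2).
  rewrite -RintB// -!RintZ//; [|exact: L1B].
  rewrite -RintD//; [|exact: L1Z].
  rewrite -RintD//; [|by apply: L1D => //; exact: L1Z].
  apply: eq_Rintegral => z _; rewrite /v /e /qm_remainder /rk -/(a z).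
  rewrite -{1}(sqr_sqrtr (f_ge0 n z)) -{1}(sqr_sqrtr (f0_ge0 z)) -/(a z).
  rewrite -{1}(@sqr_sqrtr _ n%:R)//.
  by field.
have s2a : \int[mu]_z (`|k n z| * (s z * a z) ^+ 2) =
    \int[P0]_z (`|k n z| * s z ^+ 2).
  rewrite (Rint_density dP0); last first.
    by apply: measurable_funM; [exact: measurableT_comp|exact: measurable_funX].
  by apply: eq_Rintegral => z _; rewrite exprMn sqr_sqrtr// mulrA.
have T2 : `|\int[mu]_z (rk n z * a z * e z)| <=
    Num.sqrt (\int[P0]_z (D z ^+ 2) * \int[mu]_z (e z ^+ 2)).
  have CS : (\int[mu]_z (rk n z * a z * e z)) ^+ 2 <=
    \int[mu]_z ((rk n z * a z) ^+ 2) * \int[mu]_z (e z ^+ 2).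
    exact: Rint_cauchy_schwarz L2rka L2e.
  rewrite -sqrtr_sqr ler_wsqrtr// (le_trans CS)//.
  apply: ler_wpM2r; first exact: qm_ge0.
  have -> : \int[mu]_z ((rk n z * a z) ^+ 2) = \int[P0]_z (rk n z ^+ 2).
    by under eq_Rintegral do rewrite expr2; rewrite Rint_mul_sqrt//; case: (L2rk n).
  apply: Rint_le; [by case: (L2rk n)|by case: D2|] => z.
  by rewrite -real_normK ?num_real// lerXn2r ?nnegrE// (le_trans _ (kD n z)).
have T3 : `|\int[mu]_z (k n z * v z ^+ 2)| <=
    \int[P0]_z (`|k n z| * s z ^+ 2) / 2 + 2 * C * \int[mu]_z (e z ^+ 2).
  have L1ks : L1 mu (fun z => `|k n z| * (s z * a z) ^+ 2).
    apply: (L1_le (g := fun z => C * (s z * a z) ^+ 2)).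
    - apply: measurable_funM; first exact: measurableT_comp.
      by apply: measurable_funX; case: (L2_mul_sqrt s2).
    - move=> z; rewrite normrM normr_id [X in _ * X]ger0_norm ?sqr_ge0//.
      by rewrite ler_wpM2r ?sqr_ge0.
    - by apply: L1Z; case: (L2_mul_sqrt s2).
  have L1e2 : L1 mu (fun z => e z ^+ 2) by case: L2e.
  rewrite -s2a mulrC -!RintZ// -RintD; [|exact: L1Z|exact: L1Z].
  apply: Rint_norm_le => //; first by apply: L1D; exact: L1Z.
  move=> z; rewrite normrM [`|v z ^+ 2|]ger0_norm ?sqr_ge0//.
  apply: (@le_trans _ _ (`|k n z| * (2 * (s z * a z / 2) ^+ 2 + 2 * e z ^+ 2))).
    rewrite ler_wpM2l// -subr_ge0.
    rewrite (_ : _ - _ = (s z * a z / 2 - e z) ^+ 2) ?sqr_ge0// /v; ring.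
  rewrite mulrDr lerD//.
    by rewrite le_eqVlt; apply/orP; left; apply/eqP; field.
  by rewrite mulrCA -mulrA ler_wpM2l// ler_wpM2r// sqr_ge0.
have AK (A B B' : R) : A + B + B' - A = B + B' by ring.
rewrite E AK (le_trans (ler_normD _ _))//.
by rewrite -addrA lerD// normrM ger0_norm// ler_wpM2l.
Qed.

(** Test functions of order n^(-1/2) are matched to a change of law of the same order, so that n
    times the difference of the integrals has a finite limit. *)
Lemma local_expansion :
  n%:R * (\int[P n]_z k n z - \int[P0]_z k n z) @[n --> \oo] -->
  \int[P0]_z (kappa z * s z).
Proof.
have k0 z : k n z @[n --> \oo] --> (0 : R).
  apply: (@cvg_norm_le _ _ (fun n => `|(Num.sqrt n%:R)^-1 * D z|)).
    near=> n; have n0 : (0 : R) < Num.sqrt n%:R.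
      by rewrite sqrtr_gt0 ltr0n; near: n; exists 1%N.
    rewrite subr0 normrM gtr0_norm ?invr_gt0// mulrC ler_pdivlMr// mulrC.
    rewrite -{1}(gtr0_norm n0) -normrM (le_trans (kD n z))// ler_norm//.
  have -> : (0 : R) = `|0 * D z| by rewrite mul0r normr0.
  apply: cvg_norm; apply: cvgMl.
  exact: cvg_invsqrtn.
have main : \int[P0]_z (rk n z * s z) @[n --> \oo] -->
    \int[P0]_z (kappa z * s z).
  apply: (dominated_cvgR (g := fun z => D z * `|s z|)).
  - by move=> n; apply: measurable_funM => //; case: (L2rk n).
  - by move=> z; apply: cvgMl; exact: kkappa.
  - by apply: L1M_L2 => //; exact: L2_norm.
  - by move=> n z; rewrite normrM ler_wpM2r//; exact: kD.
have small : \int[P0]_z (`|k n z| * s z ^+ 2) @[n --> \oo] --> (0 : R).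
  have -> : (0 : R) = \int[P0]_z 0 by rewrite Rint_cst.
  apply: (dominated_cvgR (g := fun z => C * s z ^+ 2)).
  - move=> n; apply: measurable_funM; first exact: measurableT_comp.
    exact: measurable_funX.
  - move=> z; rewrite -(mul0r (s z ^+ 2)); apply: cvgMl.
    have -> : (0 : R) = `|0 : R| by rewrite normr0.
    by apply: cvg_norm; exact: k0.
  - by apply: L1Z; case: s2.
  - move=> n z; rewrite normrM normr_id [X in _ * X]ger0_norm ?sqr_ge0//.
    by rewrite ler_wpM2r ?sqr_ge0.
rewrite -[X in _ --> X]add0r.
have -> : (fun n => n%:R * (\int[P n]_z k n z - \int[P0]_z k n z)) =
  (fun n => (n%:R * (\int[P n]_z k n z - \int[P0]_z k n z)
     - \int[P0]_z (rk n z * s z)) + \int[P0]_z (rk n z * s z)).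
  by apply/funext => n; rewrite subrK.
apply: cvgD main; apply: (cvg_norm_le (v := fun n => _)).
  by near=> n; rewrite subr0; exact: expansion_bound.
have z0 : (0 : R) = 2 * Num.sqrt (\int[P0]_z (D z ^+ 2) * 0) + 0 / 2 + 2 * C * 0.
  by rewrite !mulr0 sqrtr0 mul0r mulr0 !addr0.
rewrite [X in _ --> X]z0; apply: cvgD.
  apply: cvgD; last by apply: cvgMl.
  by apply: cvgMr; apply: cvg_sqrt; exact: cvgMr.
exact: cvgMr.
Unshelve. all: by end_near. Qed.

End expansion.

(** For the constant functions [(Num.sqrt n%:R)^-1] the expansion compares 0, both laws having mass
    1, with the mean of [s]. *)
Lemma score_mean0 : \int[P0]_z s z = 0.
Proof.
have L21 : L2 P0 (fun=> 1) by exact: L2_cst probability_fin.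
have rn n : `|Num.sqrt n%:R * (Num.sqrt n%:R)^-1| <= 1 :> R.
  have [->|n0] := eqVneq (Num.sqrt n%:R : R) 0; first by rewrite mul0r normr0.
  by rewrite divff// normr1.
have C1 n : `|(Num.sqrt n%:R)^-1| <= 1 :> R.
  rewrite normfV ger0_norm//; case: n => [|n].
    by rewrite sqrtr0 invr0.
  by rewrite invf_le1 ?sqrtr_gt0// -[leLHS]sqrtr1 ler_wsqrtr// ler1n.
have L := @local_expansion (fun n _ => (Num.sqrt n%:R)^-1) 1 (fun=> 1) (fun=> 1)
  (fun n => measurable_cst _) (fun n _ => C1 n) L21 (fun n _ => rn n).
have : n%:R * (\int[P n]_z (Num.sqrt n%:R)^-1 - \int[P0]_z (Num.sqrt n%:R)^-1)
    @[n --> \oo] --> \int[P0]_z (1 * s z).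
  apply: L => _; apply: cvg_near_cst; near=> n.
  by rewrite divff// gt_eqF// sqrtr_gt0 ltr0n; near: n; exists 1%N.
under eq_cvg do rewrite !Rint_cst subrr mulr0.
under eq_Rintegral do rewrite mul1r.
by move=> /cvg_lim <-//; rewrite lim_cst.
Unshelve. all: by end_near. Qed.

End local_expansion.

(** * Contiguity by truncation of the score *)

Section contiguity.
Context {d : measure_display} {Z : measurableType d} {R : realType}.
Variables (mu : {measure set Z -> \bar R}) (P0 : probability Z R)
  (P : nat -> probability Z R) (f0 : Z -> R) (f : nat -> Z -> R) (s : Z -> R).
Hypotheses (dP0 : is_density mu P0 f0) (dP : forall n, is_density mu (P n) (f n))
  (s2 : L2 P0 s).
Hypothesis qm : \int[mu]_z (qm_remainder f0 f s n z ^+ 2)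
  @[n --> \oo] --> (0 : R).

Let ms : measurable_fun setT s. Proof. by case: s2. Qed.

(** The intermediate law will have density [1 + u M n z] with respect to [P0]. Truncation makes it
    nonnegative for large n and controls its second moment; centring by [c M] gives it mass 1. *)
Let truncated (M : nat) z : R := s z * \1_[set z | `|s z| <= M%:R] z.

Let mtruncated M : measurable_fun setT (truncated M).
Proof.
apply: measurable_funM => //; apply: measurable_indic.
rewrite -[X in measurable X]setTI; apply: measurable_fun_le => //.
exact: measurableT_comp.
Qed.

Let truncated_le_s M z : `|truncated M z| <= `|s z|.
Proof.
by rewrite /truncated normrM indicE ler_piMr//; case: (_ \in _); rewrite ?normr1 ?normr0.
Qed.

Let truncated_le M z : `|truncated M z| <= M%:R.
Proof.
rewrite /truncated indicE; case: (boolP (z \in _)) => [/set_mem /= h|_].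
  by rewrite mulr1.
by rewrite mulr0 normr0.
Qed.

Let truncated_cvg z : truncated M z @[M --> \oo] --> s z.
Proof.
apply: cvg_near_cst; near=> M; rewrite /truncated indicE mem_set ?mulr1//=.
by near: M; exact: nbhs_infty_ger.
Unshelve. all: by end_near. Qed.

Let c M : R := \int[P0]_z truncated M z.

Let sM M z : R := truncated M z - c M.

Let c_cvg : c M @[M --> \oo] --> (0 : R).
Proof.
rewrite -(score_mean0 dP0 dP s2 qm); apply: (dominated_cvgR (g := fun z => `|s z|)) => //.
by apply: L1_norm; exact: L2_L1_prob.
Qed.

Let L1truncated M : L1 P0 (truncated M).
Proof. exact: L1_bounded_prob (mtruncated M) (truncated_le M). Qed.

Let sM_le M z : `|sM M z| <= 2 * M%:R.
Proof.
rewrite (le_trans (ler_normB _ _))// mulr2n mulrDl mul1r lerD//.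
by apply: Rint_bounded => // z'; exact: truncated_le.
Qed.

Let msM M : measurable_fun setT (sM M).
Proof. exact: measurable_funB. Qed.

Let L1sM M : L1 P0 (sM M).
Proof. exact: L1_bounded_prob (msM M) (sM_le M). Qed.

Let sM_mean0 M : \int[P0]_z sM M z = 0.
Proof. by rewrite RintB ?Rint_cst ?subrr//; exact: L1_cst. Qed.

Let sM_cvg : \int[P0]_z ((s z - sM M z) ^+ 2) @[M --> \oo] --> (0 : R).
Proof.
have -> : (0 : R) = \int[P0]_z 0 by rewrite Rint_cst.
have c1 M : `|c M| <= \int[P0]_z `|s z|.
  by apply: Rint_norm_le => //; apply: L1_norm; exact: L2_L1_prob.
set I := \int[P0]_z `|s z| in c1.
apply: (dominated_cvgR (g := fun z => (2 * `|s z| + I) ^+ 2)).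
- by move=> M; apply: measurable_funX; exact: measurable_funB.
- move=> z; have -> : (0 : R) = (s z - (s z - 0)) ^+ 2 by rewrite subr0 subrr expr0n.
  rewrite expr2; under eq_cvg do rewrite expr2.
  by apply: cvgM; apply: cvgB; [exact: cvg_cst|exact: cvgB|exact: cvg_cst|exact: cvgB].
- have [//] : L2 P0 (fun z => 2 * `|s z| + I).
  apply: L2D; last exact: L2_cst probability_fin.
  by apply: L2Z; exact: L2_norm.
- move=> M z; rewrite normrX lerXn2r ?nnegrE//.
    by rewrite addr_ge0 ?mulr_ge0//; apply: Rint_ge0 => ?.
  rewrite /sM opprB addrCA addrC (le_trans (ler_normD _ _))// lerD//.
  rewrite mulr2n mulrDl mul1r (le_trans (ler_normB _ _))// lerD//.
Qed.

(** With r the root of 1 + u, the error is exactly - (r - 1)^2 / 2, while u = (r - 1) (r + 1) and r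
    + 1 >= 1. *)
Let sqrt1Dx_le (u : R) : `|u| <= 1 / 2 -> `|Num.sqrt (1 + u) - 1 - u / 2| <= u ^+ 2.
Proof.
rewrite ler_norml => /andP[u1 u2].
set r := Num.sqrt (1 + u).
have r0 : 0 <= r by exact: sqrtr_ge0.
have r2 : r ^+ 2 = 1 + u by rewrite sqr_sqrtr//; lra.
move: r r0 r2 => r r0 r2.
have uE : u = (r - 1) * (r + 1).
  have -> : (r - 1) * (r + 1) = r ^+ 2 - 1 by ring.
  by rewrite r2; ring.
have -> : r - 1 - u / 2 = - ((r - 1) ^+ 2 / 2) by rewrite uE; field.
rewrite normrN ger0_norm ?divr_ge0 ?sqr_ge0// uE exprMn ler_wpM2l ?sqr_ge0//.
by rewrite (@le_trans _ _ 1)// ?expr_ge1 ?lerDr//; lra.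
Qed.

Let sqr3_le (x y z : R) : (x + y + z) ^+ 2 <= 3 * (x ^+ 2 + y ^+ 2 + z ^+ 2).
Proof.
rewrite -subr_ge0 (_ : _ - _ = (x - y) ^+ 2 + (y - z) ^+ 2 + (x - z) ^+ 2).
  by rewrite !addr_ge0// sqr_ge0.
by ring.
Qed.

Let u M n z : R := sM M z / Num.sqrt n%:R.

Let mu_ M n : measurable_fun setT (u M n).
Proof. exact: measurable_funM. Qed.

Let u_sqr_le M n z : u M n z ^+ 2 <= 4 * M%:R ^+ 2 / n%:R.
Proof.
rewrite /u exprMn exprVn sqr_sqrtr// ler_wpM2r ?invr_ge0//.
rewrite -real_normK ?num_real// (_ : 4 * _ = (2 * M%:R) ^+ 2); last by ring.
by rewrite lerXn2r ?nnegrE ?mulr_ge0.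
Qed.

Let u_le M n z : 16 * M%:R ^+ 2 <= n%:R :> R -> `|u M n z| <= 1 / 2.
Proof.
move=> nM; rewrite -(@ler_pXn2r _ 2)// ?nnegrE ?divr_ge0//.
rewrite real_normK ?num_real// (le_trans (u_sqr_le M n z))//.
case: n nM => [|n] nM; first by rewrite invr0 mulr0 sqr_ge0.
by rewrite ler_pdivrMr// expr_div_n expr1n; lra.
Qed.

Let L2w M n : L2 P0 (fun z => 1 + u M n z).
Proof.
apply: L2D; first exact: L2_cst probability_fin.
split=> //; apply: (L1_bounded_prob (C := 4 * M%:R ^+ 2 / n%:R)).
  exact: measurable_funX.
by move=> z; rewrite ger0_norm ?sqr_ge0.
Qed.

(** The rescaled difference of roots is the sum of the quadratic mean remainder, half the truncation
    error of the score, and the Taylor error of the square root. The last is at most u^2 <= 4 M^2 /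
    n, and n times its square is the term 16 M^4 / n. The threshold on n ensures that |u| <= 1 /
    2. *)
Let hellinger_truncated M n : 16 * M%:R ^+ 2 <= n%:R :> R ->
  n%:R * \int[mu]_z ((Num.sqrt (f n z) -
    Num.sqrt ((1 + u M n z) * f0 z)) ^+ 2) <=
  3 * (\int[mu]_z (qm_remainder f0 f s n z ^+ 2)
       + \int[P0]_z ((s z - sM M z) ^+ 2) / 4 + 16 * M%:R ^+ 4 / n%:R).
Proof.
move=> nM; have [n0|n0] := posnP n.
  rewrite n0 mul0r invr0 mulr0 addr0 mulr_ge0// addr_ge0// ?divr_ge0//;
    by apply: Rint_ge0 => z; exact: sqr_ge0.
pose r : R := Num.sqrt n%:R.
have r0 : 0 < r by rewrite sqrtr_gt0 ltr0n.
have w0 z : 0 <= 1 + u M n z by have := u_le z nM; rewrite ler_norml => /andP[]; lra.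
have f00 z : 0 <= f0 z by case: dP0.
pose a z := Num.sqrt (f0 z).
pose rem := qm_remainder f0 f s n.
have L2g (g : Z -> R) := @L2_mul_sqrt _ _ _ mu P0 f0 dP0 g.
have L2ss : L2 P0 (fun z => s z - sM M z).
  apply: L2B => //; split=> //; apply: (L1_bounded_prob (C := (2 * M%:R) ^+ 2)).
    exact: measurable_funX.
  move=> z; rewrite normrX lerXn2r ?nnegrE//; exact: sM_le.
have L2sw : L2 P0 (fun z => Num.sqrt (1 + u M n z)).
  split.
    apply: measurableT_comp; last exact: measurable_funD.
    by apply: continuous_measurable_fun; exact: sqrt_continuous.
  rewrite (_ : (fun _ => _) = (fun z => 1 + u M n z)); first exact: L2_L1_prob.
  by apply/funext => z; rewrite sqr_sqrtr.
have L2f : L2 mu (fun z => Num.sqrt (f n z)).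
  have [Lf _] := density_L1 (dP n); split.
    apply: measurableT_comp; last exact: L1_measurable Lf.
    by apply: continuous_measurable_fun; exact: sqrt_continuous.
  rewrite (_ : (fun _ => _) = f n)//; apply/funext => z; rewrite sqr_sqrtr//.
  by case: (dP n).
have L2a : L2 mu a.
  rewrite (_ : a = (fun z => 1 * Num.sqrt (f0 z))).
    by apply: L2g; exact: L2_cst probability_fin.
  by apply/funext => z; rewrite mul1r.
have L2rem : L2 mu rem.
  apply: L2B; first by apply: L2Z; exact: L2B.
  rewrite (_ : (fun _ => _) = (fun z => 2^-1 * (s z * Num.sqrt (f0 z)))).
    by apply: L2Z; exact: L2g.
  by apply/funext => z; rewrite mulrC.
have swE z : Num.sqrt ((1 + u M n z) * f0 z) = Num.sqrt (1 + u M n z) * a z.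
  by rewrite sqrtrM.
have L2d : L2 mu (fun z => Num.sqrt (f n z) - Num.sqrt (1 + u M n z) * a z).
  by apply: L2B => //; exact: L2g.
have nr : (n%:R : R) = r ^+ 2 by rewrite sqr_sqrtr.
under eq_Rintegral do rewrite swE.
have -> : \int[P0]_z ((s z - sM M z) ^+ 2) =
    \int[mu]_z (((s z - sM M z) * a z) ^+ 2).
  rewrite -(Rint_mul_sqrt (P0 := P0) dP0); [|by case: L2ss|by case: L2ss].
  by apply: eq_Rintegral => z _; rewrite expr2.
have [_ L1ss] := L2g _ L2ss; have [_ L1rem] := L2rem.
have [Lf0 If0] := density_L1 dP0; have [_ L1d] := L2d.
have L1t : L1 mu (fun z => 16 * M%:R ^+ 4 / n%:R * f0 z) by exact: L1Z.
have L1q : L1 mu (fun z => 4^-1 * ((s z - sM M z) * a z) ^+ 2) by exact: L1Z.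
have -> : 3 * (\int[mu]_z (qm_remainder f0 f s n z ^+ 2)
      + \int[mu]_z (((s z - sM M z) * a z) ^+ 2) / 4 + 16 * M%:R ^+ 4 / n%:R) =
    \int[mu]_z (3 * (rem z ^+ 2 + (4^-1 * ((s z - sM M z) * a z) ^+ 2
      + 16 * M%:R ^+ 4 / n%:R * f0 z))).
  rewrite RintZ; last by apply: L1D => //; exact: L1D.
  rewrite RintD//; last exact: L1D.
  rewrite RintD// !RintZ// If0 mulr1 addrA; congr (3 * (_ + _ + _)).
  exact: mulrC.
rewrite -RintZ//; apply: Rint_le.
- exact: L1Z.
- by apply: L1Z; apply: L1D => //; exact: L1D.
move=> z; rewrite nr -exprMn.
have -> : r * (Num.sqrt (f n z) - Num.sqrt (1 + u M n z) * a z) =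
    rem z + (s z - sM M z) * a z / 2
    + r * (- (Num.sqrt (1 + u M n z) - 1 - u M n z / 2)) * a z.
  have -> : sM M z = r * u M n z by rewrite mulrC divfK// gt_eqF.
  by rewrite /rem /qm_remainder -/(a z) -/r; field.
apply: le_trans (sqr3_le _ _ _) _; rewrite ler_wpM2l// -addrA lerD2l lerD//.
  by rewrite le_eqVlt; apply/orP; left; apply/eqP; field.
have a2 : a z ^+ 2 = f0 z by rewrite sqr_sqrtr.
rewrite [leLHS]exprMn a2 [in leLHS]exprMn sqrrN -nr; apply: ler_wpM2r => //.
have h1 : (Num.sqrt (1 + u M n z) - 1 - u M n z / 2) ^+ 2 <= (4 * M%:R ^+ 2 / n%:R) ^+ 2.
  rewrite -real_normK ?num_real// lerXn2r ?nnegrE// ?divr_ge0// ?mulr_ge0// ?sqr_ge0//.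
  by apply: le_trans (sqrt1Dx_le (u_le z nM)) _; exact: u_sqr_le.
have n0' : (0 : R) < n%:R by rewrite ltr0n.
apply: (le_trans (ler_wpM2l (ltW n0') h1)).
by rewrite le_eqVlt; apply/orP; left; apply/eqP; field; rewrite gt_eqF.
Qed.

(** As [u] has mean 0, the integral is at most 1 + 4 M^2 / n <= exp (4 M^2 / n), and the n-th power
    of this bound is free of n. *)
Let chi2_truncated M n : 16 * M%:R ^+ 2 <= n%:R :> R ->
  (\int[P0]_z ((1 + u M n z) ^+ 2)) ^+ n <= expR (4 * M%:R ^+ 2).
Proof.
move=> nM; have [->|n0] := posnP n; first by rewrite expr0 -expR0 ler_expR mulr_ge0 ?sqr_ge0.
have n0' : (0 : R) < n%:R by rewrite ltr0n.
have Lu : L1 P0 (u M n).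
  by apply: (L1_bounded_prob (C := 1 / 2)) => // z; exact: u_le.
have Lu2 : L1 P0 (fun z => u M n z ^+ 2).
  apply: (L1_bounded_prob (C := 4 * M%:R ^+ 2 / n%:R)); first exact: measurable_funX.
  by move=> z; rewrite ger0_norm ?sqr_ge0.
have u0 : \int[P0]_z u M n z = 0.
  rewrite /u; under eq_Rintegral do rewrite mulrC.
  by rewrite RintZ ?sM_mean0 ?mulr0//; exact: L1sM.
have -> : \int[P0]_z ((1 + u M n z) ^+ 2) = 1 + \int[P0]_z (u M n z ^+ 2).
  transitivity (\int[P0]_z (1 + (2 * u M n z + u M n z ^+ 2))).
    by apply: eq_Rintegral => z _; ring.
  rewrite RintD; [|exact: L1_cst|by apply: L1D => //; exact: L1Z].
  by rewrite Rint_cst RintD//; [rewrite RintZ// u0 mulr0 add0r|exact: L1Z].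
have h : 1 + \int[P0]_z (u M n z ^+ 2) <= expR (4 * M%:R ^+ 2 / n%:R).
  apply: le_trans (expR_ge1Dx _); rewrite lerD2l -[leRHS](Rint_cst (P := P0)).
  by apply: Rint_le => //; exact: L1_cst.
have h0 : 0 <= 1 + \int[P0]_z (u M n z ^+ 2).
  by rewrite addr_ge0//; apply: Rint_ge0 => z; exact: sqr_ge0.
rewrite (le_trans (lerXn2r n _ _ h)) ?nnegrE ?expR_ge0//.
by rewrite -expRM_natr divfK// gt_eqF.
Qed.

Lemma contiguity (e : R) : 0 < e -> exists2 C : R, 0 < C &
  \forall n \near \oo, forall A : set (n.-tuple Z), measurable A ->
    fine (iid (P n) n A) <= e + C * Num.sqrt (fine (iid P0 n A)).
Proof.
move=> e0; have e2 : 0 < e ^+ 2 / 12 by rewrite divr_gt0// exprn_gt0.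
have e3 : 0 < e ^+ 2 / 3 by rewrite divr_gt0// exprn_gt0.
(* [M] is fixed before n, so that the constant depends on [e] alone. The tolerances e^2 / 3 and e^2
   / 12 keep the Hellinger bound 3 (x + y / 4 + z) below e^2. *)
have /cvgrPdist_le/(_ _ e3)[M _ /(_ _ (leqnn M)) /= hM] := sM_cvg.
exists (Num.sqrt (expR (4 * M%:R ^+ 2))); first by rewrite sqrtr_gt0 expR_gt0.
have cM : 16 * M%:R ^+ 4 / n%:R @[n --> \oo] --> (0 : R) by exact: cvg_divn.
have /cvgrPdist_le/(_ _ e2) q2 := qm; have /cvgrPdist_le/(_ _ e2) M2 := cM.
near=> n => A mA.
have nM : 16 * M%:R ^+ 2 <= n%:R :> R by near: n; exact: nbhs_infty_ger.
have h1 : `|0 - \int[mu]_z (qm_remainder f0 f s n z ^+ 2)| <= e ^+ 2 / 12.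
  by near: n.
have h2 : `|0 - 16 * M%:R ^+ 4 / n%:R| <= e ^+ 2 / 12.
  by near: n.
have w0 z : 0 <= 1 + u M n z by have := u_le z nM; rewrite ler_norml => /andP[]; lra.
have w1 : \int[P0]_z (1 + u M n z) = 1.
  have Lu : L1 P0 (u M n).
    by apply: (L1_bounded_prob (C := 1 / 2)) => // z; exact: u_le.
  rewrite RintD ?Rint_cst//; last exact: L1_cst.
  rewrite /u; under eq_Rintegral do rewrite mulrC.
  by rewrite RintZ ?sM_mean0 ?mulr0 ?addr0//; exact: L1sM.
apply: (le_trans (iid_prob_le (dP n) dP0 (L2w M n) w0 w1 mA)); rewrite lerD//.
  rewrite -[leRHS](ger0_norm (ltW e0)) -[leRHS]sqrtr_sqr ler_wsqrtr//.
  apply: (le_trans (hellinger_truncated nM)).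
  move: h1 h2 hM; rewrite !sub0r !normrN => h1 h2 hM.
  have arith (x y z t : R) : `|x| <= t / 12 -> `|z| <= t / 12 -> `|y| <= t / 3 ->
      3 * (x + y / 4 + z) <= t.
    by rewrite !ler_norml => /andP[? ?] /andP[? ?] /andP[? ?]; lra.
  exact: arith.
rewrite -sqrtrM ?expR_ge0// ler_wsqrtr// ler_wpM2r ?fine_ge0//.
exact: chi2_truncated.
Unshelve. all: by end_near. Qed.

End contiguity.

(** * The central limit theorem along local alternatives *)

Section local_clt.
Context {d : measure_display} {Z : measurableType d} {R : realType}.

Lemma sqrtn_sin_cvg (y : R) :
  Num.sqrt n%:R * sin (y / Num.sqrt n%:R) @[n --> \oo] --> y.
Proof.
apply: (@cvg_norm_le _ _ (fun n => (2 * y ^+ 2) * (Num.sqrt n%:R)^-1)); last first.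
  by rewrite -[X in _ --> X](mulr0 (2 * y ^+ 2)); apply: cvgMr; exact: cvg_invsqrtn.
near=> n; have n0 : (0 : R) < Num.sqrt n%:R.
  by rewrite sqrtr_gt0 ltr0n; near: n; exists 1%N.
have -> : Num.sqrt n%:R * sin (y / Num.sqrt n%:R) - y =
    Num.sqrt n%:R * (sin (y / Num.sqrt n%:R) - y / Num.sqrt n%:R).
  by rewrite mulrBr [X in _ = _ - X]mulrC divfK// gt_eqF.
rewrite normrM gtr0_norm//.
have := abs_sinB_le_sqr (y / Num.sqrt n%:R) => /(ler_wpM2l (ltW n0)) /le_trans; apply.
by rewrite le_eqVlt; apply/orP; left; apply/eqP; field; exact: lt0r_neq0.
Unshelve. all: by end_near. Qed.

Lemma sqrtn_cosB1_cvg (y : R) :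
  Num.sqrt n%:R * (cos (y / Num.sqrt n%:R) - 1) @[n --> \oo] --> (0 : R).
Proof.
apply: (@cvg_norm_le _ _ (fun n => (y ^+ 2 / 2) * (Num.sqrt n%:R)^-1)); last first.
  by rewrite -[X in _ --> X](mulr0 (y ^+ 2 / 2)); apply: cvgMr; exact: cvg_invsqrtn.
near=> n; have n0 : (0 : R) < Num.sqrt n%:R.
  by rewrite sqrtr_gt0 ltr0n; near: n; exists 1%N.
rewrite subr0 normrM gtr0_norm//.
have := abs_cosB1_le (y / Num.sqrt n%:R) => /(ler_wpM2l (ltW n0)) /le_trans; apply.
by rewrite le_eqVlt; apply/orP; left; apply/eqP; field; exact: lt0r_neq0.
Unshelve. all: by end_near. Qed.

Lemma n_sinB_cvg (y : R) :
  n%:R * (sin (y / Num.sqrt n%:R) - y / Num.sqrt n%:R) @[n --> \oo] --> (0 : R).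
Proof.
apply: (@cvg_norm_le _ _ (fun n => (`|y| ^+ 3) * (Num.sqrt n%:R)^-1)); last first.
  by rewrite -[X in _ --> X](mulr0 (`|y| ^+ 3)); apply: cvgMr; exact: cvg_invsqrtn.
near=> n; have n0 : (0 : R) < Num.sqrt n%:R.
  by rewrite sqrtr_gt0 ltr0n; near: n; exists 1%N.
rewrite subr0 normrM ger0_norm//.
have := abs_sinB_le (y / Num.sqrt n%:R) => /(ler_wpM2l (ler0n R n)) /le_trans; apply.
rewrite normrM normfV (gtr0_norm n0) -{1}(@sqr_sqrtr _ n%:R)//.
by rewrite le_eqVlt; apply/orP; left; apply/eqP; field; exact: lt0r_neq0.
Unshelve. all: by end_near. Qed.

Lemma n_cosB1_cvg (y : R) :
  n%:R * (cos (y / Num.sqrt n%:R) - 1) @[n --> \oo] --> - (y ^+ 2 / 2).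
Proof.
apply: (@cvg_norm_le _ _ (fun n => (y ^+ 4) / n%:R)); last exact: cvg_divn.
near=> n; have n0 : (0 : R) < Num.sqrt n%:R.
  by rewrite sqrtr_gt0 ltr0n; near: n; exists 1%N.
have nr : n%:R = Num.sqrt n%:R ^+ 2 :> R by rewrite sqr_sqrtr.
have nn : (0 : R) <= n%:R by [].
move: n0 nr nn; set r := Num.sqrt n%:R => n0 nr nn.
have -> : n%:R * (cos (y / r) - 1) - - (y ^+ 2 / 2) =
    n%:R * (cos (y / r) - 1 + (y / r) ^+ 2 / 2).
  by rewrite nr; field; exact: lt0r_neq0.
rewrite normrM (ger0_norm nn).
have := abs_cosB_quad_le (y / r) => /(ler_wpM2l nn) /le_trans; apply.
by rewrite nr le_eqVlt; apply/orP; left; apply/eqP; field; exact: lt0r_neq0.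
Unshelve. all: by end_near. Qed.

Let sqrtn_sqr n (y : R) : n%:R * (y / Num.sqrt n%:R) ^+ 2 <= y ^+ 2.
Proof.
rewrite exprMn exprVn sqr_sqrtr// mulrCA ler_piMr ?sqr_ge0//.
by have [->|n0] := eqVneq (n%:R : R) 0; rewrite ?mul0r// divff.
Qed.

Let sqrtn_norm n (y : R) : Num.sqrt n%:R * `|y / Num.sqrt n%:R| <= `|y|.
Proof.
rewrite normrM normfV [X in _ / X]ger0_norm// mulrCA ler_piMr//.
by have [->|n0] := eqVneq (Num.sqrt n%:R : R) 0; rewrite ?mul0r// divff.
Qed.

Section base.
Variables (P0 : probability Z R) (psi : Z -> R).
Hypotheses (psi2 : L2 P0 psi) (psi0 : \int[P0]_z psi z = 0).

Let mpsi : measurable_fun setT psi. Proof. by case: psi2. Qed.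

Let mk n : measurable_fun setT (fun z => psi z / Num.sqrt n%:R).
Proof. exact: measurable_funM. Qed.

Let msin n : measurable_fun setT (fun z => sin (psi z / Num.sqrt n%:R)).
Proof.
apply: measurableT_comp => //.
by apply: continuous_measurable_fun; exact: continuous_sin.
Qed.

Let mcos n : measurable_fun setT (fun z => cos (psi z / Num.sqrt n%:R) - 1).
Proof.
apply: measurable_funB => //; apply: measurableT_comp => //.
by apply: continuous_measurable_fun; exact: continuous_cos.
Qed.

Let base_cos : n%:R * \int[P0]_z (cos (psi z / Num.sqrt n%:R) - 1)
  @[n --> \oo] --> - (\int[P0]_z (psi z ^+ 2) / 2).
Proof.
have L (n : nat) : L1 P0 (fun z => cos (psi z / Num.sqrt n%:R) - 1).
  apply: (L1_bounded_prob (C := 2)) => // z.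
  by rewrite (le_trans (ler_normB _ _))// normr1 mulr2n lerD2r cos_max.
have -> : - (\int[P0]_z (psi z ^+ 2) / 2) = \int[P0]_z (- (psi z ^+ 2 / 2)).
  under [RHS]eq_Rintegral do rewrite -mulNr mulrC -[- _]mulN1r mulrA.
  by rewrite RintZ; [ring|case: psi2].
under eq_cvg do rewrite -RintZ//.
apply: (dominated_cvgR (g := fun z => psi z ^+ 2)).
- by move=> n; exact: measurable_funM.
- by move=> z; exact: n_cosB1_cvg.
- by case: psi2.
- move=> n z; rewrite normrM ger0_norm//.
  apply: le_trans (sqrtn_sqr n (psi z)); rewrite ler_wpM2l//.
  apply: le_trans (abs_cosB1_le _) _.
  by rewrite ler_pdivrMr// ler_peMr ?sqr_ge0// ler1n.
Qed.

Let base_sin : n%:R * \int[P0]_z sin (psi z / Num.sqrt n%:R)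
  @[n --> \oo] --> (0 : R).
Proof.
have L1psi := L2_L1_prob psi2.
have L (n : nat) : L1 P0 (fun z => sin (psi z / Num.sqrt n%:R)).
  by apply: (L1_bounded_prob (C := 1)) => // z; exact: sin_max.
have Lk (n : nat) : L1 P0 (fun z => psi z / Num.sqrt n%:R).
  under eq_fun do rewrite mulrC; exact: L1Z.
have E n : n%:R * \int[P0]_z sin (psi z / Num.sqrt n%:R) =
    \int[P0]_z (n%:R * (sin (psi z / Num.sqrt n%:R) - psi z / Num.sqrt n%:R)).
  rewrite RintZ; last exact: L1B.
  rewrite RintB//; under [X in _ = _ * (_ - X)]eq_Rintegral do rewrite mulrC.
  by rewrite RintZ// psi0 mulr0 subr0.
rewrite (_ : (fun n => _) = (fun n => \int[P0]_z (n%:R *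
    (sin (psi z / Num.sqrt n%:R) - psi z / Num.sqrt n%:R)))); last exact/funext.
have -> : (0 : R) = \int[P0]_z 0 by rewrite Rint_cst.
apply: (dominated_cvgR (g := fun z => 2 * psi z ^+ 2)).
- by move=> n; apply: measurable_funM => //; exact: measurable_funB.
- by move=> z; exact: n_sinB_cvg.
- by apply: L1Z; case: psi2.
- move=> n z; rewrite normrM ger0_norm//.
  apply: (@le_trans _ _ (2 * (n%:R * (psi z / Num.sqrt n%:R) ^+ 2))).
    by rewrite mulrCA ler_wpM2l// abs_sinB_le_sqr.
  by rewrite ler_wpM2l.
Qed.

Variables (mu : {measure set Z -> \bar R}) (P : nat -> probability Z R)
  (f0 : Z -> R) (f : nat -> Z -> R) (s : Z -> R).
Hypotheses (dP0 : is_density mu P0 f0) (dP : forall n, is_density mu (P n) (f n))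
  (s2 : L2 P0 s).
Hypothesis qm : \int[mu]_z (qm_remainder f0 f s n z ^+ 2)
  @[n --> \oo] --> (0 : R).

Let local_sin_diff : n%:R * (\int[P n]_z sin (psi z / Num.sqrt n%:R)
    - \int[P0]_z sin (psi z / Num.sqrt n%:R))
  @[n --> \oo] --> \int[P0]_z (psi z * s z).
Proof.
apply: (@local_expansion _ _ _ mu P0 P f0 f s dP0 dP s2 qm
  (fun n z => sin (psi z / Num.sqrt n%:R)) 1 psi (fun z => `|psi z|)) => //.
- by move=> n z; exact: sin_max.
- exact: L2_norm.
- move=> n z; rewrite normrM ger0_norm//.
  by apply: le_trans (sqrtn_norm n (psi z)); rewrite ler_wpM2l// abs_sin_le.
- by move=> z; exact: sqrtn_sin_cvg.
Qed.

(** The drift arises here: under [P0] the limit is 0 because [psi] is centred, and the passage to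
    [P n] adds the covariance of [psi] with the score. *)
Lemma local_sin : n%:R * \int[P n]_z sin (psi z / Num.sqrt n%:R)
  @[n --> \oo] --> \int[P0]_z (psi z * s z).
Proof.
rewrite -[X in _ --> X]addr0 (_ : (fun n => _) = (fun n =>
    n%:R * (\int[P n]_z sin (psi z / Num.sqrt n%:R)
      - \int[P0]_z sin (psi z / Num.sqrt n%:R))
    + n%:R * \int[P0]_z sin (psi z / Num.sqrt n%:R))).
  exact: cvgD local_sin_diff base_sin.
by apply/funext => n; rewrite mulrBr subrK.
Qed.

(** The cosine leaves 1 only to second order, so the rescaled test functions tend to 0 and the
    change of law does not affect the variance term. *)
Lemma local_cos : n%:R * \int[P n]_z (cos (psi z / Num.sqrt n%:R) - 1)
  @[n --> \oo] --> - (\int[P0]_z (psi z ^+ 2) / 2).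
Proof.
have diff : n%:R * (\int[P n]_z (cos (psi z / Num.sqrt n%:R) - 1)
    - \int[P0]_z (cos (psi z / Num.sqrt n%:R) - 1))
    @[n --> \oo] --> \int[P0]_z (0 * s z).
  apply: (@local_expansion _ _ _ mu P0 P f0 f s dP0 dP s2 qm
    (fun n z => cos (psi z / Num.sqrt n%:R) - 1) 2 (fun=> 0)
    (fun z => 2 * `|psi z|)) => //.
  - move=> n z; rewrite (le_trans (ler_normB _ _))// normr1 mulr2n lerD2r.
    exact: cos_max.
  - by apply: L2Z; exact: L2_norm.
  - move=> n z; rewrite normrM ger0_norm//.
    apply: (@le_trans _ _ (2 * (Num.sqrt n%:R * `|psi z / Num.sqrt n%:R|))).
      by rewrite mulrCA ler_wpM2l// abs_cosB1_le_norm.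
    by rewrite ler_wpM2l.
  - by move=> z; exact: sqrtn_cosB1_cvg.
have z0 : \int[P0]_z (0 * s z) = 0.
  by under eq_Rintegral do rewrite mul0r; rewrite Rint_cst.
rewrite -[X in _ --> X]add0r -z0 (_ : (fun n => _) = (fun n =>
    n%:R * (\int[P n]_z (cos (psi z / Num.sqrt n%:R) - 1)
      - \int[P0]_z (cos (psi z / Num.sqrt n%:R) - 1))
    + n%:R * \int[P0]_z (cos (psi z / Num.sqrt n%:R) - 1))).
  exact: cvgD diff base_cos.
by apply/funext => n; rewrite mulrBr subrK.
Qed.

(** The conclusion of Le Cam's third lemma for normalized sums, reached without an expansion of the
    log-likelihood ratio. *)
Lemma local_clt b :
  \int[iid (P n) n]_u cos (b + \sum_(i < n) psi (tnth u i) / Num.sqrt n%:R)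
    @[n --> \oo] -->
  expR (- (\int[P0]_z (psi z ^+ 2) / 2)) * cos (b + \int[P0]_z (psi z * s z)).
Proof.
apply: (@iid_cos_cvg _ _ _ P (fun n z => psi z / Num.sqrt n%:R)) => //.
- by rewrite divr_ge0//; apply: Rint_ge0 => z; exact: sqr_ge0.
- exact: local_cos.
- exact: local_sin.
Qed.

(** If these integrals do not move along the path, there is no drift. Sines are bounded, so the
    hypothesis can be checked without any moment of [psi] under [P n]; it will be applied to
    functions of the first coordinate. *)
Lemma score_orthogonal :
  (forall n, \int[P n]_z sin (psi z / Num.sqrt n%:R) =
             \int[P0]_z sin (psi z / Num.sqrt n%:R)) ->
  \int[P0]_z (psi z * s z) = 0.
Proof.
move=> same; have := local_sin; under eq_cvg do rewrite same.
by move=> /cvg_lim <-//; exact: cvg_lim base_sin.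
Qed.

End base.
End local_clt.

(** * Stochastic orders *)

Section outer.
Context {d : measure_display} {T : measurableType d} {R : realType}.
Variable P : probability T R.

Lemma outer_probability_cover (A : set T) (e : R) : 0 < e ->
  exists2 B : set T, measurable B /\ A `<=` B &
    (P B <= outer_probability P A + e%:E)%E.
Proof.
move=> e0; rewrite /outer_probability.
have fin : mu_ext P A \is a fin_num.
  rewrite ge0_fin_numE ?mu_ext_ge0//.
  apply: (@le_lt_trans _ _ (mu_ext P setT)); first exact: le_mu_ext.
  by rewrite measurable_mu_extE// probability_fin.
have [_ [F [mF AF] <-] Fle] := lb_ereal_inf_adherent e0 fin.
exists (\bigcup_k F k); first by split=> //; exact: bigcup_measurable.
apply: le_trans (ltW Fle); apply: measure_sigma_subadditive => //.
exact: bigcup_measurable.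
Qed.

Lemma outer_probability_le (A B : set T) : measurable B -> A `<=` B ->
  (outer_probability P A <= P B)%E.
Proof. by move=> mB AB; rewrite -measurable_mu_extE//; exact: le_mu_ext. Qed.

Lemma outer_probability_ge0 (A : set T) : (0 <= outer_probability P A)%E.
Proof. exact: mu_ext_ge0. Qed.

Lemma fine_prob_le (A B : set T) : measurable A -> measurable B -> A `<=` B ->
  fine (P A) <= fine (P B).
Proof.
move=> mA mB AB; apply: fine_le; rewrite ?fin_num_measure//.
by apply: le_measure => //; rewrite inE.
Qed.

Lemma fine_prob_setU (A B : set T) : measurable A -> measurable B ->
  fine (P (A `|` B)) <= fine (P A) + fine (P B).
Proof.
move=> mA mB; rewrite -fineD ?fin_num_measure//; apply: fine_le.
- by rewrite fin_num_measure//; exact: measurableU.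
- by rewrite fin_numD !fin_num_measure.
- exact: measureU2.
Qed.

Lemma EFin_fine_prob (A : set T) : measurable A -> (fine (P A))%:E = P A.
Proof. by move=> mA; rewrite fineK// fin_num_measure. Qed.

End outer.

Section vanishing.
Context {d : measure_display} {Z : measurableType d} {R : realType}.
Implicit Types (Q : forall n, probability (n.-tuple Z) R).

(* Covers by measurable sets express that the outer probabilities tend to 0. *)
Definition vanishing Q (A : forall n, set (n.-tuple Z)) : Prop :=
  forall e : R, 0 < e -> \forall n \near \oo,
    exists2 B : set (n.-tuple Z), measurable B /\ A n `<=` B & fine (Q n B) <= e.

Lemma vanishingP Q A :
  vanishing Q A <-> outer_probability (Q n) (A n) @[n --> \oo] --> 0%E.
Proof.
split=> [van|cvg0 e e0].
  apply/fine_cvgP; split.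
    apply: nearW => n; rewrite ge0_fin_numE ?outer_probability_ge0//.
    apply: (le_lt_trans (outer_probability_le (Q n) measurableT _)) => //.
    exact: probability_fin.
  apply/cvgrPdist_le => e e0; near=> n.
  have [B [mB AB] Be] : exists2 B : set (n.-tuple Z),
    measurable B /\ A n `<=` B & fine (Q n B) <= e by near: n; exact: van.
  have ole := outer_probability_le (Q n) mB AB.
  have o0 := outer_probability_ge0 (Q n) (A n).
  rewrite /= sub0r normrN ger0_norm ?fine_ge0//; apply: le_trans Be.
  apply: fine_le => //; last by rewrite fin_num_measure.
  by rewrite ge0_fin_numE// (le_lt_trans ole)// -EFin_fine_prob// ltry.
have /fine_cvgP[fin /cvgrPdist_le /(_ (e / 2))] := cvg0.
have e2 : 0 < e / 2 by rewrite divr_gt0.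
move=> /(_ e2) near0; near=> n.
have finn : outer_probability (Q n) (A n) \is a fin_num by near: n.
have on : `|0 - fine (outer_probability (Q n) (A n))| <= e / 2 by near: n.
have [B [mB AB] Bo] := outer_probability_cover (Q n) (A n) e2.
exists B => //; rewrite -lee_fin EFin_fine_prob//; apply: (le_trans Bo).
rewrite -(fineK finn) -EFinD lee_fin [leRHS]splitr lerD2r.
by rewrite (le_trans _ on)// sub0r normrN ler_norm.
Unshelve. all: by end_near. Qed.

Lemma vanishing_sub Q A B : (forall n, A n `<=` B n) ->
  vanishing Q B -> vanishing Q A.
Proof.
move=> AB vB e /vB; apply: filterS => n [C [mC BC] Ce].
by exists C => //; split=> //; exact: subset_trans BC.
Qed.

Lemma vanishing_setU Q A B : vanishing Q A -> vanishing Q B ->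
  vanishing Q (fun n => A n `|` B n).
Proof.
move=> vA vB e e0; have e2 : 0 < e / 2 by rewrite divr_gt0.
apply: filterS2 (vA _ e2) (vB _ e2) => n [C [mC AC] Ce] [D [mD BD] De].
exists (C `|` D); first by split; [exact: measurableU|exact: setUSS].
by rewrite (le_trans (fine_prob_setU _ mC mD))// (splitr e) lerD.
Qed.

(* [o_p(1)] and [O_p(1)] under the laws [Q n]. *)
Definition opn Q (W : forall n, n.-tuple Z -> R) : Prop :=
  forall e : R, 0 < e -> vanishing Q (fun n => [set z | e < `|W n z|]).

Definition Opn Q (W : forall n, n.-tuple Z -> R) : Prop :=
  forall e : R, 0 < e -> exists K : R, \forall n \near \oo,
    exists2 B : set (n.-tuple Z),
      measurable B /\ [set z | K < `|W n z|] `<=` B & fine (Q n B) <= e.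

Lemma o_p1P (P : probability Z R) W : o_p1 P W <-> opn (fun n => iid P n) W.
Proof. by split=> oW e /oW /vanishingP. Qed.

Lemma opn_le Q V W : (forall n z, `|V n z| <= `|W n z|) -> opn Q W -> opn Q V.
Proof.
move=> VW oW e e0; apply: vanishing_sub (oW e e0) => n z /= h.
exact: lt_le_trans (VW n z).
Qed.

(** The comparison may fail on a vanishing event; this absorbs the event that the nuisance estimator
    leaves [O]. *)
Lemma opn_ext Q V W A : vanishing Q A ->
  (forall n z, ~ A n z -> `|V n z| <= `|W n z|) -> opn Q W -> opn Q V.
Proof.
move=> vA VW oW e e0; apply: vanishing_sub (vanishing_setU vA (oW e e0)) => n z /= h.
have [Az|nAz] := pselect (A n z); [by left|right].
exact: lt_le_trans (VW n z nAz).
Qed.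

Lemma opnD Q V W : opn Q V -> opn Q W -> opn Q (fun n z => V n z + W n z).
Proof.
move=> oV oW e e0; have e2 : 0 < e / 2 by rewrite divr_gt0.
apply: vanishing_sub (vanishing_setU (oV _ e2) (oW _ e2)) => n z /= h.
have [h1|h1] := ltP (e / 2) `|V n z|; [by left|right].
rewrite ltNge; apply/negP => h2; move: h; rewrite ltNge => /negP; apply.
by rewrite (le_trans (ler_normD _ _))// (splitr e) lerD.
Qed.

Lemma opnN Q V : opn Q V -> opn Q (fun n z => - V n z).
Proof. by apply: opn_le => n z; rewrite normrN. Qed.

Lemma opn0 Q : opn Q (fun _ _ => 0).
Proof.
move=> e e0 e' e'0; apply: nearW => n; exists set0.
  by split=> // z /=; rewrite normr0 ltNge (ltW e0).
by rewrite measure0 ltW.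
Qed.

Lemma opn_sum Q (I : Type) (r : seq I) (W : I -> forall n, n.-tuple Z -> R) :
  (forall i, opn Q (W i)) -> opn Q (fun n z => \sum_(i <- r) W i n z).
Proof.
move=> oW; elim: r => [|i r IH].
  by apply: opn_le (opn0 Q) => n z; rewrite big_nil.
by apply: opn_le (opnD (oW i) IH) => n z; rewrite big_cons.
Qed.

Lemma opnM_Opn Q V W : opn Q V -> Opn Q W -> opn Q (fun n z => V n z * W n z).
Proof.
move=> oV OW e e0 e' e'0; have e2 : 0 < e' / 2 by rewrite divr_gt0.
have [K OK] := OW _ e2.
(* The maximum with 1 makes the divisor positive. *)
pose K' := Num.max K 1; have K'0 : 0 < K' by rewrite lt_max ltr01 orbT.
have eK : 0 < e / K' by rewrite divr_gt0.
apply: filterS2 OK (oV _ eK _ e2) => n [B [mB KB] Be] [C [mC VC] Ce].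
exists (B `|` C); last first.
  by rewrite (le_trans (fine_prob_setU _ mB mC))// (splitr e') lerD.
split; first exact: measurableU.
move=> z /= h; have [h1|h1] := ltP K `|W n z|; [by left; exact: KB|right].
apply: VC => /=; rewrite ltr_pdivrMr//; apply: (lt_le_trans h).
by rewrite normrM ler_wpM2l// (le_trans h1)// le_max lexx.
Qed.

Lemma OpnD Q V W : Opn Q V -> Opn Q W -> Opn Q (fun n z => V n z + W n z).
Proof.
move=> OV OW e e0; have e2 : 0 < e / 2 by rewrite divr_gt0.
have [K1 OK1] := OV _ e2; have [K2 OK2] := OW _ e2; exists (K1 + K2).
apply: filterS2 OK1 OK2 => n [B [mB VB] Be] [C [mC WC] Ce].
exists (B `|` C); last first.
  by rewrite (le_trans (fine_prob_setU _ mB mC))// (splitr e) lerD.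
split; first exact: measurableU.
move=> z /= h; have [h1|h1] := ltP K1 `|V n z|; [by left; exact: VB|right].
apply: WC => /=; rewrite -(ltrD2l K1) (lt_le_trans h)//.
by rewrite (le_trans (ler_normD _ _))// lerD2r.
Qed.

Lemma Opn_le Q V W : (forall n z, `|V n z| <= `|W n z|) -> Opn Q W -> Opn Q V.
Proof.
move=> VW OW e /OW[K OK]; exists K; apply: filterS OK => n [B [mB WB] Be].
exists B => //; split=> // z /= h; apply: WB => /=.
exact: lt_le_trans (VW n z).
Qed.

Lemma Opn_opnD_cst Q V (c : R) : opn Q (fun n z => V n z - c) -> Opn Q V.
Proof.
move=> oV e e0; exists (`|c| + 1).
apply: filterS (oV 1 ltr01 e e0) => n [B [mB VB] Be].
exists B => //; split=> // z /= h; apply: VB => /=.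
rewrite -(ltrD2l `|c|) (lt_le_trans h)// -{1}(subrK c (V n z)) addrC.
exact: ler_normD.
Qed.

Lemma Opn_cst Q (c : R) : Opn Q (fun _ _ => c).
Proof. by apply: (@Opn_opnD_cst _ _ c); apply: opn_le (opn0 Q) => n z; rewrite subrr. Qed.

Lemma Opn_sum Q (I : Type) (r : seq I) (W : I -> forall n, n.-tuple Z -> R) :
  (forall i, Opn Q (W i)) -> Opn Q (fun n z => \sum_(i <- r) W i n z).
Proof.
move=> oW; elim: r => [|i r IH].
  by apply: Opn_le (Opn_cst Q 0) => n z; rewrite big_nil.
by apply: Opn_le (OpnD (oW i) IH) => n z; rewrite big_cons.
Qed.

Lemma opnZ Q V (c : R) : opn Q V -> opn Q (fun n z => V n z * c).
Proof. by move=> oV; apply: opnM_Opn oV (Opn_cst _ c). Qed.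

End vanishing.

Section laws_of_large_numbers.
Context {d : measure_display} {Z : measurableType d} {R : realType}.
Variable P : probability Z R.

Lemma measurable_ge_set d' (T : measurableType d') (f : T -> R) (c : R) :
  measurable_fun [set: T] f -> measurable [set x | c <= f x].
Proof.
by move=> mf; rewrite -[X in measurable X]setTI; exact: measurable_fun_le.
Qed.

Lemma chebyshev_iid_sum n (psi : Z -> R) (c : R) :
  0 < c -> L2 P psi -> \int[P]_z psi z = 0 ->
  fine (iid P n [set u | c ^+ 2 <= (\sum_(i < n) psi (tnth u i)) ^+ 2]) <=
  n%:R * \int[P]_z (psi z ^+ 2) / c ^+ 2.
Proof.
move=> c0 psi2 psi0; rewrite -Rint_iid_sum_sqr//.
apply: markovR; rewrite ?exprn_gt0//; first by case: (L2_iid_sum n psi2).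
by move=> u; exact: sqr_ge0.
Qed.

Lemma Opn_clt_sum (psi : Z -> R) : L2 P psi -> \int[P]_z psi z = 0 ->
  Opn (fun n => iid P n) (fun n u => \sum_(i < n) psi (tnth u i) / Num.sqrt n%:R).
Proof.
move=> psi2 psi0 e e0; set V := \int[P]_z (psi z ^+ 2).
have V0 : 0 <= V by apply: Rint_ge0 => z; exact: sqr_ge0.
(* Chebyshev gives the bound V / K^2 <= e; the added 1 keeps [K] positive when V = 0. *)
pose K := Num.sqrt (V / e + 1).
have K2 : K ^+ 2 = V / e + 1 by rewrite sqr_sqrtr// addr_ge0// divr_ge0// ltW.
have K0 : 0 < K by rewrite sqrtr_gt0 ltr_wpDl// divr_ge0// ltW.
have mpsi : measurable_fun setT psi by case: psi2.
exists K; near=> n.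
have n0 : (0 : R) < n%:R by rewrite ltr0n; near: n; exists 1%N.
have r0 : (0 : R) < Num.sqrt n%:R by rewrite sqrtr_gt0.
have c0 : 0 < K * Num.sqrt n%:R by rewrite mulr_gt0.
exists [set u | (K * Num.sqrt n%:R) ^+ 2 <= (\sum_(i < n) psi (tnth u i)) ^+ 2].
  split.
    by apply: measurable_ge_set; apply: measurable_funX; exact: measurable_iid_sum.
  move=> u /=; rewrite -mulr_suml normrM normfV (gtr0_norm r0) ltr_pdivlMr//.
  move=> /ltW h; rewrite -[leRHS]real_normK ?num_real// lerXn2r ?nnegrE//.
  exact: ltW.
rewrite (le_trans (chebyshev_iid_sum n c0 psi2 psi0))//.
rewrite ler_pdivrMr ?exprn_gt0// exprMn (@sqr_sqrtr _ n%:R) ?ler0n// K2 -/V.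
rewrite mulrC [leRHS]mulrA ler_wpM2r ?ler0n//.
by rewrite mulrDr mulrCA divff ?gt_eqF// mulr1 mulr1 lerDl ltW.
Unshelve. all: by end_near. Qed.

(** The products to which this is applied have only a first moment. After truncation, Markov's
    inequality handles the tails and Chebyshev's the bounded part. *)
Lemma weak_lln (f : Z -> R) : L1 P f ->
  opn (fun n => iid P n)
    (fun n u => n%:R^-1 * \sum_(i < n) f (tnth u i) - \int[P]_z f z).
Proof.
move=> Lf e e0 e' e'0; have mf := L1_measurable Lf.
pose tr (M : nat) z : R := f z * \1_[set z | `|f z| <= M%:R] z.
have mtr M : measurable_fun setT (tr M).
  apply: measurable_funM => //; apply: measurable_indic.
  rewrite -[X in measurable X]setTI; apply: measurable_fun_le => //.
  exact: measurableT_comp.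
have tr_le M z : `|tr M z| <= M%:R.
  rewrite /tr indicE; case: (boolP (z \in _)) => [/set_mem /= h|_].
    by rewrite mulr1.
  by rewrite mulr0 normr0.
have trf M z : `|f z - tr M z| <= `|f z|.
  rewrite /tr indicE; case: (z \in _); last by rewrite mulr0 subr0.
  by rewrite mulr1 subrr normr0.
have Ltr M : L1 P (tr M) by exact: L1_bounded_prob (mtr M) (tr_le M).
have Ldiff M : L1 P (fun z => `|f z - tr M z|) by apply: L1_norm; exact: L1B.
have trcvg : \int[P]_z `|f z - tr M z| @[M --> \oo] --> (0 : R).
  have -> : (0 : R) = \int[P]_z 0 by rewrite Rint_cst.
  apply: (dominated_cvgR (g := fun z => `|f z|)).
  - by move=> M; exact: L1_measurable (Ldiff M).
  - move=> z; apply: cvg_near_cst; near=> M; rewrite /tr indicE mem_set/=.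
      by rewrite mulr1 subrr normr0.
    by near: M; exact: nbhs_infty_ger.
  - exact: L1_norm.
  - by move=> M z; rewrite normr_id.
(* The tail mean must bound the bias of the truncated mean by e / 3 and, divided by Markov's
   threshold e / 3, be at most e' / 2. *)
have d0 : 0 < Num.min (e / 3) (e * e' / 6).
  by rewrite lt_min !divr_gt0// mulr_gt0.
have /cvgrPdist_le /(_ _ d0) [M _ /(_ M (leqnn M)) /=] := trcvg.
rewrite sub0r normrN ger0_norm; last by apply: Rint_ge0.
rewrite le_min => /andP[hM1 hM2].
pose c := \int[P]_z tr M z; pose psi z := tr M z - c.
have c_le : `|c| <= M%:R by exact: Rint_bounded (mtr M) (tr_le M).
have psi2 : L2 P psi.
  apply: L2B; last exact: L2_cst probability_fin.
  split=> //; apply: (L1_bounded_prob (C := M%:R ^+ 2)).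
    exact: measurable_funX.
  by move=> z; rewrite normrX lerXn2r ?nnegrE.
have psi0 : \int[P]_z psi z = 0 by rewrite RintB ?Rint_cst ?subrr//; exact: L1_cst.
have cf : `|c - \int[P]_z f z| <= e / 3.
  rewrite distrC -RintB//; apply: le_trans hM1.
  by apply: Rint_norm; exact: L1B.
pose V := \int[P]_z (psi z ^+ 2).
have Vn : (V / (e / 3) ^+ 2) / n%:R @[n --> \oo] --> (0 : R) by exact: cvg_divn.
have e'2 : 0 < e' / 2 by rewrite divr_gt0.
have /cvgrPdist_le /(_ _ e'2) Vn2 := Vn.
near=> n.
have n0 : (0 : R) < n%:R by rewrite ltr0n; near: n; exists 1%N.
have Vne : `|0 - (V / (e / 3) ^+ 2) / n%:R| <= e' / 2 by near: n.
pose B1 := [set u : n.-tuple Z |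
  n%:R * (e / 3) <= \sum_(i < n) `|f (tnth u i) - tr M (tnth u i)|].
pose B2 := [set u : n.-tuple Z |
  (n%:R * (e / 3)) ^+ 2 <= (\sum_(i < n) psi (tnth u i)) ^+ 2].
have mB1 : measurable B1.
  apply: measurable_ge_set.
  exact: (measurable_iid_sum (f := fun z => `|f z - tr M z|) (L1_measurable (Ldiff M))).
have mB2 : measurable B2.
  apply: measurable_ge_set; apply: measurable_funX; apply: measurable_iid_sum.
  by case: psi2.
have ne0 : 0 < n%:R * (e / 3) by rewrite mulr_gt0// divr_gt0.
have P1 : fine (iid P n B1) <= e' / 2.
  have := @markovR _ _ _ (iid P n) (fun u => \sum_(i < n) `|f (tnth u i) - tr M (tnth u i)|)
    _ ne0 (L1_iid_sum n (Ldiff M)) (fun u => sumr_ge0 _ (fun i _ => normr_ge0 _)).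
  rewrite (Rint_iid_sum n (Ldiff M)) => /le_trans; apply.
  rewrite ler_pdivrMr// mulrCA ler_wpM2l ?ler0n//; apply: (le_trans hM2).
  by rewrite le_eqVlt; apply/orP; left; apply/eqP; field.
have P2 : fine (iid P n B2) <= e' / 2.
  apply: (le_trans (chebyshev_iid_sum n ne0 psi2 psi0)); rewrite -/V.
  apply: le_trans Vne; rewrite sub0r normrN; apply: le_trans (ler_norm _).
  by rewrite le_eqVlt; apply/orP; left; apply/eqP; field; rewrite !gt_eqF.
exists (B1 `|` B2); last first.
  by rewrite (le_trans (fine_prob_setU _ mB1 mB2))// (splitr e') lerD.
split; first exact: measurableU.
move=> u /= hu.
have [h1|h1] := leP (n%:R * (e / 3)) (\sum_(i < n) `|f (tnth u i) - tr M (tnth u i)|).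
  by left.
right; rewrite /B2 /= -[leRHS]real_normK ?num_real// lerXn2r ?nnegrE ?(ltW ne0)//.
rewrite leNgt; apply/negP => h2; move: hu; rewrite ltNge => /negP; apply.
have -> : n%:R^-1 * \sum_(i < n) f (tnth u i) - \int[P]_z f z =
   n%:R^-1 * \sum_(i < n) (f (tnth u i) - tr M (tnth u i))
   + n%:R^-1 * \sum_(i < n) psi (tnth u i) + (c - \int[P]_z f z).
  rewrite !sumrB sumr_const card_ord -[c *+ n]mulr_natl.
  by field; rewrite gt_eqF.
have n1 (y : R) : `|y| <= n%:R * (e / 3) -> `|n%:R^-1 * y| <= e / 3.
  by move=> h; rewrite normrM normfV (gtr0_norm n0) mulrC ler_pdivrMr// mulrC.
have -> : e = e / 3 + e / 3 + e / 3 by field.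
rewrite (le_trans (ler_normD _ _))// lerD// (le_trans (ler_normD _ _))// lerD//.
  by apply: n1; rewrite (le_trans (ler_norm_sum _ _ _))// ltW.
by apply: n1; exact: ltW.
Unshelve. all: by end_near. Qed.

End laws_of_large_numbers.

(** * Convergence in distribution from trigonometric moments *)

Section trigonometric_polynomials.
Context {R : realType} {p : nat}.
Implicit Types (x y a : 'cV[R]_p).

Definition dot a x : R := \sum_i a i ord0 * x i ord0.

(** The real span of cosines. The free phase supplies sines and constants, and the product-to-sum
    formula makes the span an algebra, as Bernstein polynomials in sines require. *)
Inductive trigpoly : ('cV[R]_p -> R) -> Prop :=
| trigpoly_cos (b : R) a : trigpoly (fun x => cos (b + dot a x))
| trigpoly_add f g : trigpoly f -> trigpoly g -> trigpoly (fun x => f x + g x)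
| trigpoly_scale (c : R) f : trigpoly f -> trigpoly (fun x => c * f x).

Lemma dotD a b x : dot (a + b) x = dot a x + dot b x.
Proof. by rewrite -big_split; apply: eq_bigr => i _; rewrite mxE mulrDl. Qed.

Lemma dotBl a b x : dot (a - b) x = dot a x - dot b x.
Proof. by rewrite -sumrB; apply: eq_bigr => i _; rewrite !mxE mulrBl. Qed.

Lemma dotBr a x y : dot a (x - y) = dot a x - dot a y.
Proof. by rewrite -sumrB; apply: eq_bigr => i _; rewrite !mxE mulrBr. Qed.

Lemma dotE a x : (a^T *m x) ord0 ord0 = dot a x.
Proof. by rewrite mxE; apply: eq_bigr => i _; rewrite !mxE. Qed.

Lemma dot_delta (i : 'I_p) (c : R) x : dot (c *: delta_mx i ord0) x = c * x i ord0.
Proof.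
rewrite /dot (bigD1 i)//= big1 ?addr0 => [|j ji].
  by rewrite !mxE !eqxx mulr1.
by rewrite !mxE (negbTE ji) mulr0 mul0r.
Qed.

Lemma trigpoly_cst (c : R) : trigpoly (fun=> c).
Proof.
rewrite (_ : (fun=> c) = (fun x => c * cos (0 + dot 0 x))).
  by apply: trigpoly_scale; exact: trigpoly_cos.
apply/funext => x; rewrite /dot big1 ?addr0 ?cos0 ?mulr1// => i _.
by rewrite mxE mul0r.
Qed.

Lemma trigpoly_mul f g : trigpoly f -> trigpoly g -> trigpoly (fun x => f x * g x).
Proof.
elim=> {f} [b a|f1 f2 tf1 IH1 tf2 IH2|c f tf IH] tg.
- elim: tg => {g} [b' a'|g1 g2 tg1 IH1 tg2 IH2|c g tg IH].
  + rewrite (_ : (fun _ => _) = (fun x => 2^-1 *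
        (cos ((b + b') + dot (a + a') x) + cos ((b - b') + dot (a - a') x)))).
      by apply: trigpoly_scale; apply: trigpoly_add; exact: trigpoly_cos.
    apply/funext => x; rewrite dotD dotBl.
    rewrite (_ : b + b' + _ = (b + dot a x) + (b' + dot a' x)); last by ring.
    rewrite (_ : b - b' + _ = (b + dot a x) - (b' + dot a' x)); last by ring.
    by rewrite (cosD (b + dot a x)) cosB; field.
  + rewrite (_ : (fun _ => _) = (fun x => cos (b + dot a x) * g1 x
        + cos (b + dot a x) * g2 x)); first exact: trigpoly_add.
    by apply/funext => x; rewrite mulrDr.
  + rewrite (_ : (fun _ => _) = (fun x => c * (cos (b + dot a x) * g x))).
      exact: trigpoly_scale.
    by apply/funext => x; rewrite mulrCA.
- rewrite (_ : (fun _ => _) = (fun x => f1 x * g x + f2 x * g x)).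
    by apply: trigpoly_add; [exact: IH1|exact: IH2].
  by apply/funext => x; rewrite mulrDl.
- rewrite (_ : (fun _ => _) = (fun x => c * (f x * g x))).
    by apply: trigpoly_scale; exact: IH.
  by apply/funext => x; rewrite mulrA.
Qed.

Lemma trigpoly_sin (i : 'I_p) (c : R) : trigpoly (fun x => sin (c * x i ord0)).
Proof.
rewrite (_ : (fun _ => _) = (fun x => cos (- (pi / 2) + dot (c *: delta_mx i ord0) x))).
  exact: trigpoly_cos.
by apply/funext => x; rewrite dot_delta addrC -cosBpihalf.
Qed.

Lemma trigpoly_bounded f : trigpoly f -> exists C, forall x, `|f x| <= C.
Proof.
elim=> {f} [b a|f g _ [C1 h1] _ [C2 h2]|c f _ [C h]].
- by exists 1 => x; exact: cos_max.
- by exists (C1 + C2) => x; rewrite (le_trans (ler_normD _ _))// lerD.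
- by exists (`|c| * C) => x; rewrite normrM ler_wpM2l.
Qed.

Lemma abs_cosB_le (u v : R) : `|cos u - cos v| <= `|u - v|.
Proof.
suff H (s t : R) : `|cos (s + t) - cos (t - s)| <= `|s + t - (t - s)|.
  have := H ((u - v) / 2) ((u + v) / 2).
  rewrite (_ : (u - v) / 2 + (u + v) / 2 = u); last by field.
  by rewrite (_ : (u + v) / 2 - (u - v) / 2 = v); last by field.
have -> : cos (s + t) - cos (t - s) = - (2 * sin s * sin t).
  by rewrite cosD cosB; ring.
have -> : s + t - (t - s) = 2 * s by ring.
rewrite normrN !normrM (ger0_norm (_ : 0 <= 2))// -mulrA ler_wpM2l//.
by rewrite -[leRHS]mulr1 ler_pM ?abs_sin_le ?sin_max.
Qed.

Lemma trigpoly_lipschitz f : trigpoly f -> exists2 K, 0 <= K &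
  forall x y, `|f x - f y| <= K * \sum_i `|x i ord0 - y i ord0|.
Proof.
have sum0 x y : 0 <= \sum_i `|x i ord0 - y i ord0| :> R by exact: sumr_ge0.
elim=> {f} [b a|f g _ [K1 K10 h1] _ [K2 K20 h2]|c f _ [K K0 h]].
- exists (\sum_i `|a i ord0|); first exact: sumr_ge0.
  move=> x y; apply: (le_trans (abs_cosB_le _ _)).
  rewrite opprD addrACA subrr add0r -dotBr.
  apply: (le_trans (ler_norm_sum _ _ _)); rewrite mulr_suml.
  apply: ler_sum => i _; rewrite normrM !mxE ler_wpM2l//.
  by rewrite (bigD1 i)//= lerDl sumr_ge0.
- exists (K1 + K2) => [|x y]; first exact: addr_ge0.
  by rewrite opprD addrACA mulrDl (le_trans (ler_normD _ _))// lerD.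
- exists (`|c| * K) => [|x y]; first exact: mulr_ge0.
  by rewrite -mulrBr normrM -mulrA ler_wpM2l.
Qed.

Lemma trigpoly_measurable d (T : measurableType d) f (S : T -> 'cV[R]_p) :
  (forall i, measurable_fun [set: T] (fun z => S z i ord0)) ->
  trigpoly f -> measurable_fun [set: T] (fun z => f (S z)).
Proof.
move=> mS; elim=> {f} [b a|f g _ h1 _ h2|c f _ h].
- apply: measurable_cosD; apply: measurable_sum => i.
  exact: measurable_funM.
- exact: measurable_funD.
- exact: measurable_funM.
Qed.

Section random_walk.
Variable t : 'I_p -> R.

Definition walk_step (k : {ffun 'I_p -> nat}) (j : 'I_p) : {ffun 'I_p -> nat} :=
  [ffun i => (k i + (i == j))%N].

(* Expectation of G at the end of a walk that increments, in turn, each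
   coordinate j listed in [l] with probability [t j]; with N copies of each
   coordinate this is a product Bernstein operator of degree N. *)
Fixpoint walk (l : seq 'I_p) (G : {ffun 'I_p -> nat} -> R) k : R :=
  if l is j :: l' then (1 - t j) * walk l' G k + t j * walk l' G (walk_step k j)
  else G k.

Lemma walkD l G1 G2 k :
  walk l (fun k => G1 k + G2 k) k = walk l G1 k + walk l G2 k.
Proof. by elim: l k => //= j l IH k; rewrite !IH; ring. Qed.

Lemma walkZ l c G k : walk l (fun k => c * G k) k = c * walk l G k.
Proof. by elim: l k => //= j l IH k; rewrite !IH; ring. Qed.

Lemma walk_cst l c k : walk l (fun=> c) k = c.
Proof. by elim: l k => //= j l IH k; rewrite !IH; ring. Qed.

Lemma walk_sum l (I : Type) (r : seq I) (G : I -> {ffun 'I_p -> nat} -> R) k :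
  walk l (fun k => \sum_(i <- r) G i k) k = \sum_(i <- r) walk l (G i) k.
Proof.
elim: r => [|i r IH].
  rewrite big_nil -[RHS](walk_cst l 0 k); congr walk.
  by apply/funext => k'; rewrite big_nil.
rewrite big_cons -IH -walkD; congr walk.
by apply/funext => k'; rewrite big_cons.
Qed.

(** Mean and variance of a binomial count in a single formula; it is the moment computation behind
    the Chebyshev estimate for Bernstein polynomials. *)
Lemma walk_var l (j : 'I_p) (c : R) k :
  walk l (fun k => ((k j)%:R - c) ^+ 2) k =
  ((k j)%:R + (count_mem j l)%:R * t j - c) ^+ 2
    + (count_mem j l)%:R * (t j * (1 - t j)).
Proof.
elim: l k => [|i l IH] k /=; first by rewrite mul0r addr0 mul0r addr0.
rewrite !IH /walk_step ffunE eq_sym natrD natrD.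
by case: eqVneq => [->|_] /=; ring.
Qed.

Hypothesis t01 : forall j, 0 <= t j <= 1.

Lemma walk_le l G1 G2 k : (forall k, G1 k <= G2 k) -> walk l G1 k <= walk l G2 k.
Proof.
move=> h; elim: l k => //= j l IH k; have /andP[t0 t1] := t01 j.
by rewrite lerD// ler_wpM2l// subr_ge0.
Qed.

Lemma walk_norm_le l G (C : R) k : (forall k, `|G k| <= C) -> `|walk l G k| <= C.
Proof.
move=> h; rewrite ler_norml -{1}(walk_cst l (- C) k) -{2}(walk_cst l C k).
by apply/andP; split; apply: walk_le => k'; have := h k'; rewrite ler_norml => /andP[].
Qed.

End random_walk.

Lemma trigpoly_walk (t : 'I_p -> 'cV[R]_p -> R) l G k :
  (forall j, trigpoly (t j)) -> trigpoly (fun y => walk (fun j => t j y) l G k).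
Proof.
move=> tt; elim: l k => [|j l IH] k /=; first exact: trigpoly_cst.
apply: trigpoly_add; apply: trigpoly_mul => //.
apply: trigpoly_add; first exact: trigpoly_cst.
rewrite (_ : (fun _ => _) = (fun y => -1 * t j y)); first exact: trigpoly_scale.
by apply/funext => y; rewrite mulN1r.
Qed.

End trigonometric_polynomials.

Section approximation.
Context {R : realType} {p : nat}.
Implicit Types (x y : 'cV[R]_p).

Lemma continuous_trmx : continuous (fun x : 'rV[R]_p => x^T : 'cV[R]_p).
Proof.
move=> x U [V nV VU]; exists (fun i j => V j i) => [i j|y yV].
  by have := nV j i; rewrite mxE.
by apply: VU => i j; rewrite mxE; exact: yV.
Qed.

Lemma coord_ball x y (e : R) : 0 < e ->
  (forall i, `|x i ord0 - y i ord0| < e) -> ball x e y.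
Proof. by move=> e0 h; split=> // i j; rewrite (ord1 j); exact: h. Qed.

(** Only [x] is confined to the box while [y] is free, which the near-covering form of compactness
    provides directly. *)
Lemma box_unif_continuous (f : 'cV[R]_p -> R) (K e : R) :
  continuous f -> 0 < e -> exists2 del : R, 0 < del &
    forall x y, (forall i, `|x i ord0| <= K) ->
      (forall i, `|x i ord0 - y i ord0| < del) -> `|f x - f y| <= e.
Proof.
move=> cf e0.
pose box := [set v : 'rV[R]_p | forall i, `[- K, K]%classic (v ord0 i)].
have cbox : compact box.
  by apply: (@rV_compact _ _ (fun=> `[- K, K]%classic)) => _; exact: segment_compact.
have cboxT : compact ((fun v : 'rV[R]_p => v^T : 'cV[R]_p) @` box).
  apply: continuous_compact cbox; apply: continuous_subspaceT.
  exact: continuous_trmx.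
move/compact_near_coveringP : cboxT => /(_ R (0^'+)
  (fun del x => forall y, ball x del y -> `|f x - f y| <= e) _).
case.
  move=> x _; have e2 : 0 < e / 2 by rewrite divr_gt0.
  have /cvgrPdist_lt /(_ _ e2) := cf x.
  move=> /nbhs_ballP [r r0 hr]; have r2 : 0 < r / 2 by rewrite divr_gt0.
  have r21 : r / 2 <= r by move: r0; rewrite /=; lra.
  exists (ball x (r / 2), [set del : R | del < r / 2]).
    by split; [exact: nbhsx_ballx|exact: nbhs_right_lt].
  move=> [x' del] /= [xx' dr] y x'y.
  have h1 : `|f x - f x'| < e / 2.
    by apply: hr; apply: le_ball xx'.
  have h2 : `|f x - f y| < e / 2.
    apply: hr => /=; rewrite (splitr r); apply: ball_triangle xx' _.
    by apply: le_ball x'y; exact: ltW.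
  rewrite (splitr e) -(subrKA (f x)) (le_trans (ler_normD _ _))// distrC.
  by rewrite lerD// ltW.
move=> del /= del0 hdel.
exists (del / 2); first by rewrite divr_gt0.
move=> x y xK xy; apply: (hdel (del / 2)).
- by rewrite /= sub0r normrN ger0_norm ?divr_ge0 ?ltW// ltr_pdivrMr// ltr_pMr// ltr1n.
- by rewrite divr_gt0.
- exists x^T; last by rewrite trmxK.
  by move=> i; rewrite /= mxE in_itv/= -ler_norml.
- by apply: coord_ball => //; rewrite divr_gt0.
Qed.

End approximation.

Section local_arcsin.
Context {R : realType}.

Let cos_ge_half (c : R) : -1 <= c <= 1 -> 1 / 2 <= cos c.
Proof.
move=> c1; have := abs_cosB1_le c; rewrite ler_norml => /andP[h _].
have : c ^+ 2 <= 1.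
  by rewrite -real_normK ?num_real// expr_le1// ler_norml.
by lra.
Qed.

Let sin_expand (a b : R) : -1 <= a <= 1 -> -1 <= b <= 1 ->
  `|a - b| <= 2 * `|sin a - sin b|.
Proof.
wlog ab : a b / a < b.
  move=> H ha hb; have [ab|ba|->] := ltgtP a b; first exact: H.
    by rewrite distrC [X in 2 * X]distrC; exact: H.
  by rewrite subrr normr0 mulr_ge0.
move=> /andP[a1 a2] /andP[b1 b2].
have cf : {within `[a, b], continuous (@sin R)}.
  by apply: continuous_subspaceT; exact: continuous_sin.
have [c /[!in_itv]/= /andP[c1 c2] E] := MVT ab (fun x _ => is_derive_sin x) cf.
rewrite distrC [X in 2 * X]distrC E normrM.
have hc : 1 / 2 <= cos c by apply: cos_ge_half; lra.
have c0 : 0 <= cos c by apply: le_trans hc.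
rewrite (ger0_norm c0) mulrA ler_peMl//; lra.
Qed.

(** On [-1, 1] the derivative of sine is at least 1 / 2, which makes its inverse Lipschitz with
    constant 2; clipping the argument to [- sin 1, sin 1] extends the inverse to the whole line. *)
Lemma clipped_arcsin : exists2 A : R -> R,
  (forall u, -1 <= u <= 1 -> A (sin u) = u) &
  forall u v, `|A u - A v| <= 2 * `|u - v|.
Proof.
pose clip (u : R) := Num.max (- sin 1) (Num.min (sin 1) u).
have s1 : 0 <= sin 1 :> R.
  by rewrite sin_ge0_pi//; have := pi_ge2 R; lra.
have clip_itv u : - sin 1 <= clip u <= sin 1.
  by rewrite /clip le_max lexx/= ge_max ge_min lexx/= andbT; lra.
have clip_lip u v : `|clip u - clip v| <= `|u - v|.
  rewrite /clip /Num.max /Num.min.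
  by do !case: ifPn; rewrite -?leNgt => *; rewrite ler_norml;
    case: (ler0P (u - v)); lra.
have ex u : exists x, -1 <= x <= 1 /\ sin x = clip u.
  have le11 : -1 <= 1 :> R by lra.
  have cf : {within `[-1, 1], continuous (@sin R)}.
    by apply: continuous_subspaceT; exact: continuous_sin.
  have [|x x1 xE] := @IVT R sin (-1) 1 (clip u) le11 cf.
    rewrite sinN; have /andP[h1 h2] := clip_itv u.
    by apply/andP; split; [rewrite ge_min h1|rewrite le_max h2 orbT].
  by exists x.
have [A AP] := choice ex; exists A => [u u1|u v].
  have [Au sAu] := AP (sin u).
  have cu : clip (sin u) = sin u.
    have mono (a b : R) : -1 <= a <= 1 -> -1 <= b <= 1 -> a <= b -> sin a <= sin b.
      move=> ha hb; rewrite le_eqVlt => /predU1P[->//|ab].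
      have cf : {within `[a, b], continuous (@sin R)}.
        by apply: continuous_subspaceT; exact: continuous_sin.
      have [c /[!in_itv]/= /andP[c1 c2] E] := MVT ab (fun x _ => is_derive_sin x) cf.
      rewrite -subr_ge0 E; apply: mulr_ge0; last by rewrite subr_ge0 ltW.
      have hc : 1 / 2 <= cos c by apply: cos_ge_half; lra.
      by lra.
    have h1 : sin u <= sin 1 by apply: mono => //; lra.
    have h2 : - sin 1 <= sin u by rewrite -sinN; apply: mono => //; lra.
    by rewrite /clip (min_idPr h1) (max_idPr h2).
  apply/eqP; rewrite -subr_eq0 -normr_le0.
  by apply: le_trans (sin_expand Au u1) _; rewrite sAu cu subrr normr0 mulr0.
have [Au sAu] := AP u; have [Av sAv] := AP v.
by apply: le_trans (sin_expand Au Av) _; rewrite sAu sAv ler_wpM2l.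
Qed.

End local_arcsin.

Section approximation_theorem.
Context {R : realType} {p : nat}.

(** The Bernstein operator is applied to t -> f (K A (2 t - 1)) on the unit cube and evaluated at
    t_j = (1 + sin (y_j / K)) / 2. On the box [A] undoes the sine; off the box the value is still an
    average of values of [f], whence the global bound [C]. *)
Lemma trigpoly_approx (f : 'cV[R]_p -> R) (C K e : R) :
  continuous f -> (forall x, `|f x| <= C) -> 0 < K -> 0 < e ->
  exists q : 'cV[R]_p -> R, [/\ trigpoly q, forall x, `|q x| <= C &
    forall x : 'cV[R]_p, (forall i, `|x i ord0| <= K) -> `|f x - q x| <= e].
Proof.
move=> cf fC K0 e0; have e2 : 0 < e / 2 by rewrite divr_gt0.
have C0 : 0 <= C by apply: le_trans (fC 0).
have [del del0 hdel] := box_unif_continuous K cf e2.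
have [A AK Alip] := @clipped_arcsin R.
(* A change of t_j by less than [eta] moves the coordinate by less than 4 K eta = del: a factor 2
   from the affine map, 2 from the Lipschitz constant of [A], and [K] from the scaling. *)
pose eta := del / (4 * K); have eta0 : 0 < eta by rewrite divr_gt0// mulr_gt0.
pose D := 2 * C * p%:R / eta ^+ 2.
have D0 : 0 <= D by rewrite divr_ge0 ?sqr_ge0// !mulr_ge0.
pose N := (Num.truncn (D / (e / 2))).+1.
have ND : D / N%:R <= e / 2.
  rewrite ler_pdivrMr// mulrC -ler_pdivrMr//; apply: ltW.
  exact: truncnS_gt.
have N0 : (0 : R) < N%:R by rewrite ltr0n.
pose t (j : 'I_p) (y : 'cV[R]_p) := 2^-1 * (1 + sin (K^-1 * y j ord0)).
have tt j : trigpoly (t j).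
  apply: trigpoly_scale; apply: trigpoly_add; first exact: trigpoly_cst.
  exact: trigpoly_sin.
have t01 y j : 0 <= t j y <= 1.
  by have := sin_max (K^-1 * y j ord0); rewrite ler_norml /t; lra.
pose l := flatten (nseq N (enum 'I_p)).
have cl j : count_mem j l = N.
  rewrite /l count_flatten map_nseq sumn_nseq.
  by rewrite (count_uniq_mem _ (enum_uniq _)) mem_enum inE mul1n.
pose G (k : {ffun 'I_p -> nat}) : R :=
  f (\col_i (K * A (2 * (k i)%:R / N%:R - 1))).
pose k0 : {ffun 'I_p -> nat} := [ffun=> 0%N].
exists (fun y => walk (fun j => t j y) l G k0); split.
- exact: trigpoly_walk.
- by move=> y; apply: walk_norm_le => // k; exact: fC.
move=> y yK; set T := fun j => t j y.
have T01 j : 0 <= T j <= 1 by exact: t01.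
have -> : f y - walk T l G k0 = walk T l (fun k => f y + -1 * G k) k0.
  by rewrite walkD walk_cst walkZ mulN1r.
(* A majorant of the error: e / 2 covers the case where every frequency is within [eta] of its mean,
   and otherwise the second term exceeds the trivial bound 2 C. *)
pose H (k : {ffun 'I_p -> nat}) := e / 2 + (2 * C / (eta ^+ 2 * N%:R ^+ 2)) *
  \sum_j ((k j)%:R - N%:R * T j) ^+ 2.
have C20 : 0 <= 2 * C / (eta ^+ 2 * N%:R ^+ 2).
  apply: divr_ge0; apply: mulr_ge0 => //; exact: sqr_ge0.
have step k : `|f y + -1 * G k| <= H k.
  rewrite mulN1r /H; have S0 : 0 <= \sum_j ((k j)%:R - N%:R * T j) ^+ 2.
    by apply: sumr_ge0 => j _; exact: sqr_ge0.
  have [near|] := boolP [forall j, `|T j - (k j)%:R / N%:R| < eta].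
    apply: (@le_trans _ _ (e / 2)); last by rewrite lerDl; exact: mulr_ge0.
    apply: hdel => // j; rewrite mxE.
    have yE : y j ord0 = K * A (sin (K^-1 * y j ord0)).
      rewrite AK ?mulVKf ?gt_eqF//.
      by rewrite -ler_norml normrM normfV (gtr0_norm K0) mulrC ler_pdivrMr// mul1r.
    rewrite [in X in `|X - _|]yE -mulrBr normrM (gtr0_norm K0).
    have /forallP/(_ j) := near.
    rewrite /eta ltr_pdivlMr ?mulr_gt0// => h; apply: le_lt_trans h.
    apply: (@le_trans _ _ (K * (2 * `|sin (K^-1 * y j ord0)
        - (2 * (k j)%:R / N%:R - 1)|))).
      by apply: ler_wpM2l; [exact: ltW|exact: Alip].
    have -> : sin (K^-1 * y j ord0) - (2 * (k j)%:R / N%:R - 1) =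
      2 * (T j - (k j)%:R / N%:R) by rewrite /T /t; field; rewrite gt_eqF.
    rewrite normrM (ger0_norm (_ : 0 <= 2))//.
    by rewrite le_eqVlt; apply/orP; left; apply/eqP; ring.
  move=> /forallPn[j]; rewrite -leNgt => far.
  rewrite (@le_trans _ _ (2 * C))//.
    by rewrite (le_trans (ler_normB _ _))// mulr2n mulrDl mul1r lerD// fC.
  rewrite -[leLHS]add0r lerD ?(ltW e2)//.
  have single : eta ^+ 2 * N%:R ^+ 2 <= \sum_j ((k j)%:R - N%:R * T j) ^+ 2.
    rewrite (bigD1 j)//= (@le_trans _ _ (((k j)%:R - N%:R * T j) ^+ 2))//; last first.
      by rewrite lerDl; apply: sumr_ge0 => i _; exact: sqr_ge0.
    have -> : ((k j)%:R - N%:R * T j) ^+ 2 = (T j - (k j)%:R / N%:R) ^+ 2 * N%:R ^+ 2.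
      by field; rewrite gt_eqF.
    apply: ler_wpM2r; first exact: sqr_ge0.
    by rewrite -[leRHS]real_normK ?num_real// lerXn2r ?nnegrE// ltW.
  apply: le_trans (ler_wpM2l C20 single).
  rewrite divfK// mulf_neq0// expf_neq0//; by rewrite gt_eqF.
have wH : walk T l H k0 <= e.
  rewrite /H walkD walk_cst walkZ walk_sum [leRHS]splitr lerD2l.
  apply: le_trans ND; rewrite /D.
  have -> : 2 * C * p%:R / eta ^+ 2 / N%:R =
      2 * C / (eta ^+ 2 * N%:R ^+ 2) * (p%:R * N%:R).
    by field; rewrite !gt_eqF.
  rewrite ler_wpM2l//.
  apply: (@le_trans _ _ (\sum_(j < p) N%:R)); last first.
    by rewrite sumr_const card_ord mulr_natl.
  apply: ler_sum => j _; rewrite walk_var cl ffunE add0r subrr expr0n/= add0r.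
  rewrite ler_piMr ?ltW//; have := T01 j; move: (T j) => x /andP[x0 x1].
  by nra.
rewrite ler_norml; apply/andP; split; last first.
  apply: le_trans wH; apply: walk_le => // k.
  by have := step k; rewrite ler_norml => /andP[].
have E : - walk T l H k0 = walk T l (fun k => -1 * H k) k0.
  by rewrite walkZ mulN1r.
apply: (@le_trans _ _ (- walk T l H k0)); first by rewrite lerN2.
rewrite E; apply: walk_le => // k; rewrite mulN1r.
by have := step k; rewrite ler_norml => /andP[].
Qed.

End approximation_theorem.

Section outer_expectation.
Context {d : measure_display} {T : measurableType d} {R : realType}.
Variable P : probability T R.

Lemma outer_expectation_le (f g : T -> R) : L1 P g -> (forall z, f z <= g z) ->
  (outer_expectation P f <= (\int[P]_z g z)%:E)%E.
Proof.
move=> Lg fg; apply: ereal_inf_lbound; exists g => //.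
by rewrite EFin_Rint.
Qed.

Lemma outer_expectation_ge (f g : T -> R) : L1 P g -> (forall z, g z <= f z) ->
  ((\int[P]_z g z)%:E <= outer_expectation P f)%E.
Proof.
move=> Lg gf; apply: le_ereal_inf_tmp => _ [h [Lh fh] <-].
rewrite EFin_Rint// lee_fin; apply: Rint_le => // z.
exact: le_trans (gf z) (fh z).
Qed.

Lemma outer_expectation_mono (f g : T -> R) : (forall z, f z <= g z) ->
  (outer_expectation P f <= outer_expectation P g)%E.
Proof.
move=> fg; apply: le_ereal_inf_tmp => _ [h [Lh gh] <-].
by apply: ereal_inf_lbound; exists h => //; split=> // z; exact: le_trans (gh z).
Qed.

End outer_expectation.

Section borel_vectors.
Context {R : realType} {p : nat}.

Lemma continuous_borel_measurable (f : 'cV[R]_p -> R) :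
  continuous f -> measurable_fun [set: borel 'cV[R]_p] f.
Proof.
move=> cf; apply: (measurability _ (RGenOpens.measurableE R)).
move=> _ [_ [a [b ->]] <-]; rewrite setTI; apply: sub_sigma_algebra.
by move/continuousP : cf; apply; exact: interval_open.
Qed.

Lemma borel_coord_measurable (i : 'I_p) :
  measurable_fun [set: borel 'cV[R]_p] (fun x : 'cV[R]_p => x i ord0).
Proof. by apply: continuous_borel_measurable; exact: coord_continuous. Qed.

Definition box (K : R) : set 'cV[R]_p := [set x | forall i, `|x i ord0| <= K].

Lemma measurable_box (K : R) : measurable (box K : set (borel 'cV[R]_p)).
Proof.
rewrite (_ : box K = \bigcap_(i in [set: 'I_p]) [set x | `|x i ord0| <= K]).
  apply: fin_bigcap_measurable => // i _; rewrite -[X in measurable X]setTI.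
  apply: measurable_fun_le => //.
  by apply: measurableT_comp => //; exact: borel_coord_measurable.
by apply/seteqP; split=> x /= xK i; [move=> _|]; exact: xK.
Qed.

(** A single law is tight, since the complements of growing boxes decrease to the empty set. *)
Lemma prob_box_cvg (L : probability (borel 'cV[R]_p) R) (e : R) : 0 < e ->
  exists2 K : R, 0 < K & fine (L (~` box K)) <= e.
Proof.
move=> e0.
have : L (~` box n%:R) @[n --> \oo] --> L (\bigcap_n ~` box n%:R).
  apply: nonincreasing_cvg_mu => //.
  - by apply: (le_lt_trans _ (probability_fin (P := L))); apply: le_measure;
      rewrite ?inE//; apply: measurableC; exact: measurable_box.
  - by move=> n; apply: measurableC; exact: measurable_box.
  - by apply: bigcap_measurable => // n _; apply: measurableC; exact: measurable_box.
  - move=> m n mn; apply/subsetPset; apply: subsetC => x xm i.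
    by rewrite (le_trans (xm i))// ler_nat.
have -> : \bigcap_n ~` box n%:R = set0 :> set 'cV[R]_p.
  rewrite -subset0 => x /= h.
  apply: (h (Num.truncn (\sum_i `|x i ord0|)).+1 I) => i.
  apply: (@le_trans _ _ (\sum_i `|x i ord0|)); last exact: ltW (truncnS_gt _).
  by rewrite (bigD1 i)//= lerDl sumr_ge0.
rewrite measure0 => /fine_cvgP[_ /cvgrPdist_le /(_ _ e0) [N _ /(_ N.+1 (leqnSn N))]].
rewrite /= sub0r normrN => h; exists N.+1%:R; first by rewrite ltr0n.
exact: le_trans (ler_norm _) h.
Qed.

End borel_vectors.

Section cvg_in_distribution_criterion.
Context {d : measure_display} {Z : measurableType d} {R : realType} {p : nat}.

Lemma trigpoly_continuous (f : 'cV[R]_p -> R) : trigpoly f -> continuous f.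
Proof.
move=> tf x U /nbhs_ballP[e' /= e'0 eU]; have [K K0 lip] := trigpoly_lipschitz tf.
pose e := e' / 2; have e0 : 0 < e by rewrite divr_gt0.
have e1 : 0 < e / (K * p%:R + 1) by rewrite divr_gt0// ltr_wpDl// mulr_ge0.
apply/nbhs_ballP; exists (e / (K * p%:R + 1)) => //= y [_ xy].
apply: eU; apply: (@le_lt_trans _ _ e); last by rewrite /e; lra.
apply: (le_trans (lip x y)).
apply: (@le_trans _ _ (K * \sum_(i < p) e / (K * p%:R + 1))).
  by rewrite ler_wpM2l//; apply: ler_sum => i _; apply: ltW; exact: xy.
rewrite sumr_const card_ord -[_ *+ p]mulr_natr.
have -> : K * (e / (K * p%:R + 1) * p%:R) = K * p%:R * e / (K * p%:R + 1) by ring.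
rewrite ler_pdivrMr; last by rewrite ltr_wpDl// mulr_ge0.
by rewrite mulrC ler_wpM2l ?(ltW e0)// lerDl.
Qed.

Lemma trigpoly_L1 (L : probability (borel 'cV[R]_p) R) (f : 'cV[R]_p -> R) :
  trigpoly f -> L1 L f.
Proof.
move=> tf; have [C fC] := trigpoly_bounded tf.
have cf := trigpoly_continuous tf.
exact: (L1_bounded_prob (P := L) (continuous_borel_measurable cf) fC).
Qed.

Lemma bounded_continuous_L1 (L : probability (borel 'cV[R]_p) R)
    (f : 'cV[R]_p -> R) (C : R) :
  continuous f -> (forall x, `|f x| <= C) -> L1 L f.
Proof.
move=> cf fC.
exact: (L1_bounded_prob (P := L) (continuous_borel_measurable cf) fC).
Qed.

Lemma bounded_funP (f : 'cV[R]_p -> R) : bounded_fun f ->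
  exists2 C, 0 <= C & forall x, `|f x| <= C.
Proof.
move=> [M [_ fM]]; exists (`|M| + 1); first exact: addr_ge0.
by move=> x; apply: fM => //; rewrite (le_lt_trans (ler_norm M))// ltrDl.
Qed.

Lemma Rint_approx_le d' (T : measurableType d') (P : probability T R)
    (h k : T -> R) (B : set T) (C e : R) : measurable B ->
  L1 P h -> L1 P k -> 0 <= C -> (forall x, `|h x - k x| <= e + C * \1_B x) ->
  `|\int[P]_x h x - \int[P]_x k x| <= e + C * fine (P B).
Proof.
move=> mB Lh Lk C0 hk; have LB : L1 P (\1_B : T -> R).
  apply: (L1_bounded_prob (C := 1)); first exact: measurable_indic.
  by move=> x; rewrite indicE; case: (_ \in _); rewrite ?normr1 ?normr0.
have -> : e + C * fine (P B) = \int[P]_x (e + C * \1_B x).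
  by rewrite RintD ?Rint_cst ?RintZ ?Rint_indic//; [exact: L1_cst|exact: L1Z].
rewrite -RintB//; apply: Rint_norm_le => //.
  exact: L1_measurable (L1B Lh Lk).
by apply: L1D; [exact: L1_cst|exact: L1Z].
Qed.

Lemma trigpoly_determine (L1' L2' : probability (borel 'cV[R]_p) R) :
  (forall q, trigpoly q -> \int[L1']_x q x = \int[L2']_x q x) ->
  forall f, continuous f -> bounded_fun f ->
  \int[L1']_x f x = \int[L2']_x f x.
Proof.
move=> same f cf bf; have [C C0 fC] := bounded_funP bf.
apply/eqP; rewrite -subr_eq0 -normr_le0; apply/ler_addgt0Pl => e e0.
(* Each of the two laws contributes an error (1 + 2 C) (e / c). *)
rewrite addr0; pose c := 2 + 4 * C; have c0 : 0 < c by rewrite /c; lra.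
have ec : 0 < e / c by rewrite divr_gt0.
have [K1 K10 h1] := prob_box_cvg L1' ec; have [K2 K20 h2] := prob_box_cvg L2' ec.
pose K := Num.max K1 K2; have K0 : 0 < K by rewrite lt_max K10.
have [q [tq qC fq]] := trigpoly_approx cf fC K0 ec.
have sub (K' : R) : K' <= K -> (~` box K : set 'cV[R]_p) `<=` ~` box K'.
  by move=> KK; apply: subsetC => x xK i; rewrite (le_trans (xK i)).
have mc (K' : R) : measurable (~` box K' : set (borel 'cV[R]_p)).
  by apply: measurableC; exact: measurable_box.
have est (L : probability (borel 'cV[R]_p) R) : fine (L (~` box K)) <= e / c ->
    `|\int[L]_x f x - \int[L]_x q x| <= e / c + 2 * C * (e / c).
  move=> hL; apply: (@le_trans _ _ (e / c + 2 * C * fine (L (~` box K)))); last first.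
    by rewrite lerD2l ler_wpM2l// mulr_ge0.
  apply: Rint_approx_le => //.
  - exact: bounded_continuous_L1 fC.
  - exact: trigpoly_L1.
  - exact: mulr_ge0.
  - move=> x; rewrite indicE; case: (boolP (x \in _)) => [_|].
      rewrite mulr1 (le_trans (ler_normB _ _))//.
      by have := fC x; have := qC x; lra.
    move=> /negP h; rewrite mulr0 addr0; apply: fq => i.
    have : box K x by apply: contrapT => nb; apply: h; rewrite inE.
    exact.
have e1 : `|\int[L1']_x f x - \int[L1']_x q x| <= e / c + 2 * C * (e / c).
  apply: est; apply: le_trans h1; apply: fine_prob_le => //.
  by apply: sub; rewrite le_max lexx.
have e2 : `|\int[L2']_x f x - \int[L2']_x q x| <= e / c + 2 * C * (e / c).
  apply: est; apply: le_trans h2; apply: fine_prob_le => //.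
  by apply: sub; rewrite le_max lexx orbT.
rewrite -(same q tq) in e2.
rewrite -(subrKA (\int[L1']_x q x)) (le_trans (ler_normD _ _))//.
rewrite [X in _ + X]distrC.
apply: le_trans (lerD e1 e2) _.
by rewrite le_eqVlt; apply/orP; left; apply/eqP; rewrite /c; field; rewrite gt_eqF.
Qed.

Variables (Q : forall n, probability (n.-tuple Z) R)
  (S T : forall n, n.-tuple Z -> 'cV[R]_p) (L : probability (borel 'cV[R]_p) R).
Hypotheses
  (mS : forall n i, measurable_fun [set: n.-tuple Z] (fun z => S z i ord0))
  (cosS : forall b a, \int[Q n]_z cos (b + dot a (S z)) @[n --> \oo] -->
     \int[L]_x cos (b + dot a x))
  (tightS : forall i, Opn Q (fun n z => S z i ord0))
  (TS : forall i, opn Q (fun n z => T z i ord0 - S z i ord0)).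

Let trigS q : trigpoly q ->
  \int[Q n]_z q (S z) @[n --> \oo] --> \int[L]_x q x.
Proof.
have LQ n f : trigpoly f -> L1 (Q n) (fun z => f (S z)).
  move=> tf; have [C fC] := trigpoly_bounded tf.
  exact: (L1_bounded_prob (trigpoly_measurable (@mS n) tf) (fun z => fC (@S n z))).
elim=> {q} [b a|f g tf h1 tg h2|c f tf h] //=.
- rewrite RintD; [|exact: trigpoly_L1|exact: trigpoly_L1].
  rewrite (_ : (fun n => _) = (fun n => \int[Q n]_z f (S z) + \int[Q n]_z g (S z))).
    exact: cvgD.
  by apply/funext => n; rewrite RintD//; exact: LQ.
- rewrite RintZ; last exact: trigpoly_L1.
  rewrite (_ : (fun n => _) = (fun n => c * \int[Q n]_z f (S z))).
    exact: cvgMr.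
  by apply/funext => n; rewrite RintZ//; exact: LQ.
Qed.

Let tightS_all (e : R) : 0 < e -> exists2 K : R, 0 <= K & \forall n \near \oo,
  exists2 B : set (n.-tuple Z),
    measurable B /\ (forall z, ~ B z -> forall i, `|S z i ord0| <= K) &
    fine (Q n B) <= e.
Proof.
move=> e0; have : Opn Q (fun n z => \sum_i `|S z i ord0|).
  apply: Opn_sum => i; apply: Opn_le (tightS i) => n z.
  by rewrite normr_id.
move=> /(_ _ e0)[K OK]; exists (Num.max K 0); first by rewrite le_max lexx orbT.
apply: filterS OK => n [B [mB SB] Be]; exists B => //; split=> // z nB i.
rewrite le_max; apply/orP; left; rewrite leNgt; apply/negP => h; apply: nB.
apply: SB => /=; apply: (lt_le_trans h).
apply: le_trans (ler_norm _).
by rewrite (bigD1 i)//= lerDl sumr_ge0.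
Qed.

Let TS_all (e : R) : 0 < e -> vanishing Q (fun n => [set z |
  e < \sum_i `|T z i ord0 - S z i ord0|]).
Proof.
move=> e0; have : opn Q (fun n z => \sum_i `|T z i ord0 - S z i ord0|).
  apply: opn_sum => i; apply: opn_le (TS i) => n z.
  by rewrite normr_id.
move=> /(_ _ e0); apply: vanishing_sub => n z /= h.
by rewrite ger0_norm ?sumr_ge0.
Qed.

Lemma ereal_cvg_bounds (u : nat -> \bar R) (l : R) :
  (forall e, 0 < e -> \forall n \near \oo, ((l - e)%:E <= u n <= (l + e)%:E)%E) ->
  u n @[n --> \oo] --> l%:E.
Proof.
move=> h; apply/fine_cvgP; split.
  apply: filterS (h 1 ltr01) => n /andP[h1 h2]; rewrite fin_numElt.
  by rewrite (lt_le_trans _ h1) ?ltNyr// (le_lt_trans h2) ?ltry.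
apply/cvgrPdist_le => e e0; apply: filterS (h e e0) => n /andP[h1 h2] /=.
have fin : u n \is a fin_num.
  rewrite fin_numElt.
  by rewrite (lt_le_trans _ h1) ?ltNyr// (le_lt_trans h2) ?ltry.
move: h1 h2; rewrite -(fineK fin) !lee_fin /= => h1 h2.
by rewrite ler_norml; apply/andP; split; lra.
Qed.

(** Although [T] need not be measurable, f (T) lies between the measurable functions q (S) plus or
    minus an error that is small off an exceptional set and at most of order [C] on it. Its outer
    expectation thus lies between two ordinary integrals. *)
Theorem cvg_in_distribution_trig : cvg_in_distribution Q T L.
Proof.
move=> f cf bf; have [C C0 fC] := bounded_funP bf.
have Lf := bounded_continuous_L1 L cf fC.
rewrite EFin_Rint//; apply: ereal_cvg_bounds => e e0.
(* In units of e / c: 1 + 2 C for replacing f by q under [L], 1 for the convergence of the integrals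
   of q (S), and 2 + 4 C for replacing q (S) by f (T). *)
pose c := 4 + 6 * C; have c0 : 0 < c by rewrite /c; lra.
have ec : 0 < e / c by rewrite divr_gt0.
have [K1 K10 hL] := prob_box_cvg L ec; have [K2 K20 hS] := tightS_all ec.
(* The box must carry most of [L] and also contain [T], which is within 1 of [S] off the exceptional
   set. *)
pose K := Num.max K1 (K2 + 1); have K0 : 0 < K by rewrite lt_max K10.
have [q [tq qC fq]] := trigpoly_approx cf fC K0 ec.
have [M M0 lip] := trigpoly_lipschitz tq.
pose eta := Num.min 1 (e / c / (M + 1)).
have eta0 : 0 < eta by rewrite lt_min ltr01 divr_gt0// ltr_wpDl.
have /cvgrPdist_le /(_ _ ec) q_near := trigS tq.
have mbox : measurable (~` box K : set (borel 'cV[R]_p)).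
  by apply: measurableC; exact: measurable_box.
have fqL : `|\int[L]_x f x - \int[L]_x q x| <= e / c + 2 * C * (e / c).
  apply: (@le_trans _ _ (e / c + 2 * C * fine (L (~` box K)))); last first.
    rewrite lerD2l ler_wpM2l ?mulr_ge0//; apply: le_trans hL.
    apply: fine_prob_le => //; first by apply: measurableC; exact: measurable_box.
    by apply: subsetC => x xK i; rewrite (le_trans (xK i))// le_max lexx.
  apply: Rint_approx_le => //.
  - exact: trigpoly_L1.
  - exact: mulr_ge0.
  - move=> x; rewrite indicE; case: (boolP (x \in _)) => [_|].
      rewrite mulr1 (le_trans (ler_normB _ _))//.
      by have := fC x; have := qC x; lra.
    move=> /negP h; rewrite mulr0 addr0; apply: fq => i.
    have : box K x by apply: contrapT => nb; apply: h; rewrite inE.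
    exact.
near=> n.
have [B1 [mB1 SB1] B1e] : exists2 B : set (n.-tuple Z),
    measurable B /\ (forall z, ~ B z -> forall i, `|S z i ord0| <= K2) &
    fine (Q n B) <= e / c by near: n.
have [B2 [mB2 TB2] B2e] : exists2 B : set (n.-tuple Z), measurable B /\
    [set z | eta < \sum_i `|T z i ord0 - S z i ord0|] `<=` B & fine (Q n B) <= e / c.
  by near: n; exact: TS_all.
have qn : `|\int[L]_x q x - \int[Q n]_z q (S z)| <= e / c by near: n.
pose B := B1 `|` B2; have mB : measurable B by exact: measurableU.
have Be : fine (Q n B) <= 2 * (e / c).
  by rewrite (le_trans (fine_prob_setU _ mB1 mB2))// mulr2n mulrDl mul1r lerD.
have close z : `|f (T z) - q (S z)| <= 2 * (e / c) + 2 * C * \1_B z.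
  rewrite indicE; case: (boolP (z \in B)) => [_|/negP nB].
    rewrite mulr1 -[leLHS]add0r; apply: lerD; first by rewrite mulr_ge0// ltW.
    rewrite (le_trans (ler_normB _ _))//.
    by have := fC (T z); have := qC (S z); lra.
  have nB1 : ~ B1 z by move=> b; apply: nB; rewrite inE; left.
  have TSz : \sum_i `|T z i ord0 - S z i ord0| <= eta.
    rewrite leNgt; apply/negP => b; apply: nB; rewrite inE; right.
    exact: TB2.
  have TK i : `|T z i ord0| <= K.
    rewrite le_max; apply/orP; right; rewrite -(subrK (S z i ord0) (T z i ord0)).
    rewrite addrC (le_trans (ler_normD _ _))// lerD ?SB1//.
    apply: (@le_trans _ _ (\sum_i `|T z i ord0 - S z i ord0|)).
      by rewrite (bigD1 i)//= lerDl sumr_ge0.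
    by apply: (le_trans TSz); rewrite ge_min lexx.
  rewrite mulr0 addr0 -(subrKA (q (T z))) (le_trans (ler_normD _ _))//.
  rewrite mulr2n mulrDl mul1r lerD ?fq//.
  apply: (le_trans (lip (T z) (S z))).
  apply: (@le_trans _ _ (M * (e / c / (M + 1)))).
    by rewrite ler_wpM2l// (le_trans TSz)// ge_min lexx orbT.
  rewrite mulrCA ler_piMr ?(ltW ec)// ler_pdivrMr ?mul1r ?lerDl//.
  by rewrite ltr_wpDl.
have Lq : L1 (Q n) (fun z => q (S z)).
  exact: (L1_bounded_prob (trigpoly_measurable (@mS n) tq) (fun z => qC (@S n z))).
have LB : L1 (Q n) (fun z => 2 * (e / c) + 2 * C * \1_B z).
  apply: L1D; [exact: L1_cst|apply: L1Z; apply: (L1_bounded_prob (C := 1))].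
    exact: measurable_indic.
  by move=> z; rewrite indicE; case: (_ \in _); rewrite ?normr1 ?normr0.
have IB : \int[Q n]_z (2 * (e / c) + 2 * C * \1_B z) <=
    2 * (e / c) + 2 * C * (2 * (e / c)).
  have L1B' : L1 (Q n) (\1_B : _ -> R).
    apply: (L1_bounded_prob (C := 1)); first exact: measurable_indic.
    by move=> z; rewrite indicE; case: (_ \in _); rewrite ?normr1 ?normr0.
  rewrite RintD ?Rint_cst ?RintZ ?Rint_indic//; [|exact: L1_cst|exact: L1Z].
  by rewrite lerD2l ler_wpM2l// mulr_ge0.
have eE : e = 4 * (e / c) + 6 * (C * (e / c)) by rewrite /c; field; rewrite gt_eqF.
have arith (I J I' b x : R) : `|I - J| <= x + 2 * C * x -> `|J - I'| <= x ->
    b <= 2 * x + 2 * C * (2 * x) -> e = 4 * x + 6 * (C * x) ->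
    I - e <= I' - b /\ I' + b <= I + e.
  move=> + + h3 h4; rewrite !ler_norml => /andP[h11 h12] /andP[h21 h22].
  by rewrite h4; split; lra.
have [low up] := arith _ _ _ _ _ fqL qn IB eE.
apply/andP; split.
  apply: (@le_trans _ _ (\int[Q n]_z (q (S z) - (2 * (e / c) + 2 * C * \1_B z)))%:E).
    by rewrite lee_fin RintB.
  apply: outer_expectation_ge; first exact: L1B.
  by move=> z; have := close z; rewrite ler_norml /= => /andP[]; lra.
apply: (@le_trans _ _ (\int[Q n]_z (q (S z) + (2 * (e / c) + 2 * C * \1_B z)))%:E).
  apply: outer_expectation_le; first exact: L1D.
  by move=> z; have := close z; rewrite ler_norml /= => /andP[]; lra.
by rewrite lee_fin RintD.
Unshelve. all: by end_near. Qed.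

End cvg_in_distribution_criterion.

(** * Gaussian laws *)

Section normal_cosine_transform.
Context {R : realType}.
Variable s : R.
Hypothesis s0 : 0 < s.
Let p := normal_pdf 0 s.
Local Notation leb := (@lebesgue_measure R).

Let pE y : p y = normal_peak s * expR (- (y ^+ 2 / (2 * s ^+ 2))).
Proof.
rewrite /p /normal_pdf gt_eqF//= /normal_fun subr0.
by rewrite -[s ^+ 2 *+ 2]mulr_natl mulNr.
Qed.

Let p0 y : 0 <= p y. Proof. exact: normal_pdf_ge0. Qed.

Let mp : measurable_fun [set: R] p. Proof. exact: measurable_normal_pdf. Qed.

Let L1p : L1 leb p. Proof. exact: integrable_normal_pdf. Qed.

Let p_derive (y : R) : is_derive y 1 p (- (y / s ^+ 2) * p y).
Proof.
rewrite (_ : p = fun y => normal_peak s * expR (- (y ^+ 2 / (2 * s ^+ 2)))); last first.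
  exact/funext/pE.
have sn0 : s != 0 by rewrite gt_eqF.
apply: is_derive_eq; rewrite /GRing.scale /=.
by field.
Qed.

Let L1le f g := @L1_le _ (measurableTypeR R) R leb f g.

(** The normal density of doubled variance: its tails dominate [|y| * p y], so that its
    integrability and boundedness give the first moment and the decay of [p]. *)
Let q := normal_pdf 0 (s * Num.sqrt 2).

Let q_dom : exists2 C : R, 0 <= C & forall y : R, `|y| * p y <= C * q y.
Proof.
have t0 : 0 < s * Num.sqrt 2 by rewrite mulr_gt0.
have qE y : q y = normal_peak (s * Num.sqrt 2) * expR (- (y ^+ 2 / (4 * s ^+ 2))).
  rewrite /q /normal_pdf gt_eqF//= /normal_fun subr0.
  congr (_ * expR _); rewrite exprMn sqr_sqrtr// mulNr; congr (- (_ / _)).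
  by rewrite -[LHS]mulr_natl; ring.
have P0 := normal_peak_gt0 (lt0r_neq0 s0).
have P1 := normal_peak_gt0 (lt0r_neq0 t0).
exists (s * normal_peak s / normal_peak (s * Num.sqrt 2)).
  by apply: divr_ge0; [apply: mulr_ge0|]; exact: ltW.
move=> y; rewrite qE pE.
set E := expR (- (y ^+ 2 / (4 * s ^+ 2))).
have -> : s * normal_peak s / normal_peak (s * Num.sqrt 2) *
    (normal_peak (s * Num.sqrt 2) * E) = normal_peak s * (s * E).
  by field; rewrite gt_eqF.
have -> : expR (- (y ^+ 2 / (2 * s ^+ 2))) = E * E.
  by rewrite -expRD; congr expR; field; rewrite gt_eqF.
rewrite mulrCA ler_wpM2l ?(ltW P0)// mulrA ler_wpM2r ?expR_ge0//.
rewrite /E expRN ler_pdivrMr ?expR_gt0//.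
apply: (@le_trans _ _ (s * (1 + y ^+ 2 / (4 * s ^+ 2)))); last first.
  by rewrite ler_wpM2l ?(ltW s0) ?expR_ge1Dx.
(* Completing the square proves |y| <= s + y^2 / (4 s). *)
have -> : s * (1 + y ^+ 2 / (4 * s ^+ 2)) = `|y| + (s - `|y| / 2) ^+ 2 / s.
  by rewrite -(real_normK (num_real y)); field; rewrite gt_eqF.
by rewrite lerDl divr_ge0 ?sqr_ge0 ?(ltW s0).
Qed.

Let L1yp : L1 leb (fun y => `|y| * p y).
Proof.
have [C _ h] := q_dom.
apply: (@L1le _ (fun y => C * q y)).
- by apply: measurable_funM => //; exact: measurable_normed.
- by move=> y; rewrite ger0_norm ?h// mulr_ge0.
- by apply: L1Z; apply: integrable_normal_pdf; rewrite mulf_neq0 ?gt_eqF.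
Qed.

Let p_tail : exists C : R, forall n, p n.+1%:R <= C / n.+1%:R /\ p (- n.+1%:R) <= C / n.+1%:R.
Proof.
have [C C0 h] := q_dom.
exists (C * normal_peak (s * Num.sqrt 2)) => n.
have aux y : `|y| * p y <= C * normal_peak (s * Num.sqrt 2).
  apply: (le_trans (h y)); rewrite ler_wpM2l// normal_pdf_ub// mulf_neq0 ?gt_eqF//.
split; rewrite ler_pdivlMr// mulrC.
  by have := aux n.+1%:R; rewrite ger0_norm.
by have := aux (- n.+1%:R); rewrite normrN ger0_norm.
Qed.

Section fix_t.
Variables b t : R.
Let G y := sin (b + t * y) * p y.
Let G' y := t * (cos (b + t * y) * p y) - (sin (b + t * y) * (y * p y)) / s ^+ 2.

Let mlin : measurable_fun [set: R] (fun y : R => b + t * y).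
Proof. by apply: measurable_funD => //; exact: measurable_funM. Qed.

Let msin : measurable_fun [set: R] (fun y => sin (b + t * y)).
Proof.
apply: measurableT_comp mlin; apply: continuous_measurable_fun.
exact: continuous_sin.
Qed.

Let L1cp : L1 leb (fun y => cos (b + t * y) * p y).
Proof.
apply: (@L1le _ p) => // [|y].
  by apply: measurable_funM => //; exact: measurable_cosD.
by rewrite normrM [`|p y|]ger0_norm// ler_piMl// ler_norml cos_geN1 cos_le1.
Qed.

Let L1syp : L1 leb (fun y => sin (b + t * y) * (y * p y)).
Proof.
apply: (@L1le _ (fun y => `|y| * p y)) => // [|y].
  apply: measurable_funM; last exact: measurable_funM.
  by exact: msin.
rewrite normrM [X in _ * X]normrM [`|p y|]ger0_norm// ler_piMl ?mulr_ge0//.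
by rewrite ler_norml sin_geN1 sin_le1.
Qed.

Let G_derive (y : R) : is_derive y 1 G (G' y).
Proof.
have h := p_derive y; rewrite /G /G'.
apply: is_derive_eq; rewrite /GRing.scale /=; field; exact: lt0r_neq0.
Qed.

Let cvg_int_sym (f : R -> R) : L1 leb f ->
  \int[leb]_(x in `[- n.+1%:R, n.+1%:R]) f x @[n --> \oo] --> \int[leb]_x f x.
Proof.
move=> Lf.
rewrite (_ : (fun n => _) = (fun n => \int[leb]_x (\1_(`[- n.+1%:R, n.+1%:R]%classic) x * f x))); last first.
  apply/funext => n; rewrite Rintegral_mkcond; apply: eq_Rintegral => x _.
  by rewrite patchE indicE; case: ifPn => _; rewrite ?mul1r ?mul0r.
apply: (dominated_cvgR (m := leb) (g := fun x => `|f x|)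
  (f_ := fun n x => \1_(`[- n.+1%:R, n.+1%:R]%classic) x * f x)).
- by move=> n; apply: measurable_funM; [exact: measurable_indic|exact: L1_measurable Lf].
- move=> x; apply: (cvg_near_cst).
  near=> n; rewrite indicE mem_set ?mul1r//= in_itv/= -ler_norml.
  have : (Num.truncn `|x| <= n)%N by near: n; exact: nbhs_infty_ge.
  rewrite -ltnS -(ltr_nat R) => h; apply/ltW; apply: lt_le_trans (truncnS_gt _) _.
  by rewrite ler_nat -(ltr_nat R).
- exact: L1_norm.
- move=> n x; rewrite normrM ler_piMl// indicE; case: (_ \in _); rewrite ?normr1 ?normr0//.
Unshelve. all: by end_near. Qed.

(** [G] is bounded by [p], which tends to 0 at both ends, so the integrals of its derivative over
    growing symmetric intervals tend to 0. *)
Let int_G' : \int[leb]_y G' y = 0.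
Proof.
have LG' : L1 leb G'.
  apply: L1B; first exact: L1Z.
  rewrite (_ : (fun y => _) = (fun y => (s ^+ 2)^-1 * (sin (b + t * y) * (y * p y)))).
    exact: L1Z.
  by apply/funext => y; rewrite mulrC.
have cG' : continuous G'.
  have cp : continuous p by apply: continuous_normal_pdf; rewrite gt_eqF.
  have cl : continuous (fun y : R => b + t * y).
    by move=> y; apply: cvgD; [exact: cvg_cst|apply: cvgM; [exact: cvg_cst|exact: cvg_id]].
  move=> y; apply: cvgB.
    apply: cvgM; first exact: cvg_cst.
    apply: cvgM; last exact: cp.
    by apply: (continuous_comp (cl y)); exact: continuous_cos.
  apply: cvgM; last exact: cvg_cst.
  apply: cvgM.
    by apply: (continuous_comp (cl y)); exact: continuous_sin.
  by apply: cvgM; [exact: cvg_id|exact: cp].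
have cG : continuous G.
  by move=> y; apply: differentiable_continuous; apply/derivable1_diffP; case: (G_derive y).
have ftc n : \int[leb]_(x in `[- n.+1%:R, n.+1%:R]) G' x = G n.+1%:R - G (- n.+1%:R).
  rewrite /Rintegral (@continuous_FTC2 _ _ G)//.
  - by rewrite -subr_gt0 opprK addr_gt0.
  - exact: continuous_subspaceT.
  - split; [|exact/cvg_at_right_filter/cG|exact/cvg_at_left_filter/cG].
    by move=> x _; case: (G_derive x).
  - by move=> x _; rewrite derive1E; have [_ ->] := G_derive x.
have [C hC] := p_tail.
have lim0 : G n.+1%:R - G (- n.+1%:R) @[n --> \oo] --> (0 : R).
  apply: (@cvg_norm_le _ _ (fun n => 2 * (C / n.+1%:R))).
    apply: nearW => n; rewrite subr0 (le_trans (ler_normB _ _))//.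
    have aux y : `|G y| <= p y.
      rewrite normrM [`|p y|]ger0_norm// ler_piMl// ler_norml.
      by rewrite sin_geN1 sin_le1.
    have [h1 h2] := hC n; have := aux n.+1%:R; have := aux (- n.+1%:R).
    by move: (C / _) h1 h2 => ?; lra.
  have -> : (0 : R) = 2 * (C * 0) by rewrite !mulr0.
  apply: cvgM; first exact: cvg_cst.
  apply: cvgM; first exact: cvg_cst.
  by rewrite (cvg_shiftS (fun n => (n%:R^-1 : R^o))); exact: cvg_invn.
have := cvg_int_sym LG'.
rewrite (_ : (fun n => _) = (fun n => G n.+1%:R - G (- n.+1%:R))); last exact/funext.
by move=> /(cvg_lim (@Rhausdorff R)) <-; rewrite (cvg_lim (@Rhausdorff R) lim0).
Qed.

(** Stein's identity for the test function y -> sin (b + t y), obtained by integration by parts. *)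
Lemma normal_stein :
  \int[leb]_y (sin (b + t * y) * (y * p y)) =
  t * s ^+ 2 * \int[leb]_y (cos (b + t * y) * p y).
Proof.
have := int_G'; rewrite /G' RintB; last first.
- rewrite (_ : (fun y => _) = (fun y => (s ^+ 2)^-1 * (sin (b + t * y) * (y * p y)))).
    exact: L1Z.
  by apply/funext => y; rewrite mulrC.
- exact: L1Z.
rewrite RintZ// (_ : (fun y => _ / s ^+ 2) = (fun y => (s ^+ 2)^-1 * (sin (b + t * y) * (y * p y)))); last first.
  by apply/funext => y; rewrite mulrC.
rewrite RintZ// => /eqP; rewrite subr_eq0 => /eqP h.
rewrite -mulrA [s ^+ 2 * _]mulrC mulrA h mulrAC mulVf ?mul1r//.
by rewrite expf_neq0// gt_eqF.
Qed.

Lemma L1_cos_normal_pdf : L1 leb (fun y => cos (b + t * y) * p y).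
Proof. exact: L1cp. Qed.

Lemma L1_sin_normal_pdf : L1 leb (fun y => sin (b + t * y) * (y * p y)).
Proof. exact: L1syp. Qed.

End fix_t.

Let F b t := \int[leb]_y (cos (b + t * y) * p y).

Let F_derive b (t : R) : is_derive t 1 (F b) (- (t * s ^+ 2 * F b t)).
Proof.
pose f t y := cos (b + t * y) * p y.
have fd (r y : R) : is_derive r 1 (f ^~ y) (- (sin (b + r * y) * (y * p y))).
  by rewrite /f; apply: is_derive_eq; rewrite /GRing.scale /=; ring.
have tI : t \in `]t - 1, t + 1[ by rewrite in_itv/=; apply/andP; split; lra.
have f1 (r y : R) : partial1of2 f r y = - (sin (b + r * y) * (y * p y)).
  by rewrite partial1of2E; have [_ ->] := fd r y.
have intf r : `]t - 1, t + 1[%classic r -> leb.-integrable setT (EFin \o f r).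
  by move=> _; exact: L1_cos_normal_pdf.
have df r y : `]t - 1, t + 1[%classic r -> setT y -> derivable (f ^~ y) r 1.
  by move=> _ _; case: (fd r y).
have ub r y : `]t - 1, t + 1[%classic r -> setT y -> `|partial1of2 f r y| <= `|y| * p y.
  move=> _ _; rewrite f1 normrN !normrM [`|p y|]ger0_norm// ler_piMl ?mulr_ge0//.
  by rewrite ler_norml sin_geN1 sin_le1.
have g0 (y : R) : 0 <= `|y| * p y by rewrite mulr_ge0.
apply: DeriveDef; first exact: (derivable_under_integral measurableT tI intf df g0 L1yp ub).
rewrite -derive1E (differentiation_under_integral measurableT tI intf df g0 L1yp ub).
rewrite -normal_stein.
under eq_Rintegral do rewrite f1 -mulN1r.
by rewrite RintZ ?mulN1r//; exact: L1_sin_normal_pdf.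
Qed.

(** Differentiation under the integral and Stein's identity give F' = - t s^2 F in [t];
    multiplication by exp (s^2 t^2 / 2) makes the function constant, and its value is read at t =
    0. *)
Let FE b t : F b t = expR (- (s ^+ 2 * t ^+ 2 / 2)) * cos b.
Proof.
pose H t := expR (s ^+ 2 * t ^+ 2 / 2) * F b t.
have dH (r : R) : is_derive r 1 H 0.
  have h := F_derive b r; rewrite /H.
  by apply: is_derive_eq; rewrite /GRing.scale /=; field.
have := is_derive_0_is_cst t 0 dH.
rewrite /H expr0n mulr0 mul0r expR0 mul1r => h.
have F0 : F b 0 = cos b.
  rewrite /F; under eq_Rintegral do rewrite mul0r addr0.
  rewrite RintZ// /Rintegral integral_normal_pdf ?mulr1//.
by rewrite -F0 -h expRN mulKf// gt_eqF// expR_gt0.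
Qed.

Lemma Rint_normal_cos b t :
  \int[normal_prob 0 s]_x cos (b + t * x) = expR (- (s ^+ 2 * t ^+ 2 / 2)) * cos b.
Proof.
rewrite -FE.
rewrite (@Rint_density _ (measurableTypeR R) _ leb (normal_prob 0 s) p)//.
exact: measurable_cosD.
Qed.

End normal_cosine_transform.

Section borel_maps.
Context {d : measure_display} {T : measurableType d} {R : realType} {p : nat}.

(* Open sets of R^p are countable unions of boxes with rational corners. *)
Lemma measurable_borel_of_coord (f : T -> 'cV[R]_p) :
  (forall i, measurable_fun [set: T] (fun z => f z i ord0)) ->
  measurable_fun [set: T] (f : T -> borel 'cV[R]_p).
Proof.
move=> mf; apply: (@measurability _ _ _ (borel 'cV[R]_p) setT f (@open 'cV[R]_p)) => //.
move=> _ [U oU <-]; rewrite setTI.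
pose bx (u : 'cV[rat]_p * 'cV[rat]_p) : set 'cV[R]_p :=
  [set x | forall i, ratr (u.1 i ord0) < x i ord0 < ratr (u.2 i ord0)].
pose F u : set T := [set z | bx u `<=` U /\ bx u (f z)].
have -> : f @^-1` U = \bigcup_u F u.
  apply/seteqP; split=> [z /= Uz|z [u _ [bU bz]]]; last exact: bU.
  have /nbhs_ballP[e /= e0 eU] : nbhs (f z) U by exact: open_nbhs_nbhs.
  have hu i : exists q : rat, ratr q \in `]f z i ord0 - e, f z i ord0[.
    by apply: rat_in_itvoo; rewrite gtrBl.
  have hv i : exists q : rat, ratr q \in `]f z i ord0, f z i ord0 + e[.
    by apply: rat_in_itvoo; rewrite ltrDl.
  have [u hu'] := choice hu; have [v hv'] := choice hv.
  exists (\col_i u i, \col_i v i) => //; split=> [y /= yb|i]; last first.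
    by rewrite !mxE; have := hu' i; have := hv' i; rewrite !in_itv/= => /andP[-> _] /andP[_ ->].
  apply: eU; split=> // i j; rewrite (ord1 j) /ball /=.
  have := yb i; have := hu' i; have := hv' i; rewrite !in_itv/= !mxE.
  move=> /andP[_ h1] /andP[h2 _] /andP[h3 h4]; rewrite ltr_distl.
  have arith (a b r u1 v1 : R) : v1 < a + r -> a - r < u1 -> u1 < b -> b < v1 ->
      b - r < a < b + r by move=> *; apply/andP; split; lra.
  exact: arith h1 h2 h3 h4.
apply: countable_bigcupT_measurable => [|u]; first exact: countableP.
have [bU|nbU] := pselect (bx u `<=` U); last first.
  by rewrite (_ : F u = set0)// -subset0 => z [].
rewrite (_ : F u = \bigcap_(i in [set: 'I_p])
    (fun z => f z i ord0) @^-1` `]ratr (u.1 i ord0), ratr (u.2 i ord0)[%classic).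
  by apply: fin_bigcap_measurable => // i _; rewrite -[X in measurable X]setTI; exact: mf.
apply/seteqP; split=> [z [_ bz] i _ /=|z h]; first by rewrite in_itv/=; exact: bz.
by split=> // i; have := h i I; rewrite /= in_itv.
Qed.
End borel_maps.

Section laws_on_the_line.
Context {R : realType}.
Local Notation RR := (measurableTypeR R).

(** Carried to column vectors of length 1, the laws agree on bounded continuous functions by
    [trigpoly_determine]; closed half-lines are then reached as limits and generate the Borel
    sets. *)
Lemma cos_determine (m1 m2 : probability RR R) :
  (forall b t, \int[m1]_x cos (b + t * x) = \int[m2]_x cos (b + t * x)) ->
  forall A : set RR, measurable A -> m1 A = m2 A.
Proof.
move=> same.
pose c (x : RR) : borel 'cV[R]_1 := const_mx x.
have mc : measurable_fun [set: RR] c.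
  apply: measurable_borel_of_coord => i.
  by rewrite (_ : (fun z => _) = id)//; apply/funext => z; rewrite mxE.
pose c' : {mfun RR >-> borel 'cV[R]_1} := mfun_Sub (mem_set mc).
have trig q : trigpoly q -> \int[distribution m1 c']_x q x = \int[distribution m2 c']_x q x.
  have im (m : probability RR R) q' : trigpoly q' ->
      \int[distribution m c']_x q' x = \int[m]_x q' (c x).
    move=> tq; rewrite (@Rint_image _ _ _ _ _ m (distribution m c') c)//.
    exact: continuous_borel_measurable (trigpoly_continuous tq).
  move=> tq; elim: tq => {q} [b a|f g tf hf tg hg|k f tf hf].
  - rewrite !im; [|exact: trigpoly_cos|exact: trigpoly_cos].
    rewrite (_ : (fun x => _) = (fun x => cos (b + a ord0 ord0 * x))).
      exact: same.
    by apply/funext => x; rewrite /dot big_ord1 mxE.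
  - by rewrite !RintD; do ?exact: trigpoly_L1; rewrite hf hg.
  - by rewrite !RintZ; do ?exact: trigpoly_L1; rewrite hf.
have cont (f : R -> R) (C : R) : continuous f -> (forall x, `|f x| <= C) ->
    \int[m1]_x f x = \int[m2]_x f x.
  move=> cf fC.
  pose F (x : 'cV[R]_1) := f (x ord0 ord0).
  have cF : continuous F.
    by move=> x; apply: (continuous_comp (@coord_continuous _ _ _ _ _ x)); exact: cf.
  have bF : bounded_fun F.
    exists C; split; first exact: num_real.
    by move=> M CM x _; apply: le_trans (fC _) (ltW CM).
  have im (m : probability RR R) : \int[distribution m c']_x F x = \int[m]_x f x.
    rewrite -(@Rint_image _ _ _ _ _ m (distribution m c') c)//.
      by apply: eq_Rintegral => x _; rewrite /F /c mxE.
    exact: continuous_borel_measurable.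
  by rewrite -!im (trigpoly_determine trig cF bF).
have ray (r : R) : m1 `[r, +oo[%classic = m2 `[r, +oo[%classic.
  (* This function is continuous, equal to 1 from [r] on and below 1 before it, so that its powers
     decrease to the indicator of the half-line. *)
  pose w x : R := (1 + (`|r - x| + (r - x)))^-1.
  have u0 x : 0 <= `|r - x| + (r - x) by rewrite -lerBlDr sub0r -normrN ler_norm.
  have w01 x : 0 <= w x <= 1.
    by rewrite invr_ge0 addr_ge0//= invf_le1 ?lerDl// ltr_wpDr.
  have cw : continuous w.
    move=> x; apply: cvgV; first by rewrite gt_eqF// ltr_wpDr.
    have cB : r - z @[z --> x] --> r - x by apply: cvgB; [exact: cvg_cst|exact: cvg_id].
    apply: cvgD; first exact: cvg_cst.
    by apply: cvgD; [exact: cvg_norm|].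
  have lim (m : probability RR R) :
      \int[m]_x (w x ^+ k) @[k --> \oo] --> \int[m]_x (\1_(`[r, +oo[%classic) x : R).
    apply: (dominated_cvgR (m := m) (f_ := fun k x => w x ^+ k) (g := cst 1)).
    - move=> k; apply: measurable_funX; exact: continuous_measurable_fun.
    - move=> x; rewrite indicE; case: (boolP (x \in _)) => [|/negP].
        rewrite inE /= in_itv/= andbT => rx.
        rewrite (_ : (fun k => _) = cst 1); first exact: cvg_cst.
        apply/funext => k; rewrite /w ler0_norm ?subr_le0// addNr addr0 invr1.
        by rewrite expr1n.
      rewrite inE /= in_itv/= andbT => /negP; rewrite -ltNge => xr.
      have w1 : `|w x| < 1.
        rewrite ger0_norm; last by case/andP: (w01 x).
        have p1 : 0 < 1 + (`|r - x| + (r - x)) by rewrite ltr_wpDr.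
        rewrite (invf_lt1 p1) ltrDl gtr0_norm ?subr_gt0//.
        by rewrite addr_gt0 ?subr_gt0.
      exact: cvg_expr.
    - exact: L1_cst.
    - move=> k x; have /andP[w0 w1] := w01 x.
      by rewrite normrX ger0_norm// exprn_ile1.
  have eqk k : \int[m1]_x (w x ^+ k) = \int[m2]_x (w x ^+ k).
    apply: (cont (fun x => w x ^+ k) 1) => x; last first.
      by have /andP[w0 w1] := w01 x; rewrite normrX ger0_norm// exprn_ile1.
    by apply: (@continuous_comp _ _ _ w (fun y => y ^+ k)); [exact: cw|exact: exprn_continuous].
  have := lim m1; rewrite (_ : (fun k => _) = (fun k => \int[m2]_x (w x ^+ k))); last exact/funext.
  move=> /(cvg_lim (@Rhausdorff R)); rewrite (cvg_lim (@Rhausdorff R) (lim m2)).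
  rewrite !Rint_indic ?measurable_itv// => e.
  by rewrite -[LHS](@EFin_fine_prob _ _ _ m1)// -e EFin_fine_prob.
apply: (@measure_unique _ R RR (@RGenCInfty.G R) (fun k => `[- k%:R, +oo[%classic)).
- exact: RGenCInfty.measurableE.
- move=> _ _ [x ->] [y ->]; exists (Num.max x y).
  by apply/seteqP; split=> z /=; rewrite !in_itv/= !andbT ge_max => /andP.
- by move=> k; exists (- k%:R).
- rewrite -subTset => x _; exists (Num.truncn `|x|).+1 => //=.
  rewrite in_itv/= andbT lerNl; apply/ltW.
  by apply: le_lt_trans (truncnS_gt _); rewrite -normrN ler_norm.
- by move=> _ [x ->]; exact: ray.
- by move=> k; apply: le_lt_trans (probability_le1 _ _) (ltry _) => //; exact: measurable_itv.
Qed.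

End laws_on_the_line.

Section cholesky.
Context {R : realType}.

Let quad_block m (x a : R) (u b : 'cV[R]_m) (W : 'M[R]_m) :
  (((col_mx x%:M u)^T : 'rV[R]_(1 + m)) *m block_mx a%:M b^T b W *m col_mx x%:M u) ord0 ord0 =
  a * x ^+ 2 + 2 * x * (u^T *m b) ord0 ord0 + (u^T *m W *m u) ord0 ord0.
Proof.
rewrite tr_col_mx tr_scalar_mx mul_row_block mul_row_col mulmxDl mulmxDl.
rewrite !mul_scalar_mx !mul_mx_scalar -scalemxAl.
have -> : b^T *m u = u^T *m b.
  by rewrite -[LHS]trmxK trmx_mul trmxK [u^T *m b]mx11_scalar tr_scalar_mx.
by rewrite !mxE !eqxx !mulr1n; ring.
Qed.

(** Cholesky factorization by Schur complements, arranged to include singular [V]: the limit law may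
    be degenerate. *)
Lemma psd_factor m (V : 'M[R]_m) : psdmx V -> exists A : 'M[R]_m, V = A *m A^T.
Proof.
elim: m V => [V _|m IH]; first by exists 0; rewrite [LHS]flatmx0 [RHS]flatmx0.
rewrite -[m.+1]/(1 + m)%N => V [sV pV].
have [a [b [W VE]]] : exists a b W, V = block_mx (a%:M : 'M[R]_1) b^T b W.
  exists (ulsubmx V ord0 ord0), (dlsubmx V), (drsubmx V).
  by rewrite -mx11_scalar trmx_dlsub sV submxK.
have q (x : R) (u : 'cV[R]_m) : 0 <= a * x ^+ 2 + 2 * x * (u^T *m b) ord0 ord0 + (u^T *m W *m u) ord0 ord0.
  by have := pV (col_mx x%:M u); rewrite VE quad_block.
have a0 : 0 <= a by have := q 1 0; rewrite trmx0 !mul0mx !mxE; lra.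
have sW : W^T = W.
  by have := sV; rewrite VE tr_block_mx => /eq_block_mx[].
pose s := Num.sqrt a; pose c := s^-1 *: b.
have bE : b = s *: c.
  have [s0|s0] := eqVneq s 0; last by rewrite scalerA divff// scale1r.
  have aE : a = 0 by apply/eqP; rewrite eq_le a0 andbT -sqrtr_eq0 -/s s0 eqxx.
  have b0 : b = 0.
    pose w := (b^T *m W *m b) ord0 ord0; pose n := (b^T *m b) ord0 ord0.
    have n0 : 0 <= n by rewrite /n mxE; apply: sumr_ge0 => i _; rewrite mxE -expr2 sqr_ge0.
    have n1 : n = 0.
      apply/eqP; rewrite eq_le n0 andbT leNgt; apply/negP => np.
      (* With corner entry 0 the form is affine in its first argument, and this argument would give
         it the value -1 if [b] were not 0. *)
      have := q (- (w + 1) / (2 * n)) b; rewrite aE -/n -/w.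
      have -> : 2 * (- (w + 1) / (2 * n)) * n = - (w + 1) by field; rewrite gt_eqF.
      by lra.
    apply/colP => i; rewrite mxE; apply/eqP.
    move: n1; rewrite /n mxE => /eqP; rewrite psumr_eq0; last first.
      by move=> j _; rewrite mxE -expr2 sqr_ge0.
    by move=> /allP /(_ i (mem_index_enum _)); rewrite mxE -expr2 sqrf_eq0.
  by rewrite /c b0 !scaler0.
have psdW : psdmx (W - c *m c^T).
  split=> [|u].
    by rewrite linearB /= sW trmx_mul trmxK.
  pose k := (u^T *m c) ord0 ord0.
  have -> : (u^T *m (W - c *m c^T) *m u) ord0 ord0 = (u^T *m W *m u) ord0 ord0 - k ^+ 2.
    rewrite mulmxBr mulmxBl [u^T *m (c *m _)]mulmxA -[u^T *m c *m _ *m u]mulmxA.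
    have -> : c^T *m u = u^T *m c.
      by rewrite -[LHS]trmxK trmx_mul trmxK [u^T *m c]mx11_scalar tr_scalar_mx.
    rewrite mxE [X in _ + X]mxE; congr (_ - _).
    by rewrite mxE big_ord1 expr2.
  have bk : (u^T *m b) ord0 ord0 = s * k by rewrite bE -scalemxAr mxE.
  have aE : a = s ^+ 2 by rewrite sqr_sqrtr.
  have [s0|s0] := eqVneq s 0.
    by have := q 0 u; rewrite /k /c s0 invr0 scale0r mulmx0 !mxE; lra.
  (* Minimizing over the first coordinate turns the form of [V] into that of the Schur
     complement. *)
  have := q (- k / s) u; rewrite bk aE.
  have -> : s ^+ 2 * (- k / s) ^+ 2 + 2 * (- k / s) * (s * k) = - k ^+ 2 by field.
  by rewrite addrC.
have [A AE] := IH _ psdW.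
exists (block_mx (s%:M : 'M[R]_1) 0 c A).
rewrite tr_block_mx mulmx_block VE tr_scalar_mx !trmx0 !mulmx0 !mul0mx !addr0.
rewrite -AE addrC subrK -scalar_mxM -expr2 sqr_sqrtr//.
by rewrite mul_scalar_mx mul_mx_scalar bE linearZ.
Qed.

End cholesky.

Section gaussian.
Context {R : realType}.
Local Notation RR := (measurableTypeR R).
Let nu : probability RR R := normal_prob 0 1.

Lemma iid_normal_cos m (c : 'I_m -> R) b :
  \int[iid nu m]_u cos (b + \sum_j c j * tnth u j) =
  expR (- ((\sum_j c j ^+ 2) / 2)) * cos b.
Proof.
have msum n (c' : 'I_n -> R) :
    measurable_fun [set: n.-tuple RR] (fun u => \sum_j c' j * tnth u j).
  apply: measurable_sum => j; apply: measurable_funM => //.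
  exact: measurable_tnth.
elim: m c b => [c b|m IH c b].
  under eq_Rintegral do rewrite big_ord0 addr0.
  by rewrite Rint_cst big_ord0 mul0r oppr0 expR0 mul1r.
pose F (u : m.+1.-tuple RR) := 1 + cos (b + \sum_j c j * tnth u j).
have LF n (P : probability (n.-tuple RR) R) (c' : 'I_n -> R) b' :
    L1 P (fun u => cos (b' + \sum_j c' j * tnth u j)).
  by apply: L1_cos; exact: msum.
have : \int[iid nu m.+1]_u F u = 1 + \int[iid nu m.+1]_u cos (b + \sum_j c j * tnth u j).
  by rewrite RintD ?Rint_cst//; exact: L1_cst.
rewrite (@Rint_iidS _ _ _ _ _ _ 2); last first.
- move=> u; rewrite /F.
  by have := cos_le1 (b + \sum_j c j * tnth u j); have := cos_geN1 (b + \sum_j c j * tnth u j);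
    move: (cos _) => C *; apply/andP; split; lra.
- by apply: measurable_funD => //; apply: measurable_cosD; exact: msum.
set S := \sum_(j < m) c (lift ord0 j) ^+ 2.
have e (z : RR) : \int[iid nu m]_t F (cons_sample (z, t)) =
    1 + expR (- (S / 2)) * cos (b + c ord0 * z).
  rewrite -(IH (fun j => c (lift ord0 j))) -[X in X + _](Rint_cst (P := iid nu m)).
  rewrite -RintD; [|exact: L1_cst|exact: LF].
  apply: eq_Rintegral => t _; rewrite /F big_ord_recl tnth0 addrA.
  by congr (1 + cos (_ + _)); apply: eq_bigr => j _; rewrite tnthS.
under eq_Rintegral do rewrite e.
have Lc : L1 nu (fun z => cos (b + c ord0 * z)) by apply: L1_cos.
rewrite RintD; [|exact: L1_cst|exact: L1Z].
rewrite Rint_cst RintZ// => /addrI <-.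
rewrite Rint_normal_cos// big_ord_recl -/S mulrA -expRD; congr (expR _ * _).
by rewrite expr1n; field.
Qed.

Section pushforward.
Variables (p : nat) (A : 'M[R]_p).

Definition gauss_map (y : p.-tuple RR) : borel 'cV[R]_p :=
  \col_i \sum_j A i j * tnth y j.

Lemma measurable_gauss_map : measurable_fun [set: _] gauss_map.
Proof.
apply: measurable_borel_of_coord => i.
rewrite (_ : (fun y => _) = (fun y => \sum_j A i j * tnth y j)).
  apply: measurable_sum => j; apply: measurable_funM => //.
  exact: measurable_tnth.
by apply/funext => y; rewrite mxE.
Qed.

Lemma dot_gauss_map a y : dot a (gauss_map y) = \sum_j (A^T *m a) j ord0 * tnth y j.
Proof.
rewrite /dot; under eq_bigr do rewrite mxE mulr_sumr.
rewrite exchange_big /=; apply: eq_bigr => j _.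
rewrite mxE mulr_suml; apply: eq_bigr => i _.
by rewrite mxE; ring.
Qed.
End pushforward.

(** Each linear image of [L] has the cosine moments of a normal law on the line, or of the Dirac
    mass when its variance is 0, and these moments determine it. *)
Lemma gaussian_cos_unique p (V : 'M[R]_p) (L : probability (borel 'cV[R]_p) R) :
  psdmx V ->
  (forall b a, \int[L]_x cos (b + dot a x) =
    expR (- ((a^T *m V *m a) ord0 ord0 / 2)) * cos b) ->
  centered_gaussian V L.
Proof.
move=> [_ pV] hL a A mA; set v := (a^T *m V *m a) ord0 ord0.
have v0 : 0 <= v by exact: pV.
have md : measurable_fun [set: borel 'cV[R]_p] (dot a : borel 'cV[R]_p -> RR).
  apply: measurable_sum => i; apply: measurable_funM => //.
  exact: borel_coord_measurable.
pose d : {mfun borel 'cV[R]_p >-> RR} := mfun_Sub (mem_set md).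
have dL b t : \int[distribution L d]_x cos (b + t * x) = expR (- (t ^+ 2 * v / 2)) * cos b.
  rewrite -(@Rint_image _ _ _ _ _ L (distribution L d) (dot a))//; last exact: measurable_cosD.
  transitivity (\int[L]_x cos (b + dot (t *: a) x)).
    apply: eq_Rintegral => x _; congr (cos (_ + _)).
    by rewrite /dot mulr_sumr; apply: eq_bigr => i _; rewrite mxE mulrA.
  rewrite hL; congr (expR (- (_ / 2)) * _).
  by rewrite [(t *: a)^T]linearZ /= -!scalemxAl -scalemxAr mxE [X in _ * X]mxE -/v mulrA expr2.
have -> : [set x : 'cV[R]_p | A ((a^T *m x) ord0 ord0)] = dot a @^-1` A.
  by apply/seteqP; split=> x /=; rewrite dotE.
rewrite /normal_law; case: ifPn => [/eqP v00|vn0].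
  pose m2 : probability RR R := \d_(0 : RR).
  rewrite -[RHS]/(m2 A); apply: (@cos_determine _ (distribution L d) m2) => // b t.
  rewrite dL v00 mulr0 mul0r oppr0 expR0 mul1r.
  rewrite /Rintegral integral_dirac ?diracT ?mul1e//= ?mulr0 ?addr0//.
  by apply/measurable_EFinP; exact: measurable_cosD.
have sv : 0 < Num.sqrt v by rewrite sqrtr_gt0 lt_def vn0.
pose m2 : probability RR R := normal_prob 0 (Num.sqrt v).
rewrite -[RHS]/(m2 A); apply: (@cos_determine _ (distribution L d) m2) => // b t.
by rewrite dL Rint_normal_cos// sqr_sqrtr// [v * _]mulrC.
Qed.

(** [L] is the image of independent standard normal variables under a factor of [V]. Its cosine
    moments are recorded too, being what the convergence criterion consumes. *)
Lemma gaussian_exists p (V : 'M[R]_p) : psdmx V ->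
  exists2 L : probability (borel 'cV[R]_p) R, centered_gaussian V L &
    forall b a, \int[L]_x cos (b + dot a x) =
      expR (- ((a^T *m V *m a) ord0 ord0 / 2)) * cos b.
Proof.
move=> pV; have [A VE] := psd_factor pV.
have mA := measurable_gauss_map A.
pose h : {mfun p.-tuple RR >-> borel 'cV[R]_p} := mfun_Sub (mem_set mA).
have trig b a : \int[distribution (iid nu p) h]_x cos (b + dot a x) =
    expR (- ((a^T *m V *m a) ord0 ord0 / 2)) * cos b.
  rewrite -(@Rint_image _ _ _ _ _ (iid nu p) (distribution (iid nu p) h) (gauss_map A))//.
    under eq_Rintegral do rewrite dot_gauss_map.
    rewrite iid_normal_cos VE; congr (expR (- (_ / 2)) * _).
    rewrite mulmxA -mulmxA mxE; apply: eq_bigr => j _.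
    by rewrite expr2; congr (_ * _); rewrite -[a^T *m A]trmxK trmx_mul trmxK [RHS]mxE.
  exact: continuous_borel_measurable (trigpoly_continuous (trigpoly_cos _ _)).
exists (distribution (iid nu p) h) => //.
exact: gaussian_cos_unique.
Qed.
End gaussian.

(** * Limits along submodels *)

Section second_moments.
Context {d : measure_display} {T : measurableType d} {R : realType} {m : nat}.
Variables (P : probability T R) (f : T -> 'cV[R]_m).
Hypothesis f2 : forall i, L2 P (fun z => f z i ord0).

Lemma L2_dot a : L2 P (fun z => dot a (f z)).
Proof. by apply: L2_sum => i; exact: L2Z. Qed.

Lemma Rint_dot a : \int[P]_z dot a (f z) = \sum_i a i ord0 * \int[P]_z f z i ord0.
Proof.
rewrite /dot Rint_sum => [|i]; last exact/L1Z/L2_L1_prob.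
by apply: eq_bigr => i _; rewrite RintZ//; exact: L2_L1_prob.
Qed.

Lemma VarmxE i j : Varmx P f i j =
  \int[P]_z (f z i ord0 * f z j ord0) -
  \int[P]_z f z i ord0 * \int[P]_z f z j ord0.
Proof.
rewrite mxE covarianceE; last first.
- by apply/Lfun1_integrable; exact: L1M_L2.
- by apply/Lfun1_integrable; exact: L2_L1_prob.
- by apply/Lfun1_integrable; exact: L2_L1_prob.
have E (g : T -> R) : L1 P g -> ('E_P[g])%E = (\int[P]_z g z)%:E.
  by move=> Lg; rewrite unlock EFin_Rint.
rewrite !E//; try exact: L2_L1_prob.
exact: L1M_L2.
Qed.

Lemma Varmx_quad a : (a^T *m Varmx P f *m a) ord0 ord0 =
  \int[P]_z (dot a (f z) ^+ 2) - (\int[P]_z dot a (f z)) ^+ 2.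
Proof.
have -> : \int[P]_z (dot a (f z) ^+ 2) =
    \sum_i \sum_j a i ord0 * a j ord0 * \int[P]_z (f z i ord0 * f z j ord0).
  have L i j : L1 P (fun z => f z i ord0 * f z j ord0) by exact: L1M_L2.
  transitivity (\int[P]_z \sum_i \sum_j a i ord0 * a j ord0 * (f z i ord0 * f z j ord0)).
    apply: eq_Rintegral => z _; rewrite expr2 /dot mulr_suml; apply: eq_bigr => i _.
    by rewrite mulr_sumr; apply: eq_bigr => j _; ring.
  rewrite Rint_sum => [|i]; last by apply: L1_sum => j; exact: L1Z.
  apply: eq_bigr => i _; rewrite Rint_sum => [|j]; last exact: L1Z.
  by apply: eq_bigr => j _; rewrite RintZ.
rewrite Rint_dot expr2 mulr_suml -sumrB.
rewrite -mulmxA mxE; apply: eq_bigr => i _.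
rewrite !mxE mulr_sumr mulr_sumr -sumrB; apply: eq_bigr => j _.
by rewrite VarmxE; ring.
Qed.

Lemma Varmx_psd : psdmx (Varmx P f).
Proof.
split=> [|a]; first by apply/matrixP => i j; rewrite mxE !VarmxE; congr (_ - _);
  rewrite 1?mulrC//; apply: eq_Rintegral => z _; rewrite mulrC.
rewrite Varmx_quad subr_ge0.
have := Rint_cauchy_schwarz (L2_dot a) (L2_cst 1 (probability_fin (P := P))).
rewrite (_ : (fun x => dot a (f x) * cst 1 x) = (fun x => dot a (f x))); last first.
  by apply/funext => x; rewrite mulr1.
by rewrite (_ : (fun x => cst 1 x ^+ 2) = (fun=> 1)) ?Rint_cst ?mulr1//;
  apply/funext => x; rewrite expr1n.
Qed.
End second_moments.

Section first_marginal.
Context {dx dy : measure_display} {X : measurableType dx}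
  {Y : measurableType dy} {R : realType}.
Variables (PX : probability X R) (K : R.-pker X ~> Y)
  (P : probability (X * Y)%type R).
Hypothesis PXK : is_joint PX K P.

Lemma is_joint_fst A : measurable A -> P (fst @^-1` A) = PX A.
Proof.
move=> mA; rewrite PXK; last first.
  by rewrite -[X in measurable X]setTI; exact: measurable_fst.
rewrite -[A in RHS]setIT -integral_indic//; apply: eq_integral => x _.
rewrite indicE; case: (boolP (x \in A)) => xA.
  rewrite (_ : xsection _ x = setT) ?prob_kernel//.
  by apply/seteqP; split=> // y _; rewrite /xsection /= inE /=; exact: set_mem.
rewrite (_ : xsection _ x = set0) ?measure0//.
by rewrite -subset0 => y; rewrite /xsection /= inE /= => /mem_set; rewrite (negbTE xA).
Qed.

Lemma L2_fst (k : X -> R) : L2 PX k -> L2 P (fun z => k z.1).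
Proof. exact: (L2_image measurable_fst is_joint_fst). Qed.

Lemma L2_of_fst (k : X -> R) : measurable_fun [set: X] k ->
  L2 P (fun z => k z.1) -> L2 PX k.
Proof.
move=> mk [_ Lk]; split=> //.
rewrite (_ : (fun x => _) = (fun x => k (id x) ^+ 2 * 1)); last first.
  by apply/funext => x; rewrite mulr1.
have sets A : measurable A ->
    (\int[PX]_(x in id @^-1` A) (1 : R)%:E = \int[P]_(z in fst @^-1` A) (1 : R)%:E)%E.
  move=> mA; rewrite !integral_cst//=; first by rewrite is_joint_fst.
  by rewrite -[X in measurable X]setTI; exact: measurable_fst.
have Lk1 : L1 P (fun z => k z.1 ^+ 2 * 1).
  by rewrite (_ : (fun z => _) = (fun z => k z.1 ^+ 2))//; apply/funext => z; rewrite mulr1.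
have mk2 : measurable_fun [set: X] (fun x => k x ^+ 2) by exact: measurable_funX.
have := @L1_transfer _ _ _ _ _ _ _ PX P id fst (fun=> 1) (fun=> 1) _ _ _ _ _ _ sets
  (fun x => k x ^+ 2) mk2 Lk1.
by apply => //; exact: measurable_fst.
Qed.

Lemma Rint_fst (k : X -> R) : measurable_fun [set: X] k ->
  \int[P]_z k z.1 = \int[PX]_x k x.
Proof. exact: (Rint_image measurable_fst is_joint_fst). Qed.

End first_marginal.

Section dqm_sequences.
Context {d : measure_display} {Z : measurableType d} {R : realType}.
Variables (mu : {measure set Z -> \bar R}) (T : set R) (t0 : R)
  (P : R -> probability Z R).
Hypotheses (nT : nbhs t0 T) (dqmP : dqm mu T t0 P).

(* The finitely many parameters outside [T] are replaced by [t0], so that every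
   member of the sequence has a density. *)
Definition local_parameter (h : R) n : R :=
  if `[< T (t0 + h / Num.sqrt n%:R) >] then t0 + h / Num.sqrt n%:R else t0.

Lemma local_parameter_near h :
  \forall n \near \oo, local_parameter h n = t0 + h / Num.sqrt n%:R.
Proof.
have cv : t0 + h / Num.sqrt n%:R @[n --> \oo] --> t0.
  rewrite -[X in _ --> X]addr0 -(mulr0 h); apply: cvgD; first exact: cvg_cst.
  by apply: cvgMr; exact: cvg_invsqrtn.
have : \forall n \near \oo, T (t0 + h / Num.sqrt n%:R) by exact: cv nT.
by apply: filterS => n Tn; rewrite /local_parameter asboolT.
Qed.

Lemma local_parameter_in h n : T (local_parameter h n).
Proof.
by rewrite /local_parameter; case: ifPn => [/asboolP//|_]; exact: nbhs_singleton.
Qed.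

(** For infinite [x] both sides are 0 by the default value of [fine], so rescaling the integrals
    calls for no integrability. *)
Let fine_scale (c : R) (x : \bar R) : 0 < c -> fine (c%:E * x)%E = c * fine x.
Proof.
by move=> c0; case: x => [r| |] //=; rewrite ?gt0_muley ?gt0_muleNy ?lte_fin//= mulr0.
Qed.

Lemma dqm_qm : exists (f : R -> Z -> R) (s : Z -> R),
  [/\ forall t, T t -> is_density mu (P t) (f t), L2 (P t0) s &
   forall h, \int[mu]_z (qm_remainder (f t0) (fun n => f (local_parameter h n))
      (fun z => h * s z) n z ^+ 2) @[n --> \oo] --> (0 : R)].
Proof.
case: dqmP => f [s [df /Lfun2P s2 lim]]; exists f, s; split=> // h.
(* The limit in quadratic mean is taken along a punctured neighbourhood of [t0], so the constant
   sequence is settled apart; its remainder is identically 0. *)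
have [->|h0] := eqVneq h 0.
  rewrite (_ : (fun n => _) = (fun=> 0)); first exact: cvg_cst.
  apply/funext => n; rewrite (_ : (fun z => _) = (fun=> 0)); last first.
    apply/funext => z; rewrite /qm_remainder /local_parameter /= !mul0r addr0 if_same.
    by rewrite !subrr mulr0 ?mul0r subrr expr0n.
  by rewrite /Rintegral integral0.
pose t n := t0 + h / Num.sqrt n%:R.
have tt0 : \forall n \near \oo, t n != t0.
  exists 1%N => // n /= n0; rewrite /t addrC -subr_eq0 addrK mulf_neq0//.
  by rewrite invr_eq0 sqrtr_eq0 -ltNge ltr0n.
have ht : t n @[n --> \oo] --> t0^'.
  have cv : t n @[n --> \oo] --> t0.
    rewrite -[X in _ --> X]addr0 -(mulr0 h); apply: cvgD; first exact: cvg_cst.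
    by apply: cvgMr; exact: cvg_invsqrtn.
  move=> A At; have : \forall n \near \oo, t n != t0 -> A (t n) by exact: cv At.
  by apply: filterS2 tt0 => n tn; exact.
have /fine_cvgP[_] := cvg_comp _ _ ht lim.
set G := (G in fine \o G) => cG.
have {}cG : h ^+ 2 * fine (G n) @[n --> \oo] --> (0 : R).
  by rewrite -[X in _ --> X](mulr0 (h ^+ 2)); apply: cvgMr; exact: cG.
apply: cvg_trans cG; apply: near_eq_cvg.
have n1 : \forall n \near \oo, (0 < n)%N by exists 1%N.
apply: filterS3 n1 tt0 (local_parameter_near h) => n n0 tn lp /=.
have c0 : 0 < ((t n - t0) ^+ 2)^-1 by rewrite invr_gt0 exprn_even_gt0//= subr_eq0.
rewrite /G /= fine_scale// mulrA.
have cE : h ^+ 2 * ((t n - t0) ^+ 2)^-1 = n%:R.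
  rewrite /t [t0 + _]addrC addrK exprMn exprVn sqr_sqrtr// invfM invrK mulrA divff ?mul1r//.
  by rewrite expf_neq0.
rewrite cE /qm_remainder lp -/(t n) -fine_scale ?ltr0n//.
have [mf0 _ _] := df _ (nbhs_singleton nT).
have [mfn _ _] := df _ (local_parameter_in h n); rewrite lp -/(t n) in mfn.
have msq (k : Z -> R) : measurable_fun [set: Z] k -> measurable_fun [set: Z] (fun z => Num.sqrt (k z)).
  by move=> mk; apply: measurableT_comp mk; apply: continuous_measurable_fun; exact: sqrt_continuous.
rewrite -ge0_integralZl_EFin//; last first.
- apply/measurable_EFinP; apply: measurable_funX; apply: measurable_funB.
    by apply: measurable_funB; exact: msq.
  apply: measurable_funM; last exact: msq.
  by apply: measurable_funM => //; exact: s2.1.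
- by move=> z _; rewrite lee_fin sqr_ge0.
congr fine; apply: eq_integral => z _; rewrite -EFinM; congr _%:E.
have nE : n%:R = Num.sqrt n%:R ^+ 2 :> R by rewrite sqr_sqrtr.
have s1 : Num.sqrt n%:R != 0 :> R by rewrite gt_eqF// sqrtr_gt0 ltr0n.
rewrite {1}nE -exprMn; congr (_ ^+ 2).
rewrite /t [t0 + _]addrC addrK; move: (Num.sqrt n%:R) s1 => r r0.
by field.
Qed.

End dqm_sequences.

Lemma Rint_gt0 {d} {T : measurableType d} {R : realType} (P : probability T R)
  (f : T -> R) : L1 P f -> (forall x, 0 < f x) -> 0 < \int[P]_x f x.
Proof.
move=> Lf f0; rewrite lt_neqAle Rint_ge0 ?andbT => [|x]; last exact: ltW.
apply/eqP => I0.
have : (\int[P]_x `|(f x)%:E| = 0)%E.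
  transitivity (\int[P]_x (f x)%:E)%E; last by rewrite EFin_Rint// -I0.
  by apply: eq_integral => x _; rewrite gee0_abs// lee_fin ltW.
move=> /ae_eq_integral_abs.
have mf : measurable_fun [set: T] (EFin \o f) by apply/measurable_EFinP; exact: L1_measurable Lf.
move=> /(_ measurableT mf) [N [mN N0 sub]].
have NT : N = setT.
  by rewrite -subTset => x _; apply: sub => /= /(_ I) [fx]; have := f0 x; rewrite fx ltxx.
move: N0; rewrite NT => /eqP; have /= -> := probability_setT P.
by rewrite onee_eq0.
Qed.

Lemma cvg_in_distribution_near {d} {Z : measurableType d} {R : realType}
    {S : ptopologicalType}
    (Q Q' : forall n, probability (n.-tuple Z) R) (U U' : forall n, n.-tuple Z -> S)
    (G : probability (borel S) R) :
  (\forall n \near \oo, Q n = Q' n /\ @U n =1 @U' n) ->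
  cvg_in_distribution Q U G -> cvg_in_distribution Q' U' G.
Proof.
move=> near QU f' cf bf; apply: cvg_trans (QU f' cf bf); apply: near_eq_cvg.
apply: filterS near => n [-> UU]; congr outer_expectation.
by apply/funext => z /=; rewrite UU.
Qed.

(** * Detecting a deterministic shift between two centrings of one statistic *)

Section limit_shift.
Context {d : measure_display} {Z : measurableType d} {R : realType} {p : nat}.
Variables (Q : forall n, probability (n.-tuple Z) R)
  (U W : forall n, n.-tuple Z -> 'cV[R]_p) (delta : nat -> 'cV[R]_p)
  (G : probability (borel 'cV[R]_p) R).
Hypotheses (UW : forall n z, @U n z = @W n z + delta n)
  (UG : cvg_in_distribution Q U G) (WG : cvg_in_distribution Q W G).

(* Testing both limits against the strictly increasing bounded function atan of
   a coordinate detects a shift. *)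
Lemma cvg_in_distribution_shift i : delta n i ord0 @[n --> \oo] --> (0 : R).
Proof.
have side (s e : R) : 0 < e -> \forall n \near \oo, s * delta n i ord0 < e.
  move=> e0; pose f (c : R) (x : 'cV[R]_p) := atan (s * x i ord0 + c).
  have cf c : continuous (f c).
    have ca (r : R) : atan (s * y + c) @[y --> r] --> atan (s * r + c).
      have cl : continuous (fun y : R => s * y + c).
        by move=> y; apply: cvgD; [apply: cvgM; [exact: cvg_cst|exact: cvg_id]|exact: cvg_cst].
      by apply: continuous_comp; [exact: cl|exact: continuous_atan].
    move=> x; apply: (@continuous_comp _ _ _ (fun x : 'cV[R]_p => x i ord0)
      (fun r => atan (s * r + c))); [exact: coord_continuous|exact: ca].
  have fb c x : `|f c x| <= pi.
    rewrite ler_norml; have := atan_gtNpi2 (s * x i ord0 + c).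
    have := atan_ltpi2 (s * x i ord0 + c); have := @pi_gt0 R.
    by rewrite /f; move: (atan (s * x i ord0 + c)) pi => A q *; apply/andP; split; lra.
  have bf c : bounded_fun (f c).
    exists pi; split; first exact: num_real.
    by move=> M CM x _; apply: le_trans (fb _ _) (ltW CM).
  have Lf c := bounded_continuous_L1 G (cf c) (fb c).
  have gap : \int[G]_x f 0 x < \int[G]_x f e x.
    rewrite -subr_gt0 -RintB//; apply: Rint_gt0; first exact: L1B.
    by move=> x; rewrite subr_gt0 /f; apply: lt_atan; rewrite addr0 ltrDl.
  have lim V c : cvg_in_distribution Q V G ->
      \forall n \near \oo, outer_expectation (Q n) (f c \o V n) \is a fin_num /\
        `|\int[G]_x f c x - fine (outer_expectation (Q n) (f c \o V n))| <
          (\int[G]_x f e x - \int[G]_x f 0 x) / 2.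
    move=> /(_ _ (cf c) (bf c)); rewrite EFin_Rint// => /fine_cvgP[fin].
    move=> /cvgrPdist_lt /(_ ((\int[G]_x f e x - \int[G]_x f 0 x) / 2)).
    rewrite divr_gt0 ?subr_gt0// => /(_ isT); exact: filterS2 fin.
  apply: filterS2 (lim (@U) 0 UG) (lim (@W) e WG) => n [finU dU] [finW dW].
  (* Were the shift at least [e], then [f e] along [W] would lie pointwise below [f 0] along [U];
     monotonicity of the outer expectation contradicts the gap between the two limits. *)
  rewrite ltNge; apply/negP => h.
  have : (outer_expectation (Q n) (f e \o @W n) <= outer_expectation (Q n) (f 0%R \o @U n))%E.
    apply: outer_expectation_mono => z; rewrite /f /= UW mxE; apply: le_atan.
    by rewrite addr0 mulrDr lerD2l.
  rewrite -(fineK finU) -(fineK finW) lee_fin.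
  have arith (a b a' b' : R) : a < b -> `|a - a'| < (b - a) / 2 ->
      `|b - b'| < (b - a) / 2 -> a' < b'.
    by rewrite !ltr_norml => _ /andP[h1 h2] /andP[h3 h4]; lra.
  by rewrite leNgt (arith _ _ _ _ gap dU dW).
apply/cvgrPdist_lt => e e0.
apply: filterS2 (side 1 e e0) (side (-1) e e0) => n; rewrite mul1r mulN1r => h1 h2.
by rewrite sub0r normrN ltr_norml h1 ltrNl h2.
Qed.
End limit_shift.

Section local_asymptotics.
Context {d : measure_display} {Z : measurableType d} {R : realType}.
Variables (mu : {measure set Z -> \bar R}) (P0 : probability Z R)
  (P : nat -> probability Z R) (f0 : Z -> R) (f : nat -> Z -> R) (s : Z -> R).
Hypotheses (dP0 : is_density mu P0 f0) (dP : forall n, is_density mu (P n) (f n))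
  (s2 : L2 P0 s).
Hypothesis qm : \int[mu]_z (qm_remainder f0 f s n z ^+ 2)
  @[n --> \oo] --> (0 : R).
Let Q n := iid (P n) n.
Let Q0 n := iid P0 n.

Let contiguous_bound (e : R) : 0 < e -> exists2 e' : R, 0 < e' &
  \forall n \near \oo, forall A : set (n.-tuple Z), measurable A ->
    fine (Q0 n A) <= e' -> fine (Q n A) <= e.
Proof.
move=> e0; have e2 : 0 < e / 2 by rewrite divr_gt0.
have [C C0 h] := contiguity dP0 dP s2 qm e2.
(* The square inverts the root in the bound of [contiguity]. *)
exists ((e / 2 / C) ^+ 2); first by rewrite exprn_gt0// divr_gt0.
apply: filterS h => n h A mA Ae; apply: (le_trans (h A mA)).
rewrite [leRHS]splitr lerD2l.
have : Num.sqrt (fine (Q0 n A)) <= e / 2 / C.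
  by rewrite -[leRHS]ger0_norm -?sqrtr_sqr ?ler_sqrt ?sqr_ge0// ltW// divr_gt0.
by rewrite ler_pdivlMr// mulrC.
Qed.

Lemma vanishing_contiguous A : vanishing Q0 A -> vanishing Q A.
Proof.
move=> vA e e0; have [e' e'0 h] := contiguous_bound e0.
by apply: filterS2 h (vA _ e'0) => n h [B [mB AB] Be]; exists B => //; exact: h.
Qed.

Lemma opn_contiguous W : opn Q0 W -> opn Q W.
Proof. by move=> oW e e0; apply: vanishing_contiguous; exact: oW. Qed.

Lemma Opn_contiguous W : Opn Q0 W -> Opn Q W.
Proof.
move=> OW e e0; have [e' e'0 h] := contiguous_bound e0.
have [K OK] := OW _ e'0; exists K.
by apply: filterS2 h OK => n h [B [mB AB] Be]; exists B => //; exact: h.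
Qed.

Section vector.
Variables (p : nat) (psi : Z -> 'cV[R]_p) (G : probability (borel 'cV[R]_p) R).
Hypotheses (psi2 : forall i, L2 P0 (fun z => psi z i ord0))
  (psi0 : forall i, \int[P0]_z psi z i ord0 = 0)
  (trigG : forall b a, \int[G]_x cos (b + dot a x) =
     expR (- ((a^T *m Varmx P0 psi *m a) ord0 ord0 / 2)) * cos b).

(** The expansion of [T] is known under [P0] only; contiguity carries it to [P n]. Centring by any
    [c] with the drift as its limit leaves a law free of the score. *)
Lemma local_gaussian (T : forall n, n.-tuple Z -> 'cV[R]_p) (c : nat -> 'cV[R]_p) :
  (forall i, opn Q0 (fun n u => T n u i ord0 -
     \sum_(j < n) psi (tnth u j) i ord0 / Num.sqrt n%:R)) ->
  (forall i, c n i ord0 @[n --> \oo] --> \int[P0]_z (psi z i ord0 * s z)) ->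
  cvg_in_distribution Q (fun n u => T n u - c n) G.
Proof.
move=> TS cm; pose m i := \int[P0]_z (psi z i ord0 * s z).
pose S n (u : n.-tuple Z) : 'cV[R]_p :=
  \col_i (\sum_(j < n) psi (tnth u j) i ord0 / Num.sqrt n%:R - m i).
have dot0 a : \int[P0]_z dot a (psi z) = 0.
  by rewrite Rint_dot// big1// => i _; rewrite psi0 mulr0.
have Lps i : L1 P0 (fun z => psi z i ord0 * s z) by exact: L1M_L2.
have dots a : \int[P0]_z (dot a (psi z) * s z) = \sum_i a i ord0 * m i.
  transitivity (\int[P0]_z \sum_i a i ord0 * (psi z i ord0 * s z)).
    apply: eq_Rintegral => z _; rewrite /dot mulr_suml.
    by apply: eq_bigr => i _; rewrite mulrA.
  rewrite Rint_sum => [|i]; last exact: L1Z.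
  by apply: eq_bigr => i _; rewrite RintZ.
apply: (@cvg_in_distribution_trig _ _ _ _ Q S).
- move=> n i; rewrite (_ : (fun z => _) = (fun u =>
      \sum_(j < n) psi (tnth u j) i ord0 / Num.sqrt n%:R - m i)).
    apply: measurable_funB => //.
    apply: (measurable_iid_sum (f := fun z => psi z i ord0 / Num.sqrt n%:R)).
    by apply: measurable_funM => //; exact: (psi2 i).1.
  by apply/funext => u; rewrite mxE.
- move=> b a; rewrite trigG Varmx_quad// dot0 expr0n subr0.
  have := local_clt (b := b - \sum_i a i ord0 * m i) (L2_dot psi2 a) (dot0 a) dP0 dP s2 qm.
  rewrite dots subrK; apply: cvg_trans; apply: near_eq_cvg; apply: nearW => n.
  apply: eq_Rintegral => u _; congr cos; rewrite -addrA; congr (_ + _).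
  rewrite /dot; under [in RHS]eq_bigr do rewrite mxE mulrBr mulr_sumr.
  rewrite sumrB addrC; congr (_ - _); rewrite exchange_big /=; apply: eq_bigr => j _.
  by rewrite mulr_suml; apply: eq_bigr => i _; rewrite mulrA.
- move=> i; apply: (@Opn_le _ _ _ Q _ (fun n u => \sum_(j < n) psi (tnth u j) i ord0 / Num.sqrt n%:R + (- m i))).
    by move=> n u; rewrite mxE.
  apply: OpnD; last exact: Opn_cst.
  by apply: Opn_contiguous; exact: (Opn_clt_sum (psi2 i) (psi0 i)).
- move=> i; apply: (@opn_le _ _ _ Q _ (fun n u => (T n u i ord0 -
      \sum_(j < n) psi (tnth u j) i ord0 / Num.sqrt n%:R) + (m i - c n i ord0))).
    by move=> n u; rewrite !mxE le_eqVlt; apply/orP; left; apply/eqP; congr (`|_|); ring.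
  apply: opnD; first exact: opn_contiguous.
  move=> e e0 e' e'0; have /cvgrPdist_le /(_ e e0) near := cm i.
  apply: filterS near => n h; exists set0; last by rewrite measure0 ltW.
  by split=> // u /=; rewrite ltNge h.
Qed.
End vector.

End local_asymptotics.

(** * Conditional expectations and variances *)

Section conditional_expectation.
Context {d d' : measure_display} {T : measurableType d} {X : measurableType d'}
  {R : realType}.
Variables (P : probability T R) (x_ : T -> X) (f : T -> R) (k : X -> R).
Hypotheses (mx : measurable_fun [set: T] x_) (f2 : L2 P f)
  (mk : measurable_fun [set: X] k) (Lk : L1 P (fun z => k (x_ z)))
  (ce : forall A, measurable A ->
    (\int[P]_(z in x_ @^-1` A) (k (x_ z))%:E = \int[P]_(z in x_ @^-1` A) (f z)%:E)%E).
Let Lf : L1 P f := L2_L1_prob f2.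

(** Regarded as weights, the conditional expectation and [f] have the same integrals over preimages
    under [x_]. Adding the common function [N] makes both nonnegative, as the change of variables
    requires. *)
Lemma cond_exp_bounded (h : X -> R) (C : R) : measurable_fun [set: X] h ->
  (forall x, `|h x| <= C) ->
  \int[P]_z (h (x_ z) * k (x_ z)) = \int[P]_z (h (x_ z) * f z).
Proof.
move=> mh hC.
pose N z := `|f z| + `|k (x_ z)|.
have LN : L1 P N by apply: L1D; exact: L1_norm.
have Lb (g : T -> R) : L1 P g -> L1 P (fun z => h (x_ z) * g z).
  move=> Lg; apply: (@L1_le _ _ _ _ _ (fun z => C * `|g z|)).
  - apply: measurable_funM; last exact: L1_measurable Lg.
    exact: measurableT_comp.
  - by move=> z; rewrite normrM ler_wpM2r.
  - by apply: L1Z; exact: L1_norm.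
have split_ (g : T -> R) : L1 P g ->
    \int[P]_z (h (x_ z) * (g z + N z)) =
    \int[P]_z (h (x_ z) * g z) + \int[P]_z (h (x_ z) * N z).
  move=> Lg; rewrite -RintD; [|exact: Lb|exact: Lb].
  by apply: eq_Rintegral => z _; rewrite mulrDr.
apply: (addIr (\int[P]_z (h (x_ z) * N z))); rewrite -!split_//.
have aux (a : R) : 0 <= a + `|a| by have := ler_norm (- a); rewrite normrN; lra.
apply: (@Rint_transfer _ _ _ _ _ _ _ P P x_ x_ (fun z => k (x_ z) + N z)
  (fun z => f z + N z)) => //.
- apply: measurable_funD; [exact: L1_measurable Lk|exact: L1_measurable LN].
- apply: measurable_funD; [exact: L1_measurable Lf|exact: L1_measurable LN].
- by move=> z; rewrite /N addrCA addr_ge0.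
- by move=> z; rewrite /N addrA addr_ge0.
- move=> A mA.
  have mA' : measurable (x_ @^-1` A) by rewrite -[X in measurable X]setTI; exact: mx.
  have sub (g : T -> R) : L1 P g -> P.-integrable (x_ @^-1` A) (EFin \o g).
    by apply: integrableS.
  under eq_integral do rewrite EFinD.
  under [RHS]eq_integral do rewrite EFinD.
  by rewrite !integralD//; try exact: sub; rewrite ce.
Qed.

(* Tested against the truncations of [k], Cauchy-Schwarz bounds their second
   moments by that of [f]. *)
Lemma cond_exp_L2 : L2 P (fun z => k (x_ z)).
Proof.
split; first exact: measurableT_comp.
pose A (M : nat) : set X := [set x | `|k x| <= M%:R].
have mA M : measurable (A M).
  rewrite -[X in measurable X]setTI; apply: measurable_fun_le => //.
  exact: measurableT_comp.
pose h M x := \1_(A M) x * k x : R.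
have hM M x : `|h M x| <= M%:R.
  rewrite /h indicE; case: (boolP (x \in A M)) => [|_].
    by rewrite inE mul1r.
  by rewrite mul0r normr0.
have mh M : measurable_fun [set: X] (h M).
  by apply: measurable_funM => //; exact: measurable_indic.
have h2 M : L2 P (fun z => h M (x_ z)).
  split; first exact: measurableT_comp.
  apply: (L1_bounded_prob (C := M%:R ^+ 2)).
    by apply: measurable_funX; exact: measurableT_comp.
  by move=> z; rewrite normrX lerXn2r ?nnegrE.
have bound M : \int[P]_z (h M (x_ z) ^+ 2) <= \int[P]_z (f z ^+ 2).
  set I := \int[P]_z (h M (x_ z) ^+ 2).
  have E : I = \int[P]_z (h M (x_ z) * f z).
    rewrite -(cond_exp_bounded (mh M) (hM M)); apply: eq_Rintegral => z _.
    by rewrite /h indicE; case: (_ \in _); rewrite ?mul1r ?mul0r ?expr2 ?mul0r.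
  have := Rint_cauchy_schwarz (h2 M) f2; rewrite -E -/I => cs.
  have I0 : 0 <= I by apply: Rint_ge0 => z; exact: sqr_ge0.
  have [->|In0] := eqVneq I 0; first by apply: Rint_ge0 => z; exact: sqr_ge0.
  by rewrite -(ler_pM2l (x := I)) ?lt_def ?In0// -expr2.
apply/integrableP; split.
  by apply/measurable_EFinP; apply: measurable_funX; exact: measurableT_comp.
have hsqE M x : h M x ^+ 2 = if `|k x| <= M%:R then k x ^+ 2 else 0.
  rewrite /h indicE; case: ifPn => kM; first by rewrite mem_set ?mul1r.
  by rewrite memNset ?mul0r ?expr0n//; exact/negP.
have lim : (\int[P]_z (h M (x_ z) ^+ 2)%:E)%E @[M --> \oo] -->
    (\int[P]_z (k (x_ z) ^+ 2)%:E)%E.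
  rewrite (_ : (\int[P]_z (k (x_ z) ^+ 2)%:E)%E =
      (\int[P]_z limn (fun M => (h M (x_ z) ^+ 2)%:E))%E); last first.
    apply: eq_integral => z _; apply/esym/cvg_lim => //.
    apply: cvg_near_cst; exists (Num.truncn `|k (x_ z)|).+1 => // M /= lM.
    rewrite hsqE (le_trans (ltW (truncnS_gt _)))// ler_nat//.
  apply: (@cvg_monotone_convergence _ _ _ P setT measurableT (fun M z => (h M (x_ z) ^+ 2)%:E)).
  - by move=> M; apply/measurable_EFinP; exact: L1_measurable (h2 M).2.
  - by move=> M z _; rewrite lee_fin sqr_ge0.
  - move=> z _ M M' MM; rewrite lee_fin !hsqE.
    case: ifPn => [kM|_]; last by case: ifP => _ //; exact: sqr_ge0.
    by rewrite (le_trans kM)// ler_nat.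
apply: (@le_lt_trans _ _ (\int[P]_z (f z ^+ 2))%:E); last exact: ltry.
rewrite (_ : (\int[P]_z _)%E = (\int[P]_z (k (x_ z) ^+ 2)%:E)%E); last first.
  by apply: eq_integral => z _; rewrite gee0_abs// lee_fin sqr_ge0.
rewrite -(cvg_lim _ lim)//; apply: lime_le; first by apply/cvg_ex; eexists; exact: lim.
by apply: nearW => M; rewrite EFin_Rint ?lee_fin//; exact: (h2 M).2.
Qed.

(** Truncations of [h] fall under the bounded case; dominated convergence applies because the
    product with the residual is integrable, both factors being square integrable. *)
Lemma cond_exp_orthogonal (h : X -> R) : L2 P (fun z => h (x_ z)) ->
  measurable_fun [set: X] h ->
  \int[P]_z (h (x_ z) * (f z - k (x_ z))) = 0.
Proof.
move=> h2 mh; pose D z := f z - k (x_ z).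
have D2 : L2 P D by apply: L2B => //; exact: cond_exp_L2.
have LhD := L1M_L2 h2 D2.
pose t (M : nat) x := \1_[set x | `|h x| <= M%:R] x * h x : R.
have tE M x : t M x = if `|h x| <= M%:R then h x else 0.
  rewrite /t indicE; case: ifPn => kM; first by rewrite mem_set ?mul1r.
  by rewrite memNset ?mul0r//; exact/negP.
have mt M : measurable_fun [set: X] (t M).
  apply: measurable_funM => //; apply: measurable_indic.
  rewrite -[X in measurable X]setTI; apply: measurable_fun_le => //.
  exact: measurableT_comp.
have t0 M : \int[P]_z (t M (x_ z) * D z) = 0.
  have tM x : `|t M x| <= M%:R by rewrite tE; case: ifP => // _; rewrite normr0.
  have Lt (g : T -> R) : L1 P g -> L1 P (fun z => t M (x_ z) * g z).
    move=> Lg; apply: (@L1_le _ _ _ _ _ (fun z => M%:R * `|g z|)).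
    - by apply: measurable_funM; [exact: measurableT_comp|exact: L1_measurable Lg].
    - by move=> z; rewrite normrM ler_wpM2r.
    - by apply: L1Z; exact: L1_norm.
  transitivity (\int[P]_z (t M (x_ z) * f z - t M (x_ z) * k (x_ z))).
    by apply: eq_Rintegral => z _; rewrite mulrBr.
  by rewrite RintB ?(cond_exp_bounded (mt M) tM) ?subrr//; exact: Lt.
have lim : \int[P]_z (t M (x_ z) * D z) @[M --> \oo] --> \int[P]_z (h (x_ z) * D z).
  apply: (dominated_cvgR (f_ := fun M z => t M (x_ z) * D z) (g := fun z => `|h (x_ z) * D z|)).
  - by move=> M; apply: measurable_funM; [exact: measurableT_comp|exact: D2.1].
  - move=> z; apply: cvg_near_cst; exists (Num.truncn `|h (x_ z)|).+1 => // M lM.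
    change (t M (x_ z) * D z = h (x_ z) * D z).
    by rewrite tE (le_trans (ltW (truncnS_gt _)))// ler_nat.
  - exact: L1_norm.
  - move=> M z; rewrite normrM [leRHS]normrM ler_wpM2r//.
    by rewrite tE; case: ifP => // _; rewrite normr0.
rewrite -(cvg_lim (@Rhausdorff R) lim); under eq_fun do rewrite t0.
exact: lim_cst.
Qed.
End conditional_expectation.

Section variance_decomposition.
Context {dx dy : measure_display} {X : measurableType dx}
  {Y : measurableType dy} {R : realType} {p : nat}.
Variables (PX : probability X R) (K : R.-pker X ~> Y)
  (P : probability (X * Y)%type R).
Hypothesis PXK : is_joint PX K P.

(** The matrix form of Pythagoras. It serves twice: with the residual of the projection on [g0], and
    with the residual of the conditional expectation. *)
Lemma Varmx_decompose (F D : X * Y -> 'cV[R]_p) (E : X -> 'cV[R]_p) :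
  (forall z, F z = D z + E z.1) ->
  (forall i, L2 P (fun z => D z i ord0)) ->
  (forall i, L2 PX (fun x => E x i ord0)) ->
  (forall i, \int[P]_z D z i ord0 = 0) ->
  (forall i j, \int[P]_z (E z.1 i ord0 * D z j ord0) = 0) ->
  Varmx P F = Varmx P D + Varmx PX E.
Proof.
move=> FE D2 E2 D0 DE0.
have E2' i : L2 P (fun z => E z.1 i ord0) := L2_fst PXK (E2 i).
have F2 i : L2 P (fun z => F z i ord0).
  rewrite (_ : (fun z => _) = (fun z => D z i ord0 + E z.1 i ord0)); first exact: L2D.
  by apply/funext => z; rewrite FE mxE.
have mE i : measurable_fun [set: X] (fun x => E x i ord0) by exact: (E2 i).1.
apply/matrixP => i j; rewrite [RHS]mxE !VarmxE// !D0 mul0r subr0.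
rewrite -!(Rint_fst PXK)//; last exact: measurable_funM.
have FI k : \int[P]_z F z k ord0 = \int[P]_z E z.1 k ord0.
  transitivity (\int[P]_z (D z k ord0 + E z.1 k ord0)).
    by apply: eq_Rintegral => z _; rewrite FE mxE.
  by rewrite RintD ?D0 ?add0r//; exact: L2_L1_prob.
rewrite !FI addrA; congr (_ - _).
transitivity (\int[P]_z ((D z i ord0 * D z j ord0 + E z.1 i ord0 * E z.1 j ord0) +
    (E z.1 i ord0 * D z j ord0 + E z.1 j ord0 * D z i ord0))).
  by apply: eq_Rintegral => z _; rewrite !FE !mxE; ring.
have L a b : L2 P a -> L2 P b -> L1 P (fun z => a z * b z) by exact: L1M_L2.
rewrite RintD; [|by apply: L1D; exact: L|by apply: L1D; exact: L].
rewrite RintD; [|exact: L|exact: L]; rewrite [X in _ + X]RintD; [|exact: L|exact: L].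
by rewrite !DE0 !addr0.
Qed.

End variance_decomposition.

(** * The safe estimator *)

Section euclidean_norm.
Context {R : realType} {m : nat}.

Lemma coord_le_enorm (v : 'cV[R]_m) i : `|v i ord0| <= enorm v.
Proof.
rewrite -sqrtr_sqr ler_sqrt; last by apply: sumr_ge0 => j _; exact: sqr_ge0.
by rewrite (bigD1 i)//= lerDl sumr_ge0// => j _; exact: sqr_ge0.
Qed.

Lemma enorm_le_sum (v : 'cV[R]_m) : enorm v <= \sum_i `|v i ord0|.
Proof.
have s0 (r : seq 'I_m) : 0 <= \sum_(i <- r) `|v i ord0| by apply: sumr_ge0.
rewrite -[leRHS]ger0_norm// -sqrtr_sqr ler_sqrt ?sqr_ge0//.
elim: (index_enum _) => [|i r IH]; first by rewrite !big_nil expr0n.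
rewrite !big_cons sqrrD real_normK ?num_real// -addrA lerD2l.
by apply: (le_trans IH); rewrite lerDr mulrn_wge0// mulr_ge0.
Qed.

Lemma enorm_ge0 (v : 'cV[R]_m) : 0 <= enorm v. Proof. exact: sqrtr_ge0. Qed.

Lemma sqrtr_nat_invr n : Num.sqrt n%:R * n%:R^-1 = (Num.sqrt n%:R)^-1 :> R.
Proof.
have [->|n0] := eqVneq n 0%N; first by rewrite sqrtr0 mul0r invr0.
have s0 : Num.sqrt n%:R != 0 :> R by rewrite gt_eqF// sqrtr_gt0 ltr0n lt0n.
by rewrite -[n%:R in X in _ * X]sqr_sqrtr// expr2 invfM mulrA divff// mul1r.
Qed.

End euclidean_norm.

Section safe_estimator_limits.
Context {R : realType} {dx dy : measure_display}
  {X : measurableType dx} {Y : measurableType dy} {p d : nat}.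
Variables (PX : probability X R) (K : R.-pker X ~> Y)
  (P : probability (X * Y)%type R).
Hypothesis PXK : is_joint PX K P.
Variables (Omega : metricType R) (eta0 : Omega) (phi : Omega -> X * Y -> 'cV[R]_p)
  (theta0 : 'cV[R]_p) (thetahat : forall n, n.-tuple (X * Y)%type -> 'cV[R]_p)
  (etatilde : forall n, n.-tuple (X * Y)%type -> Omega).
Hypothesis lin : asymptotically_linear P (@thetahat) theta0 (phi eta0).
Variables (O : set Omega) (L : X * Y -> R).
Hypotheses (O0 : O eta0) (L0 : forall z, 0 <= L z) (L_Lfun : L \in Lfun P 2%:E)
  (lip : forall e1 e2, O e1 -> O e2 -> forall z,
     enorm (phi e1 z - phi e2 z) <= L z * mdist e1 e2)
  (eta_O : inner_probability (iid P n) [set z | O (@etatilde n z)]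
     @[n --> \oo] --> 1%E)
  (eta_cvg : o_p1 P (fun n z => mdist (@etatilde n z) eta0)).
Variable g : X -> 'cV[R]_d.
Hypotheses (g_Lfun : square_integrable PX g) (Vg : Varmx PX g \in unitmx).

Let f := phi eta0.
Let g0 := centered PX g.
Let B := Bg PX g P f.
Let infl z := f z - B *m g0 z.1.
Let thetasafe := theta_safe PX g phi (@thetahat) (@etatilde).

Let L2f i : L2 P (fun z => f z i ord0).
Proof. by case: lin => h _ _; exact/Lfun2P/h. Qed.

Let f_mean0 i : \int[P]_z f z i ord0 = 0.
Proof.
by case: lin => _ /matrixP /(_ i ord0) h _; move: h; rewrite !mxE expectation_Rint.
Qed.

Let L2g i : L2 PX (fun x => g x i ord0). Proof. exact/Lfun2P/g_Lfun. Qed.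

Let g0E x i : g0 x i ord0 = g x i ord0 - \int[PX]_x g x i ord0.
Proof. by rewrite !mxE expectation_Rint. Qed.

Let L2g0 i : L2 PX (fun x => g0 x i ord0).
Proof.
rewrite (_ : (fun x => _) = (fun x => g x i ord0 - \int[PX]_x g x i ord0)).
  by apply: L2B => //; apply: L2_cst; exact: probability_fin.
by apply/funext => x; rewrite g0E.
Qed.

Let g0_mean0 i : \int[PX]_x g0 x i ord0 = 0.
Proof.
transitivity (\int[PX]_x (g x i ord0 - \int[PX]_x g x i ord0)).
  by apply: eq_Rintegral => x _; rewrite g0E.
by rewrite RintB ?Rint_cst ?subrr//; [exact: L2_L1_prob|exact: L1_cst].
Qed.

Let L2g0P i : L2 P (fun z => g0 z.1 i ord0) := L2_fst PXK (L2g0 i).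

Let g0P_mean0 i : \int[P]_z g0 z.1 i ord0 = 0.
Proof.
by rewrite (Rint_fst PXK (k := fun x => g0 x i ord0))//; exact: (L2g0 i).1.
Qed.

(** This turns the assumption on the variance of [g] into invertibility of the matrix inverted in
    [B]. *)
Let gramE : gram PX g = Varmx PX g.
Proof.
have L1M (i j : 'I_d) : L1 PX (fun x => g0 x i ord0 * g0 x j ord0) by exact: L1M_L2.
apply/matrixP => i j; rewrite mxE expectation_Rint.
transitivity (\int[PX]_x (g0 x i ord0 * g0 x j ord0)).
  by apply: eq_Rintegral => x _; rewrite mxE big_ord1 [X in _ * X]mxE.
rewrite VarmxE//.
transitivity (\int[PX]_x (g x i ord0 * g x j ord0 - \int[PX]_x g x i ord0 * g x j ord0 -
    \int[PX]_x g x j ord0 * g0 x i ord0)).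
  by apply: eq_Rintegral => x _; rewrite !g0E; ring.
have L1g k : L1 PX (fun x => g x k ord0) by exact: L2_L1_prob.
have Lgg : L1 PX (fun x => g x i ord0 * g x j ord0) by exact: L1M_L2.
rewrite RintB; [|by apply: L1B => //; exact: L1Z|by apply: L1Z; exact: L2_L1_prob].
rewrite RintB//; last exact: L1Z.
by rewrite !RintZ ?g0_mean0 ?mulr0 ?subr0//; exact: L2_L1_prob.
Qed.

Let Lfg i k : L1 P (fun z => f z i ord0 * g0 z.1 k ord0).
Proof. exact: L1M_L2. Qed.

Let Rint_fg i k : \int[P]_z (f z i ord0 * g0 z.1 k ord0) =
  Emx P (fun z => f z *m (g0 z.1)^T) i k.
Proof.
rewrite mxE expectation_Rint; apply: eq_Rintegral => z _.
by rewrite [RHS]mxE big_ord1 [X in _ = _ * X]mxE.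
Qed.

Lemma infl_coordE z i :
  infl z i ord0 = f z i ord0 - \sum_j B i j * g0 z.1 j ord0.
Proof. by rewrite !mxE. Qed.

Let L2Bg i : L2 PX (fun x => (B *m g0 x) i ord0).
Proof.
rewrite (_ : (fun x => _) = (fun x => \sum_j B i j * g0 x j ord0)).
  by apply: L2_sum => j; exact: L2Z.
by apply/funext => x; rewrite mxE.
Qed.

Lemma L2_infl i : L2 P (fun z => infl z i ord0).
Proof.
rewrite (_ : (fun z => _) = (fun z => f z i ord0 - (B *m g0 z.1) i ord0)).
  by apply: L2B => //; exact: (L2_fst PXK (L2Bg i)).
by apply/funext => z; rewrite infl_coordE [in RHS]mxE.
Qed.

Lemma infl_mean0 i : \int[P]_z infl z i ord0 = 0.
Proof.
transitivity (\int[P]_z (f z i ord0 - \sum_j B i j * g0 z.1 j ord0)).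
  by apply: eq_Rintegral => z _; rewrite infl_coordE.
have Lg j : L1 P (fun z => B i j * g0 z.1 j ord0) by apply: L1Z; exact: L2_L1_prob.
rewrite RintB; [|exact: L2_L1_prob|exact: L1_sum].
rewrite f_mean0 Rint_sum// big1 ?subrr// => j _.
by rewrite RintZ ?g0P_mean0 ?mulr0//; exact: L2_L1_prob.
Qed.

(* [B] is the matrix of the orthogonal projection of [f] on the span of [g0]. *)
Lemma infl_orthogonal i k : \int[P]_z (g0 z.1 k ord0 * infl z i ord0) = 0.
Proof.
have Lgg j : L1 P (fun z => g0 z.1 j ord0 * g0 z.1 k ord0) by exact: L1M_L2.
transitivity (\int[P]_z (f z i ord0 * g0 z.1 k ord0 -
    \sum_j B i j * (g0 z.1 j ord0 * g0 z.1 k ord0))).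
  apply: eq_Rintegral => z _; rewrite infl_coordE mulrBr [X in X - _]mulrC; congr (_ - _).
  by rewrite mulr_sumr; apply: eq_bigr => j _; ring.
rewrite RintB//; last by apply: L1_sum => j; exact: L1Z.
rewrite Rint_sum => [|j]; last exact: L1Z.
rewrite Rint_fg -[Emx _ _](@mulmxKV _ _ _ (gram PX g)); last by rewrite gramE.
rewrite mxE; apply/eqP; rewrite subr_eq0; apply/eqP; apply: eq_bigr => j _.
rewrite RintZ// ; congr (_ * _).
rewrite mxE expectation_Rint.
rewrite (Rint_fst PXK (k := fun x => g0 x j ord0 * g0 x k ord0)); last first.
  by apply: measurable_funM; [exact: (L2g0 j).1|exact: (L2g0 k).1].
by apply: eq_Rintegral => x _; rewrite [LHS]mxE big_ord1 [X in _ * X = _]mxE.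
Qed.

(** The difference of the two matrices is itself a variance, that of the removed part
    [B *m g0 x]. *)
Lemma safe_loewner : loewner_le (Varmx P infl) (Varmx P f).
Proof.
have -> : Varmx P f = Varmx P infl + Varmx PX (fun x => B *m g0 x).
  apply: (Varmx_decompose PXK).
  - by move=> z; rewrite subrK.
  - exact: L2_infl.
  - exact: L2Bg.
  - exact: infl_mean0.
  - move=> i j; transitivity (\int[P]_z \sum_k B i k * (g0 z.1 k ord0 * infl z j ord0)).
      apply: eq_Rintegral => z _; rewrite mxE mulr_suml.
      by apply: eq_bigr => k _; rewrite mulrA.
    have Lgi k : L1 P (fun z => g0 z.1 k ord0 * infl z j ord0).
      by apply: L1M_L2 => //; exact: L2_infl.
    rewrite Rint_sum => [|k]; last exact: L1Z.
    by rewrite big1// => k _; rewrite RintZ// infl_orthogonal mulr0.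
by rewrite /loewner_le addrC addKr; apply: Varmx_psd.
Qed.

Lemma safe_variance (phiX : X -> 'cV[R]_p) : is_cond_exp P f phiX ->
  Varmx P infl = Varmx P (fun z => f z - phiX z.1)
    + Varmx PX (fun x => phiX x - B *m g0 x).
Proof.
move=> ce.
have ceI i A : measurable A ->
    (\int[P]_(z in fst @^-1` A) (phiX z.1 i ord0)%:E =
     \int[P]_(z in fst @^-1` A) (f z i ord0)%:E)%E.
  move=> mA; have [_ _ /(_ A mA)] := ce i.
  by rewrite (_ : A `*` setT = fst @^-1` A)//; apply/seteqP; split=> z // [].
have L2c i : L2 P (fun z => phiX z.1 i ord0).
  have [m1 i1 _] := ce i.
  exact: (@cond_exp_L2 _ _ _ _ _ P fst (fun z => f z i ord0) (fun x => phiX x i ord0)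
    measurable_fst (L2f i) m1 i1 (ceI i)).
have L2cX i : L2 PX (fun x => phiX x i ord0).
  by have [m1 _ _] := ce i; exact: (L2_of_fst PXK m1 (L2c i)).
apply: (Varmx_decompose PXK).
- by move=> z; rewrite addrA subrK.
- move=> i; rewrite (_ : (fun z => _) = (fun z => f z i ord0 - phiX z.1 i ord0)).
    exact: L2B.
  by apply/funext => z; rewrite !mxE.
- move=> i; rewrite (_ : (fun z => _) = (fun x => phiX x i ord0 - (B *m g0 x) i ord0)).
    exact: L2B.
  by apply/funext => z; rewrite !mxE.
- move=> i; transitivity (\int[P]_z (1 * (f z i ord0 - phiX z.1 i ord0))).
    by apply: eq_Rintegral => z _; rewrite !mxE mul1r.
  have [m1 i1 _] := ce i.
  apply: (@cond_exp_orthogonal _ _ _ _ _ P fst (fun z => f z i ord0)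
    (fun x => phiX x i ord0) measurable_fst (L2f i) m1 i1 (ceI i) (cst 1)) => //.
  by apply: L2_cst; exact: probability_fin.
- move=> i j; transitivity (\int[P]_z ((phiX z.1 i ord0 - (B *m g0 z.1) i ord0) *
      (f z j ord0 - phiX z.1 j ord0))).
    by apply: eq_Rintegral => z _; rewrite !mxE.
  have [m1 i1 _] := ce j.
  apply: (@cond_exp_orthogonal _ _ _ _ _ P fst (fun z => f z j ord0)
    (fun x => phiX x j ord0) measurable_fst (L2f j) m1 i1 (ceI j)
    (fun x => phiX x i ord0 - (B *m g0 x) i ord0)) => //.
    by apply: L2B => //; exact: (L2_fst PXK (L2Bg i)).
  by apply: measurable_funB; [exact: (L2cX i).1|exact: (L2Bg i).1].
Qed.

Let Q0 n := iid P n.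

Let outside_O : vanishing Q0 (fun n => ~` [set z | O (@etatilde n z)]).
Proof.
apply/vanishingP.
pose u n := outer_probability (iid P n) (~` [set z | O (@etatilde n z)]).
have uE n : u n = (1 - inner_probability (iid P n) [set z | O (@etatilde n z)])%E.
  rewrite /inner_probability -/(u n).
  by case: (u n) => [r| |] //=; rewrite -!EFinB opprB addrC subrK.
have cv : (1 - inner_probability (iid P n) [set z | O (@etatilde n z)])%E
    @[n --> \oo] --> (1 - 1)%E.
  by apply: cvgeB => //; exact: cvg_cst.
by rewrite subee// in cv; apply: cvg_trans cv; apply: near_eq_cvg; apply: nearW => n; rewrite -uE.
Qed.

(** Off the event that [etatilde] leaves [O], the distance to [eta0] factors out of the sum and
    multiplies an average of [L] times [|g0|], which is bounded in probability. *)
Let plugin_error i k : opn Q0 (fun n z => n%:R^-1 *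
  \sum_(l < n) (phi (@etatilde n z) (tnth z l) - f (tnth z l)) i ord0 *
    g0 (tnth z l).1 k ord0).
Proof.
pose W n (z : n.-tuple (X * Y)) := n%:R^-1 *
  \sum_(l < n) (L (tnth z l) * `|g0 (tnth z l).1 k ord0|).
have LW : L1 P (fun z => L z * `|g0 z.1 k ord0|).
  by apply: L1M_L2; [exact/Lfun2P|exact/L2_norm/L2g0P].
have OW : Opn Q0 W by apply: Opn_opnD_cst; exact: weak_lln LW.
apply: (opn_ext outside_O _ (opnM_Opn (proj1 (o_p1P _ _) eta_cvg) OW)) => n z.
rewrite notK /= => Oz; rewrite mulrCA !normrM ler_wpM2l//.
have d0 : 0 <= mdist (@etatilde n z) eta0 by exact: mdist_ge0.
rewrite (ger0_norm d0) [X in _ <= _ * X]ger0_norm; last first.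
  by apply: sumr_ge0 => l _; exact: mulr_ge0.
apply: (le_trans (ler_norm_sum _ _ _)); rewrite mulr_sumr; apply: ler_sum => l _.
rewrite normrM mulrA ler_wpM2r//; apply: (le_trans (coord_le_enorm _ _)).
by rewrite mulrC; exact: lip.
Qed.

Let cross_moment i k : opn Q0 (fun n z => n%:R^-1 *
    \sum_(l < n) phi (@etatilde n z) (tnth z l) i ord0 * g0 (tnth z l).1 k ord0 -
  Emx P (fun z => f z *m (g0 z.1)^T) i k).
Proof.
have := opnD (plugin_error i k) (weak_lln (Lfg i k)); rewrite Rint_fg.
apply: opn_le => n z; rewrite le_eqVlt; apply/orP; left; apply/eqP; congr (`|_|).
rewrite addrA -mulrDr -big_split /=; congr (_ * _ - _); apply: eq_bigr => l _.
by rewrite -mulrDl !mxE subrK.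
Qed.

Let Bhat_error i j :
  opn Q0 (fun n z => Bhat PX g (phi (@etatilde n z)) z i j - B i j).
Proof.
have : opn Q0 (fun n z => \sum_k (n%:R^-1 * \sum_(l < n)
      phi (@etatilde n z) (tnth z l) i ord0 * g0 (tnth z l).1 k ord0 -
    Emx P (fun z => f z *m (g0 z.1)^T) i k) * invmx (gram PX g) k j).
  by apply: opn_sum => k; apply: opnZ; exact: cross_moment.
apply: opn_le => n z; rewrite le_eqVlt; apply/orP; left; apply/eqP; congr (`|_|).
rewrite [X in X - _]mxE [X in _ - X]mxE -sumrB; apply: eq_bigr => k _.
rewrite -mulrBl; congr ((_ - _) * _).
rewrite mxE; congr (_ * _); rewrite summxE; apply: eq_bigr => l _.
by rewrite mxE big_ord1 [X in _ * X = _]mxE.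
Qed.

Let safe_coordE n (z : n.-tuple (X * Y)) i :
  (Num.sqrt n%:R *: (@thetasafe n z - theta0)) i ord0 =
  (Num.sqrt n%:R *: (@thetahat n z - theta0)) i ord0 -
  \sum_j Bhat PX g (phi (@etatilde n z)) z i j *
    \sum_(l < n) g0 (tnth z l).1 j ord0 / Num.sqrt n%:R.
Proof.
set BH := Bhat PX g _ z.
have E : (n%:R^-1 *: \sum_(l < n) BH *m g0 (tnth z l).1) i ord0 =
    n%:R^-1 * \sum_j BH i j * \sum_(l < n) g0 (tnth z l).1 j ord0.
  rewrite mxE; congr (_ * _); rewrite summxE; under eq_bigr do rewrite mxE.
  by rewrite exchange_big /=; apply: eq_bigr => j _; rewrite mulr_sumr.
rewrite mxE [X in _ * X]mxE [X in _ * (X + _)]mxE.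
rewrite [X in _ * (_ + X + _)]mxE E [in RHS]mxE [X in _ = _ * X - _]mxE.
have -> : \sum_j BH i j * \sum_(l < n) g0 (tnth z l).1 j ord0 / Num.sqrt n%:R =
    (Num.sqrt n%:R)^-1 * \sum_j BH i j * \sum_(l < n) g0 (tnth z l).1 j ord0.
  rewrite mulr_sumr; apply: eq_bigr => j _; rewrite -mulr_suml; ring.
by rewrite -sqrtr_nat_invr; ring.
Qed.

Let hat_linear i : opn Q0 (fun n z =>
  (Num.sqrt n%:R *: (@thetahat n z - theta0)) i ord0 -
  \sum_(l < n) f (tnth z l) i ord0 / Num.sqrt n%:R).
Proof.
case: lin => _ _ /o_p1P; apply: opn_le => n z.
rewrite [leRHS]ger0_norm ?enorm_ge0//; apply: le_trans (coord_le_enorm _ i).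
rewrite le_eqVlt; apply/orP; left; apply/eqP; congr (`|_|).
rewrite [RHS]mxE; congr (_ + _); rewrite [RHS]mxE; congr (- _).
by rewrite [RHS]mxE summxE mulr_sumr; apply: eq_bigr => l _; rewrite mulrC.
Qed.

Lemma safe_linear i : opn Q0 (fun n z =>
  (Num.sqrt n%:R *: (@thetasafe n z - theta0)) i ord0 -
  \sum_(l < n) infl (tnth z l) i ord0 / Num.sqrt n%:R).
Proof.
(* Consistency of [Bhat] without a rate is enough, because the factor beside it is a normalized
   sum. *)
have corr : opn Q0 (fun n z => \sum_j (Bhat PX g (phi (@etatilde n z)) z i j - B i j) *
    \sum_(l < n) g0 (tnth z l).1 j ord0 / Num.sqrt n%:R).
  apply: opn_sum => j; apply: opnM_Opn; first exact: Bhat_error.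
  exact: (Opn_clt_sum (L2g0P j) (g0P_mean0 j)).
have := opnD (hat_linear i) (opnN corr); apply: opn_le => n z.
rewrite le_eqVlt; apply/orP; left; apply/eqP; congr (`|_|).
have inflE : \sum_(l < n) infl (tnth z l) i ord0 / Num.sqrt n%:R =
    \sum_(l < n) f (tnth z l) i ord0 / Num.sqrt n%:R -
    \sum_j B i j * \sum_(l < n) g0 (tnth z l).1 j ord0 / Num.sqrt n%:R.
  under eq_bigr do rewrite infl_coordE mulrBl mulr_suml.
  rewrite sumrB; congr (_ - _); rewrite exchange_big /=; apply: eq_bigr => j _.
  by rewrite mulr_sumr; apply: eq_bigr => l _; rewrite mulrA.
rewrite safe_coordE inflE.
have -> : \sum_j (Bhat PX g (phi (@etatilde n z)) z i j - B i j) *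
      \sum_(l < n) g0 (tnth z l).1 j ord0 / Num.sqrt n%:R =
    \sum_j Bhat PX g (phi (@etatilde n z)) z i j *
      \sum_(l < n) g0 (tnth z l).1 j ord0 / Num.sqrt n%:R -
    \sum_j B i j * \sum_(l < n) g0 (tnth z l).1 j ord0 / Num.sqrt n%:R.
  by rewrite -sumrB; apply: eq_bigr => j _; rewrite mulrBl.
by ring.
Qed.

Lemma safe_asymptotically_linear :
  asymptotically_linear P (@thetasafe) theta0 infl.
Proof.
split; first by move=> i; apply/Lfun2P; exact: L2_infl.
  by apply/matrixP => i j; rewrite !mxE expectation_Rint (ord1 j) infl_mean0.
apply/o_p1P.
have : opn Q0 (fun n z => \sum_i `|(Num.sqrt n%:R *: (@thetasafe n z - theta0)) i ord0 -
    \sum_(l < n) infl (tnth z l) i ord0 / Num.sqrt n%:R|).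
  by apply: opn_sum => i; apply: opn_le (safe_linear i) => n z; rewrite normr_id.
apply: opn_le => n z; rewrite ger0_norm ?enorm_ge0//.
apply: le_trans (enorm_le_sum _) _; rewrite ger0_norm ?sumr_ge0//.
rewrite le_eqVlt; apply/orP; left; apply/eqP; apply: eq_bigr => i _.
congr (`|_|); rewrite mxE; congr (_ + _); rewrite mxE; congr (- _).
by rewrite mxE summxE mulr_sumr; apply: eq_bigr => l _; rewrite mulrC.
Qed.

Lemma psd_infl : psdmx (Varmx P infl).
Proof. by apply: Varmx_psd; exact: L2_infl. Qed.

Lemma safe_asymptotic_variance :
  asymptotic_variance P (@thetasafe) theta0 (Varmx P infl).
Proof.
have [G gaussG trigG] := gaussian_exists psd_infl.
exists G => //.
(* The sequence of models constantly equal to [P] is a special case of the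
   local asymptotics. *)
have dP : is_density P P (fun=> 1).
  by split=> // A mA; rewrite integral_cst// mul1e.
have qm : \int[P]_z (qm_remainder (fun=> 1) (fun _ _ => 1) (fun=> 0) n z ^+ 2)
    @[n --> \oo] --> (0 : R).
  rewrite (_ : (fun n => _) = (fun=> 0)); first exact: cvg_cst.
  apply/funext => n; rewrite -[RHS](Rint_cst (P := P)); apply: eq_Rintegral => z _.
  by rewrite /qm_remainder subrr mulr0 !mul0r subr0 expr0n.
have := local_gaussian dP (fun _ => dP) (L2_cst 0 (probability_fin (P := P))) qm
  L2_infl infl_mean0 trigG safe_linear (c := fun=> 0).
move=> lim f' cf bf; have := lim _ f' cf bf.
rewrite (_ : (fun n => _) = (fun n => outer_expectation (iid P n) (f' \o
   (fun z => Num.sqrt n%:R *: (@thetasafe n z - theta0))))).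
  apply=> i; rewrite mxE.
  rewrite (_ : \int[P]_z _ = 0); first exact: cvg_cst.
  by rewrite -[RHS](Rint_cst (P := P)); apply: eq_Rintegral => z _; rewrite mulr0.
apply/funext => n; congr outer_expectation; apply/funext => z /=.
by rewrite subr0.
Qed.

(** Inclusion of [M'] in [M] makes every submodel of the smaller model one along which [thetahat] is
    regular; the common first marginal serves to make the score orthogonal to [g0]. *)
Lemma safe_regular (mu : {measure set (X * Y)%type -> \bar R})
    (M M' : set (probability (X * Y)%type R))
    (theta : probability (X * Y)%type R -> 'cV[R]_p) :
  theta P = theta0 -> M' `<=` M ->
  (forall P', M' P' -> forall A, measurable A -> P' (fst @^-1` A) = PX A) ->
  regular mu M P theta (@thetahat) -> regular mu M' P theta (@thetasafe).
Proof.
move=> thetaP MM marg reg T t0 Ps nT MT Pt0 dq.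
have [L' regL'] := reg T t0 Ps nT (fun t Tt => MM _ (MT t Tt)) Pt0 dq.
have [f_ [s [df s2 qm]]] := dqm_qm nT dq.
rewrite Pt0 in s2.
have dP0 : is_density mu P (f_ t0) by rewrite -Pt0; apply: df; exact: nbhs_singleton.
have [G _ trigG] := gaussian_exists psd_infl; exists G => h /=.
have [Gf _ trigGf] := gaussian_exists (Varmx_psd L2f).
pose P' h n := Ps (local_parameter T t0 h n).
have dP' k n : is_density mu (P' k n) (f_ (local_parameter T t0 k n)).
  by apply: df; exact: local_parameter_in.
have s2' k : L2 P (fun z => k * s z) by exact: L2Z.
have near k : \forall n \near \oo, P' k n = Ps (t0 + k / Num.sqrt n%:R).
  by apply: filterS (local_parameter_near nT k) => n; rewrite /P' => ->.
pose m k : 'cV[R]_p := \col_i \int[P]_z (f z i ord0 * (k * s z)).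
have hatA k : cvg_in_distribution (fun n => iid (P' k n) n)
    (fun n z => Num.sqrt n%:R *: (@thetahat n z - theta0) - m k) Gf.
  apply: (local_gaussian dP0 (dP' k) (s2' k) (qm k) L2f f_mean0 trigGf hat_linear).
  by move=> i; rewrite mxE; exact: cvg_cst.
have hatB k : cvg_in_distribution (fun n => iid (P' k n) n)
    (fun n z => Num.sqrt n%:R *: (@thetahat n z - theta (P' k n))) L'.
  apply: cvg_in_distribution_near (regL' k).
  by apply: filterS (near k) => n ->; split.
(* At [k = 0] the regular limit is the Gaussian law of the influence function. *)
have hatG k : cvg_in_distribution (fun n => iid (P' k n) n)
    (fun n z => Num.sqrt n%:R *: (@thetahat n z - theta (P' k n))) Gf.
  move=> f' cf bf.
  have P0E n : P' 0 n = P by rewrite /P' /local_parameter mul0r addr0 if_same Pt0.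
  have m0 : m 0 = 0.
    apply/matrixP => i j; rewrite !mxE -[RHS](Rint_cst (P := P)).
    by apply: eq_Rintegral => z _; rewrite mul0r mulr0.
  rewrite (_ : (\int[Gf]_x (f' x)%:E)%E = (\int[L']_x (f' x)%:E)%E); first exact: hatB.
  have A := hatA 0 f' cf bf; have := hatB 0 f' cf bf.
  rewrite (_ : (fun n => _) = (fun n => outer_expectation (iid (P' 0 n) n)
    (f' \o (fun z => Num.sqrt n%:R *: (@thetahat n z - theta0) - m 0)))); last first.
    apply/funext => n; congr outer_expectation; apply/funext => z /=.
    by rewrite P0E thetaP m0 subr0.
  by move=> /(cvg_lim (@ereal_hausdorff R)) <-; rewrite (cvg_lim (@ereal_hausdorff R) A).
(* [m k] is the drift of the linear expansion and [c k] the rescaled displacement of the parameter.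
   The statistic built from [thetahat] has the limit [Gf] under either centring, so their difference
   tends to 0. *)
pose c k n : 'cV[R]_p := Num.sqrt n%:R *: (theta (P' k n) - theta0).
have shift k i : (m k - c k n) i ord0 @[n --> \oo] --> (0 : R).
  apply: (cvg_in_distribution_shift _ (hatG k) (hatA k)) => n z.
  by rewrite addrA subrK /c -scalerBr opprB addrA subrK.
(* The laws of the submodel share their first marginal, so integrals of functions of [g0] do not
   change along it. *)
have g0s k : \int[P]_z (g0 z.1 k ord0 * (h * s z)) = 0.
  apply: (score_orthogonal (L2g0P k) (g0P_mean0 k) dP0 (dP' h) (s2' h) (qm h)) => n.
  have msin : measurable_fun [set: X] (fun x => sin (g0 x k ord0 / Num.sqrt n%:R)).
    apply: measurableT_comp; last by apply: measurable_funM => //; exact: (L2g0 k).1.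
    by apply: continuous_measurable_fun; exact: continuous_sin.
  have margh : forall A, measurable A -> P' h n (fst @^-1` A) = PX A.
    by apply: marg; apply: MT; exact: local_parameter_in.
  by rewrite (Rint_image measurable_fst margh msin) (Rint_fst PXK msin).
have m_infl i : \int[P]_z (infl z i ord0 * (h * s z)) = m h i ord0.
  have Lgs j : L1 P (fun z => g0 z.1 j ord0 * (h * s z)) by exact: L1M_L2.
  transitivity (\int[P]_z (f z i ord0 * (h * s z) -
      \sum_j B i j * (g0 z.1 j ord0 * (h * s z)))).
    apply: eq_Rintegral => z _; rewrite infl_coordE mulrBl; congr (_ - _).
    by rewrite mulr_suml; apply: eq_bigr => j _; rewrite mulrA.
  rewrite RintB; [|exact: L1M_L2|by apply: L1_sum => j; exact: L1Z].
  rewrite [in RHS]mxE Rint_sum => [|j]; last exact: L1Z.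
  by rewrite big1 ?subr0// => j _; rewrite RintZ// g0s mulr0.
(* Centring by [c h] is admissible since its limit [m h] is also the drift of [infl]; the law [G]
   was chosen before [h]. *)
have safeG : cvg_in_distribution (fun n => iid (P' h n) n)
    (fun n z => Num.sqrt n%:R *: (@thetasafe n z - theta0) - c h n) G.
  apply: (local_gaussian dP0 (dP' h) (s2' h) (qm h) L2_infl infl_mean0 trigG safe_linear) => i.
  rewrite m_infl; have := shift h i => shift_i.
  have cB : m h i ord0 - (m h - c h n) i ord0 @[n --> \oo] --> m h i ord0 - 0.
    by apply: cvgB; [exact: cvg_cst|exact: shift_i].
  rewrite subr0 in cB; apply: cvg_trans cB; apply: near_eq_cvg; apply: nearW => n.
  by rewrite [(m h - _) i ord0]mxE [(- c h n) i ord0]mxE opprB addrC subrK.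
apply: cvg_in_distribution_near safeG.
apply: filterS (near h) => n Pn; rewrite Pn; split=> // z.
by rewrite /c Pn -scalerBr opprB addrA subrK.
Qed.

End safe_estimator_limits.

Theorem theorem3p5 (R : realType) (dx dy : measure_display)
  (X : measurableType dx) (Y : measurableType dy) (p d : nat)
  (PXs : set (probability X R)) (PYXs : set (R.-pker X ~> Y))
  (mu : {sigma_finite_measure set (X * Y)%type -> \bar R})
  (hmu : forall P, model PXs PYXs P -> P `<< mu)
  (Theta : set 'cV[R]_p) (theta : probability (X * Y)%type R -> 'cV[R]_p)
  (htheta : forall P, model PXs PYXs P -> Theta (theta P))
  (Omega : metricType R) (eta : probability (X * Y)%type R -> Omega)
  (phi : Omega -> X * Y -> 'cV[R]_p)
  (PXstar : probability X R) (Kstar : R.-pker X ~> Y)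
  (Pstar : probability (X * Y)%type R)
  (hPX : PXs PXstar) (hK : PYXs Kstar) (hP : is_joint PXstar Kstar Pstar)
  (thetahat : forall n, n.-tuple (X * Y)%type -> 'cV[R]_p)
  (etatilde : forall n, n.-tuple (X * Y)%type -> Omega)
  (ha_reg : regular mu (model PXs PYXs) Pstar theta thetahat)
  (ha_lin : asymptotically_linear Pstar thetahat (theta Pstar)
              (phi (eta Pstar)))
  (O : set Omega) (hO : O (eta Pstar))
  (hb_donsker : vector_donsker Pstar (phi @` O))
  (L : X * Y -> R) (hL0 : forall z, 0 <= L z)
  (hL : L \in Lfun Pstar 2%:E)
  (hb_lip : forall e1 e2, O e1 -> O e2 -> forall z,
     enorm (phi e1 z - phi e2 z) <= L z * mdist e1 e2)
  (hc_O : inner_probability (iid Pstar n) [set z | O (etatilde n z)]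
            @[n --> \oo] --> 1%E)
  (hc_cvg : o_p1 Pstar (fun n z => mdist (etatilde n z) (eta Pstar)))
  (g : X -> 'cV[R]_d) (hg : square_integrable PXstar g)
  (hVg : Varmx PXstar g \in unitmx) :
  let thetasafe := theta_safe PXstar g phi thetahat etatilde in
  let B := Bg PXstar g Pstar (phi (eta Pstar)) in
  let g0 := centered PXstar g in
  let infl := fun z => phi (eta Pstar) z - B *m g0 z.1 in
  [/\ regular mu (model [set PXstar] PYXs) Pstar theta thetasafe,
      asymptotically_linear Pstar thetasafe (theta Pstar) infl,
      asymptotic_variance Pstar thetasafe (theta Pstar) (Varmx Pstar infl),
      forall phiX : X -> 'cV[R]_p, is_cond_exp Pstar (phi (eta Pstar)) phiX ->
        Varmx Pstar infl =
          Varmx Pstar (fun z => phi (eta Pstar) z - phiX z.1)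
          + Varmx PXstar (fun x => phiX x - B *m g0 x) &
      loewner_le (Varmx Pstar infl) (Varmx Pstar (phi (eta Pstar)))].
Proof.
move=> thetasafe B g0 infl.
have marg P' : model [set PXstar] PYXs P' ->
    forall A, measurable A -> P' (fst @^-1` A) = PXstar A.
  by move=> [PX' [K [-> _ PK]]] A mA; exact: (is_joint_fst PK).
split.
- apply: (safe_regular hP ha_lin hO hL0 hL hb_lip hc_O hc_cvg hg erefl _ marg ha_reg).
  by move=> P' [PX' [K [-> KK PK]]]; exists PXstar, K.
- exact: (safe_asymptotically_linear hP ha_lin hO hL0 hL hb_lip hc_O hc_cvg hg).
- exact: (safe_asymptotic_variance hP ha_lin hO hL0 hL hb_lip hc_O hc_cvg hg).
- by move=> phiX; exact: (safe_variance hP ha_lin hg).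
- exact: (safe_loewner hP ha_lin hg hVg).
Qed.
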